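(* Let $(\mathcal M,\mathbf g,\mathrm W,U)$ be a Riemannian manifold together with a field $\mathrm W$ of $\mathbf g$-symmetric endomorphisms, with corresponding symmetric bilinear form $\mathrm{II}:=\mathbf g(\mathrm W\cdot,\cdot)$, and a (nowhere vanishing) vector field $U$ satisfying the constraint equation $$\nabla^{\mathbf g}U+u\,\mathrm W=0,\qquad\text{where } u^2:=\mathbf g(U,U),\ u>0 .$$ Then, for any positive smooth function $\lambda$ on $\mathbb R\times\mathcal M$, a triple $(\mathbf g_t,U_t,u_t)$ of smooth one-parameter families of Riemannian metrics, vector fields and (positive) functions on $\mathcal M$ defines a Lorentzian metric $$\overline{\mathbf g}=-\lambda^2dt^2+\mathbf g_t$$ on an open neighbourhood $\overline{\mathcal U}$ of $\{0\}\times\mathcal M$ in $\mathbb R\times\mathcal M$ with parallel null vector field $$V=\frac{u_t}{\lambda}\partial_t-U_t,$$ if and only if $\mathbf g_t$, $U_t$ and $u_t$ satisfy the following system of PDEs on $\overline{\mathcal U}$, for all $X,Y\in T\mathcal M$, $$\ddot{\mathbf g}_t(X,Y)=\frac{\lambda^2}{u_t}\,d^{\nabla^t}\!\Big(\frac{\dot{\mathbf g}_t}{\lambda}\Big)(U_t,Y,X)+\frac12\dot{\mathbf g}_t(X,\dot{\mathbf g}_t^\sharp(Y))+(\log\lambda)^{\textstyle\cdot}\,\dot{\mathbf g}_t(X,Y)+2\lambda\,\mathrm{Hess}^t(\lambda)(X,Y),$$ $$\begin{aligned}\mathbf g_t(\ddot U_t,X)=&-\frac{\lambda^2}{2u_t}\,d^{\nabla^t}\!\Big(\frac{\dot{\mathbf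 g}_t}{\lambda}\Big)(U_t,X,U_t)-\dot{\mathbf g}_t(\dot U_t,X)-\frac12(\log\lambda)^{\textstyle\cdot}\,\dot{\mathbf g}_t(U_t,X)-\lambda\,\mathrm{Hess}^t(\lambda)(U_t,X)\\&+u_t\,\mathbf g_t([\partial_t,\mathrm{grad}^t\lambda],X)+\frac{u_t}{2}\dot{\mathbf g}_t(\mathrm{grad}^t\lambda,X)+\big(2\dot u_t-d\lambda(U_t)\big)d\lambda(X),\end{aligned}$$ $$\ddot u_t=\mathbf g_t([\partial_t,\mathrm{grad}^t\lambda],U_t)+2\,d\lambda(\dot U_t)+\frac32\dot{\mathbf g}_t(\mathrm{grad}^t\lambda,U_t)-u_t\|\mathrm{grad}^t\lambda\|^2_{\mathbf g_t},$$ with the initial conditions $$\mathbf g_0=\mathbf g,\quad \dot{\mathbf g}_0=-2\lambda_0\mathrm{II},\quad U_0=U,\quad \dot U_0=u\,\mathrm{grad}^{\mathbf g}(\lambda_0)+\lambda_0\mathrm W(U),\quad u_0=u,\quad \dot u_0=d\lambda_0(U).$$ Here $\dot{\mathbf g}_t^\sharp$ denotes the metric dual of $\dot{\mathbf g}_t$, i.e. $\mathbf g_t(X,\dot{\mathbf g}_t^\sharp(Y))=\dot{\mathbf g}_t(X,Y)$, and in terms of the Weingarten operator $\mathrm W_t$ of $(\mathcal M,\mathbf g_t)$ one has $\dot{\mathbf g}_t(X,\dot{\mathbf g}_t^\sharp(Y))=4\lambda^2\mathbf g_t(\mathrm W_t(X),\mathrm W_t(Y))=-2\lambda\,\dot{\mathbf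 g}_t(\mathrm W_t(X),Y)$.
   Context: One-parameter families on $\mathcal M$ are regarded as objects on (open subsets of) $\mathbb R\times\mathcal M$ tangential to $\mathcal M$. $\nabla^{\mathbf g}$ and $\nabla^t$ are the Levi-Civita connections of $\mathbf g$ and $\mathbf g_t$; $\mathrm{grad}^t$ and $\mathrm{Hess}^t(f)=\nabla^tdf$ are taken on $\mathcal M$ with respect to $\mathbf g_t$. The Weingarten operator is $\mathrm W_t=-\overline\nabla T|_{T\mathcal M}$ with $T=\lambda^{-1}\partial_t$ and $\overline\nabla$ the Levi-Civita connection of $\overline{\mathbf g}$. Dots denote $t$-derivatives: $\dot{\mathbf g}_t=\mathcal L_{\partial_t}\mathbf g_t$ (so $\dot{\mathbf g}_t(X,Y)=\partial_t(\mathbf g_t(X,Y))$ for $t$-independent $X,Y$), $\dot U_t=[\partial_t,U_t]$, $\dot u_t=\partial_tu_t$, $(\log\lambda)^{\cdot}=\partial_t\log\lambda$; $\lambda_0=\lambda(0,\cdot)$. For a symmetric bilinear form $h$, $d^{\nabla}h(X,Y,Z)=(\nabla_Xh)(Y,Z)-(\nabla_Yh)(X,Z)$. A vector field $V$ is null if $\overline{\mathbf g}(V,V)=0$ and $V\neq0$; it is parallel if $\overline\nabla V=0$.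
   Formalization: The triple is required to extend the data (g_0 = g, U_0 = U) on the geometric side, and the ''if'' direction assumes each slice {t : (t,p) in the neighbourhood} is an interval; without these the equivalence fails. *)

(* Defs.v *)
From mathcomp Require Import all_boot all_order all_algebra.
From mathcomp Require Import all_classical all_reals all_analysis.
From mathcomp Require Import ring.
Set Implicit Arguments.
Unset Strict Implicit.
Unset Printing Implicit Defensive.
Import Order.TTheory GRing.Theory Num.Theory.
Import numFieldNormedType.Exports.
Local Open Scope classical_set_scope.
Local Open Scope ring_scope.

(* Conventions: tangent vectors are row vectors of components, a bilinear
   form is the matrix h of h(xi, eta) = xi *m h *m eta^T, and an endomorphism
   is a matrix acting on rows from the right. *)

Definition partial (R : realType) (m : nat) (V : normedModType R) (i : 'I_m)
  (f : 'rV[R]_m -> V) (x : 'rV[R]_m) : V := 'D_(delta_mx 0 i) f x.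

(* C^infinity on an open set A: every iterated partial derivative is Frechet
   differentiable at every point of A. *)
Definition smooth_on (R : realType) (m : nat) (V : normedModType R)
  (A : set 'rV[R]_m) (f : 'rV[R]_m -> V) : Prop :=
  forall (s : seq 'I_m) (x : 'rV[R]_m), A x ->
    differentiable (foldr (@partial R m V) f s) x.

Definition bil (R : realType) (m : nat) (h : 'M[R]_m) (xi eta : 'rV[R]_m) : R :=
  (xi *m h *m eta^T) 0 0.

(* the vector Z with A(X, Z) = h(X, Y) for all X *)
Definition sharp (R : realType) (m : nat) (A h : 'M[R]_m) (Y : 'rV[R]_m) :
  'rV[R]_m := (invmx A *m h *m Y^T)^T.

Definition christoffel (R : realType) (m : nat) (G : 'rV[R]_m -> 'M[R]_m)
  (x : 'rV[R]_m) (k i j : 'I_m) : R :=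
  2^-1 * \sum_l invmx (G x) k l *
    (partial i (fun y => G y j l) x + partial j (fun y => G y i l) x
     - partial l (fun y => G y i j) x).

Definition Gamma (R : realType) (m : nat) (G : 'rV[R]_m -> 'M[R]_m)
  (x xi eta : 'rV[R]_m) : 'rV[R]_m :=
  \row_k \sum_i \sum_j christoffel G x k i j * xi 0 i * eta 0 j.

(* Levi-Civita derivative of the vector field X in the direction xi *)
Definition nabla (R : realType) (m : nat) (G : 'rV[R]_m -> 'M[R]_m)
  (X : 'rV[R]_m -> 'rV[R]_m) (x xi : 'rV[R]_m) : 'rV[R]_m :=
  'D_xi X x + Gamma G x xi (X x).

(* (nabla_xi h)(eta, zeta) *)
Definition nabla_form (R : realType) (m : nat) (G h : 'rV[R]_m -> 'M[R]_m)
  (x xi eta zeta : 'rV[R]_m) : R :=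
  bil ('D_xi h x) eta zeta - bil (h x) (Gamma G x xi eta) zeta
  - bil (h x) eta (Gamma G x xi zeta).

Definition dnabla (R : realType) (m : nat) (G h : 'rV[R]_m -> 'M[R]_m)
  (x X Y Z : 'rV[R]_m) : R :=
  nabla_form G h x X Y Z - nabla_form G h x Y X Z.

Definition grad (R : realType) (m : nat) (G : 'rV[R]_m -> 'M[R]_m)
  (f : 'rV[R]_m -> R) (x : 'rV[R]_m) : 'rV[R]_m :=
  (\row_i partial i f x) *m invmx (G x).

(* (nabla df)(xi, eta) *)
Definition hess (R : realType) (m : nat) (G : 'rV[R]_m -> 'M[R]_m)
  (f : 'rV[R]_m -> R) (x xi eta : 'rV[R]_m) : R :=
  'D_xi (fun y => 'D_eta f y) x - 'D_(Gamma G x xi eta) f x.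

(* The Christoffel symbols are those of the only torsion-free metric
   connection. *)
Lemma christoffelP (R : realType) (m : nat) (G : 'rV[R]_m -> 'M[R]_m)
    (x : 'rV[R]_m) (C : 'I_m -> 'I_m -> 'I_m -> R) :
    (\forall y \near x, (G y)^T = G y) -> G x \in unitmx ->
  ((forall k i j, C k i j = C k j i) /\
   (forall i j l, partial i (fun y => G y j l) x =
      \sum_k (C k i j * G x k l + C k i l * G x j k))) <->
  (forall k i j, C k i j = christoffel G x k i j).
Proof.
move=> symG unitG.
have Gs i j : G x i j = G x j i.
  by have /matrixP/(_ i j) := nbhs_singleton symG; rewrite mxE.
have Ds l i j : partial l (fun y => G y i j) x = partial l (fun y => G y j i) x.
  apply: near_eq_derive; near=> y.
  have /matrixP/(_ j i) : (G y)^T = G y by near: y.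
  by rewrite mxE.
have contr (a : 'I_m -> R) l :
    \sum_k (\sum_r invmx (G x) k r * a r) * G x k l = a l.
  have -> : \sum_k (\sum_r invmx (G x) k r * a r) * G x k l
      = \sum_r a r * (G x *m invmx (G x)) l r.
    under eq_bigr do rewrite mulr_suml; rewrite exchange_big /=.
    apply: eq_bigr => r _; rewrite mxE mulr_sumr; apply: eq_bigr => k _.
    by rewrite (Gs k l); ring.
  rewrite mulmxV // (bigD1 l) //= mxE eqxx mulr1 big1 ?addr0 // => r rl.
  by rewrite mxE eq_sym (negbTE rl) mulr0.
have low i j l : \sum_k christoffel G x k i j * G x k l = 2^-1 *
    (partial i (fun y => G y j l) x + partial j (fun y => G y i l) x
     - partial l (fun y => G y i j) x).
  by under eq_bigr do rewrite /christoffel -mulrA; rewrite -mulr_sumr contr.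
split=> [[Cs Cm] k i j|CE].
  have lowC l : \sum_k C k i j * G x k l = 2^-1 *
      (partial i (fun y => G y j l) x + partial j (fun y => G y i l) x
       - partial l (fun y => G y i j) x).
    rewrite !Cm !big_split /=.
    under [X in _ + _ + (X + _) - _]eq_bigr do rewrite Cs.
    under [X in _ - (X + _)]eq_bigr do rewrite Cs.
    under [X in _ - (_ + X)]eq_bigr do rewrite Cs Gs.
    under [X in _ + X + (_ + _) - _]eq_bigr do rewrite Gs.
    under [X in _ + _ + (_ + X) - _]eq_bigr do rewrite Gs.
    set a := \sum_k _; set b := \sum_k C k i l * _; set c := \sum_k C k j l * _.
    have -> : a + b + (a + c) - (b + c) = 2 * a by rewrite mulr_natl mulr2n; ring.
    by rewrite mulrA mulVf ?mul1r // pnatr_eq0.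
  have CE (D : 'I_m -> R) :
      D k = \sum_l (\sum_r D r * G x r l) * invmx (G x) l k.
    under eq_bigr do rewrite mulr_suml; rewrite exchange_big /=.
    transitivity (\sum_r D r * (G x *m invmx (G x)) r k).
      rewrite mulmxV // (bigD1 k) //= mxE eqxx mulr1 big1 ?addr0 // => r rl.
      by rewrite mxE (negbTE rl) mulr0.
    apply: eq_bigr => r _; rewrite mxE mulr_sumr; apply: eq_bigr => l _.
    by rewrite mulrA.
  rewrite (CE (fun k => C k i j)) (CE (fun k => christoffel G x k i j)).
  by apply: eq_bigr => l _; rewrite lowC low.
split=> [k i j|i j l].
  rewrite !CE /christoffel; congr (_ * _); apply: eq_bigr => l _.
  by rewrite (addrC (partial i _ _)) (Ds l i j).
under eq_bigr do rewrite !CE (Gs j).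
rewrite big_split /= !low (Ds i l j) -mulrDr.
rewrite (_ : _ + _ = 2 * partial i (fun y => G y j l) x); last by ring.
by rewrite mulrA mulVf ?mul1r // pnatr_eq0.
Unshelve. all: by end_near.
Qed.

(* [cinv] is the inverse of [cfun] on [cfun @` cdom]; its values elsewhere
   are irrelevant. *)
Record chart (R : realType) (T : Type) (m : nat) := Chart {
  cdom : set T;
  cfun : T -> 'rV[R]_m;
  cinv : 'rV[R]_m -> T }.

Record manifold (R : realType) (n : nat) := Manifold {
  carrier :> topologicalType;
  chart_index : Type;
  charts : chart_index -> chart R carrier n;
  hausdorff_carrier : hausdorff_space carrier;
  second_countable_carrier : @second_countable carrier;
  charts_cover : forall p, exists c, cdom (charts c) p;
  open_cdom : forall c, open (cdom (charts c));
  open_cimage : forall c, open (cfun (charts c) @` cdom (charts c));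
  cfunK : forall c p, cdom (charts c) p ->
    cinv (charts c) (cfun (charts c) p) = p;
  cfun_continuous : forall c p, cdom (charts c) p ->
    {for p, continuous (cfun (charts c))};
  cinv_continuous : forall c x, (cfun (charts c) @` cdom (charts c)) x ->
    {for x, continuous (cinv (charts c))};
  charts_compatible : forall c d,
    smooth_on (cfun (charts c) @` (cdom (charts c) `&` cdom (charts d)))
      (cfun (charts d) \o cinv (charts c)) }.

(* Tensor fields on an open set D are given by their components in the charts
   of an atlas A, related on overlaps by the Jacobian of the transition map;
   'J is the matrix of the differential acting on row vectors. *)

Definition transition_jacobian (R : realType) (T I : Type) (m : nat)
  (A : I -> chart R T m) (c d : I) (p : T) : 'M[R]_m :=
  'J (cfun (A d) \o cinv (A c)) (cfun (A c) p).

Definition smooth_components (R : realType) (T I : Type) (m : nat)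
  (A : I -> chart R T m) (D : set T) (V : normedModType R)
  (F : I -> 'rV[R]_m -> V) : Prop :=
  forall c, smooth_on (cfun (A c) @` (cdom (A c) `&` D)) (F c).

Definition smooth_function (R : realType) (T I : Type) (m : nat)
  (A : I -> chart R T m) (D : set T) (f : T -> R) : Prop :=
  smooth_components A D (fun c => f \o cinv (A c)).

Definition vector_field (R : realType) (T I : Type) (m : nat)
  (A : I -> chart R T m) (D : set T) (X : I -> 'rV[R]_m -> 'rV[R]_m) : Prop :=
  smooth_components A D X /\
  forall c d p, D p -> cdom (A c) p -> cdom (A d) p ->
    X d (cfun (A d) p) = X c (cfun (A c) p) *m transition_jacobian A c d p.

Definition bilinear_field (R : realType) (T I : Type) (m : nat)
  (A : I -> chart R T m) (D : set T) (h : I -> 'rV[R]_m -> 'M[R]_m) : Prop :=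
  smooth_components A D h /\
  forall c d p, D p -> cdom (A c) p -> cdom (A d) p ->
    h c (cfun (A c) p) = transition_jacobian A c d p *m h d (cfun (A d) p)
                           *m (transition_jacobian A c d p)^T.

Definition endomorphism_field (R : realType) (T I : Type) (m : nat)
  (A : I -> chart R T m) (D : set T) (W : I -> 'rV[R]_m -> 'M[R]_m) : Prop :=
  smooth_components A D W /\
  forall c d p, D p -> cdom (A c) p -> cdom (A d) p ->
    W c (cfun (A c) p) *m transition_jacobian A c d p =
    transition_jacobian A c d p *m W d (cfun (A d) p).

Definition positive_definite (R : realType) (m : nat) (h : 'M[R]_m) : Prop :=
  h^T = h /\ forall xi, xi != 0 -> 0 < bil h xi xi.

(* signature (-, +, ..., +) *)
Definition lorentzian (R : realType) (n : nat) (h : 'M[R]_(1 + n)) : Prop :=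
  h^T = h /\
  exists2 P, P \in unitmx & P *m h *m P^T = block_mx (-1)%:M 0 0 1%:M.

Definition riemannian_metric (R : realType) (T I : Type) (m : nat)
  (A : I -> chart R T m) (D : set T) (g : I -> 'rV[R]_m -> 'M[R]_m) : Prop :=
  bilinear_field A D g /\
  forall c p, D p -> cdom (A c) p -> positive_definite (g c (cfun (A c) p)).

Definition lorentzian_metric (R : realType) (T I : Type) (n : nat)
  (A : I -> chart R T (1 + n)) (D : set T)
  (g : I -> 'rV[R]_(1 + n) -> 'M[R]_(1 + n)) : Prop :=
  bilinear_field A D g /\
  forall c p, D p -> cdom (A c) p -> lorentzian (g c (cfun (A c) p)).

Definition null_field (R : realType) (T I : Type) (m : nat)
  (A : I -> chart R T m) (D : set T) (g : I -> 'rV[R]_m -> 'M[R]_m)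
  (X : I -> 'rV[R]_m -> 'rV[R]_m) : Prop :=
  forall c p, D p -> cdom (A c) p -> let x := cfun (A c) p in
    bil (g c x) (X c x) (X c x) = 0 /\ X c x != 0.

Definition parallel_field (R : realType) (T I : Type) (m : nat)
  (A : I -> chart R T m) (D : set T) (g : I -> 'rV[R]_m -> 'M[R]_m)
  (X : I -> 'rV[R]_m -> 'rV[R]_m) : Prop :=
  forall c p, D p -> cdom (A c) p -> forall xi,
    nabla (g c) (X c) (cfun (A c) p) xi = 0.

Definition tcoord (R : realType) (n : nat) (y : 'rV[R]_(1 + n)) : R :=
  lsubmx y 0 0.

Definition xcoord (R : realType) (n : nat) (y : 'rV[R]_(1 + n)) : 'rV[R]_n :=
  rsubmx y.

Definition spacetime_charts (R : realType) (n : nat) (M : manifold R n)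
  (c : chart_index M) : chart R (R * M) (1 + n) :=
  {| cdom := [set q | cdom (charts c) q.2];
     cfun := fun q => row_mx q.1%:M (cfun (charts c) q.2);
     cinv := fun y => (tcoord y, cinv (charts c) (xcoord y)) |}.
Arguments spacetime_charts {R n} M c.

Definition local_rep (R : realType) (n : nat) (M : manifold R n)
  (f : R * M -> R) (c : chart_index M) (t : R) (x : 'rV[R]_n) : R :=
  f (t, cinv (charts c) x).

(* Componentwise time derivative in a product chart: the Lie derivative along
   d/dt, so that dt X stands for [d/dt, X] when X is a family of vector
   fields. *)
Definition dt (R : realType) (n : nat) (V : normedModType R)
  (f : R -> 'rV[R]_n -> V) (t : R) (x : 'rV[R]_n) : V :=
  derive1 (fun s => f s x) t.

(* One-parameter families on M are tensor fields on an open subset of R x M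
   that are tangential to M. *)

Definition vector_family (R : realType) (n : nat) (M : manifold R n)
  (D : set (R * M)) (X : chart_index M -> R -> 'rV[R]_n -> 'rV[R]_n) : Prop :=
  vector_field (spacetime_charts M) D
    (fun c y => row_mx 0 (X c (tcoord y) (xcoord y))).

Definition metric_family (R : realType) (n : nat) (M : manifold R n)
  (D : set (R * M)) (g : chart_index M -> R -> 'rV[R]_n -> 'M[R]_n) : Prop :=
  bilinear_field (spacetime_charts M) D
    (fun c y => block_mx 0 0 0 (g c (tcoord y) (xcoord y))) /\
  forall c t p, D (t, p) -> cdom (charts c) p ->
    positive_definite (g c t (cfun (charts c) p)).

Definition gbar (R : realType) (n : nat) (lam : R -> 'rV[R]_n -> R)
  (g : R -> 'rV[R]_n -> 'M[R]_n) (y : 'rV[R]_(1 + n)) : 'M[R]_(1 + n) :=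
  block_mx (- lam (tcoord y) (xcoord y) ^+ 2)%:M 0
           0 (g (tcoord y) (xcoord y)).

Definition Vbar (R : realType) (n : nat) (lam u : R -> 'rV[R]_n -> R)
  (U : R -> 'rV[R]_n -> 'rV[R]_n) (y : 'rV[R]_(1 + n)) : 'rV[R]_(1 + n) :=
  row_mx (u (tcoord y) (xcoord y) / lam (tcoord y) (xcoord y))%:M
         (- U (tcoord y) (xcoord y)).

Definition Tbar (R : realType) (n : nat) (lam : R -> 'rV[R]_n -> R)
  (y : 'rV[R]_(1 + n)) : 'rV[R]_(1 + n) :=
  row_mx ((lam (tcoord y) (xcoord y))^-1)%:M 0.

(* W_t(X) = - nabla_X T; this vector is tangential to M, since T has constant
   length. *)
Definition weingarten (R : realType) (n : nat) (lam : R -> 'rV[R]_n -> R)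
  (g : R -> 'rV[R]_n -> 'M[R]_n) (t : R) (x X : 'rV[R]_n) : 'rV[R]_n :=
  - rsubmx (nabla (gbar lam g) (Tbar lam) (row_mx t%:M x) (row_mx 0 X)).

Definition dt_log (R : realType) (n : nat) (lam : R -> 'rV[R]_n -> R) (t : R)
  (x : 'rV[R]_n) : R := dt (fun s y => ln (lam s y) : R) t x.

Definition dt_grad (R : realType) (n : nat) (g : R -> 'rV[R]_n -> 'M[R]_n)
  (lam : R -> 'rV[R]_n -> R) (t : R) (x : 'rV[R]_n) : 'rV[R]_n :=
  dt (fun s y => grad (g s) (lam s) y) t x.

Definition dnabla_dg (R : realType) (n : nat) (g : R -> 'rV[R]_n -> 'M[R]_n)
  (lam : R -> 'rV[R]_n -> R) (t : R) (x X Y Z : 'rV[R]_n) : R :=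
  dnabla (g t) (fun y => (lam t y)^-1 *: dt g t y) x X Y Z.

Definition metric_equation (R : realType) (n : nat)
  (g : R -> 'rV[R]_n -> 'M[R]_n) (U : R -> 'rV[R]_n -> 'rV[R]_n)
  (u lam : R -> 'rV[R]_n -> R) (t : R) (x : 'rV[R]_n) : Prop :=
  forall X Y : 'rV[R]_n,
    bil (dt (dt g) t x) X Y =
      lam t x ^+ 2 / u t x * dnabla_dg g lam t x (U t x) Y X
      + 1 / 2 * bil (dt g t x) X (sharp (g t x) (dt g t x) Y)
      + dt_log lam t x * bil (dt g t x) X Y
      + 2 * lam t x * hess (g t) (lam t) x X Y.

Definition vector_equation (R : realType) (n : nat)
  (g : R -> 'rV[R]_n -> 'M[R]_n) (U : R -> 'rV[R]_n -> 'rV[R]_n)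
  (u lam : R -> 'rV[R]_n -> R) (t : R) (x : 'rV[R]_n) : Prop :=
  forall X : 'rV[R]_n,
    bil (g t x) (dt (dt U) t x) X =
      - (lam t x ^+ 2 / (2 * u t x)) * dnabla_dg g lam t x (U t x) X (U t x)
      - bil (dt g t x) (dt U t x) X
      - 1 / 2 * dt_log lam t x * bil (dt g t x) (U t x) X
      - lam t x * hess (g t) (lam t) x (U t x) X
      + u t x * bil (g t x) (dt_grad g lam t x) X
      + u t x / 2 * bil (dt g t x) (grad (g t) (lam t) x) X
      + (2 * dt u t x - 'D_(U t x) (lam t) x) * 'D_X (lam t) x.

Definition scalar_equation (R : realType) (n : nat)
  (g : R -> 'rV[R]_n -> 'M[R]_n) (U : R -> 'rV[R]_n -> 'rV[R]_n)
  (u lam : R -> 'rV[R]_n -> R) (t : R) (x : 'rV[R]_n) : Prop :=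
  dt (dt u) t x =
    bil (g t x) (dt_grad g lam t x) (U t x)
    + 2 * 'D_(dt U t x) (lam t) x
    + 3 / 2 * bil (dt g t x) (grad (g t) (lam t) x) (U t x)
    - u t x * bil (g t x) (grad (g t) (lam t) x) (grad (g t) (lam t) x).

(* [g0], [W0], [U0] and [u0] are the data of the constraint equation on M. *)
Definition initial_conditions (R : realType) (n : nat)
  (g0 W0 : 'rV[R]_n -> 'M[R]_n) (U0 : 'rV[R]_n -> 'rV[R]_n)
  (u0 : 'rV[R]_n -> R)
  (g : R -> 'rV[R]_n -> 'M[R]_n) (U : R -> 'rV[R]_n -> 'rV[R]_n)
  (u lam : R -> 'rV[R]_n -> R) (x : 'rV[R]_n) : Prop :=
  [/\ g 0 x = g0 x /\
      (forall X Y, bil (dt g 0 x) X Y =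
                   - 2 * lam 0 x * bil (g0 x) (X *m W0 x) Y),
      U 0 x = U0 x,
      dt U 0 x = u0 x *: grad g0 (lam 0) x + lam 0 x *: (U0 x *m W0 x),
      u 0 x = u0 x &
      dt u 0 x = 'D_(U0 x) (lam 0) x].

Definition constraint_data (R : realType) (n : nat) (M : manifold R n)
  (g W : chart_index M -> 'rV[R]_n -> 'M[R]_n)
  (U : chart_index M -> 'rV[R]_n -> 'rV[R]_n) (u : M -> R) : Prop :=
  [/\ riemannian_metric (@charts R n M) setT g,
      endomorphism_field (@charts R n M) setT W,
      vector_field (@charts R n M) setT U &
      forall c p, cdom (charts c) p -> let x := cfun (charts c) p in
        [/\ forall X Y, bil (g c x) (X *m W c x) Y = bil (g c x) X (Y *m W c x),
            U c x != 0,
            0 < u p /\ u p ^+ 2 = bil (g c x) (U c x) (U c x) &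
            forall X, nabla (g c) (U c) x X + u p *: (X *m W c x) = 0]].

Definition smooth_families (R : realType) (n : nat) (M : manifold R n)
  (D : set (R * M)) (gt : chart_index M -> R -> 'rV[R]_n -> 'M[R]_n)
  (Ut : chart_index M -> R -> 'rV[R]_n -> 'rV[R]_n) (ut : R * M -> R) : Prop :=
  [/\ metric_family D gt, vector_family D Ut,
      smooth_function (spacetime_charts M) D ut &
      forall q, D q -> 0 < ut q].

(* - lambda^2 dt^2 + g_t is a Lorentzian metric on D, with parallel null
   vector field V, and it extends the data (g, U) given on M. *)
Definition parallel_null_extension (R : realType) (n : nat) (M : manifold R n)
  (D : set (R * M)) (lam : R * M -> R)
  (g : chart_index M -> 'rV[R]_n -> 'M[R]_n)
  (U : chart_index M -> 'rV[R]_n -> 'rV[R]_n)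
  (gt : chart_index M -> R -> 'rV[R]_n -> 'M[R]_n)
  (Ut : chart_index M -> R -> 'rV[R]_n -> 'rV[R]_n) (ut : R * M -> R) : Prop :=
  let G c := gbar (local_rep lam c) (gt c) in
  let V c := Vbar (local_rep lam c) (local_rep ut c) (Ut c) in
  [/\ lorentzian_metric (spacetime_charts M) D G,
      vector_field (spacetime_charts M) D V,
      null_field (spacetime_charts M) D G V,
      parallel_field (spacetime_charts M) D G V &
      forall c p, cdom (charts c) p -> let x := cfun (charts c) p in
        gt c 0 x = g c x /\ Ut c 0 x = U c x].

Definition evolution_system (R : realType) (n : nat) (M : manifold R n)
  (D : set (R * M)) (lam : R * M -> R)
  (g W : chart_index M -> 'rV[R]_n -> 'M[R]_n)
  (U : chart_index M -> 'rV[R]_n -> 'rV[R]_n) (u : M -> R)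
  (gt : chart_index M -> R -> 'rV[R]_n -> 'M[R]_n)
  (Ut : chart_index M -> R -> 'rV[R]_n -> 'rV[R]_n) (ut : R * M -> R) : Prop :=
  (forall c t p, D (t, p) -> cdom (charts c) p ->
     let x := cfun (charts c) p in
     let ul := local_rep ut c in let laml := local_rep lam c in
     [/\ metric_equation (gt c) (Ut c) ul laml t x,
         vector_equation (gt c) (Ut c) ul laml t x &
         scalar_equation (gt c) (Ut c) ul laml t x]) /\
  (forall c p, cdom (charts c) p ->
     initial_conditions (g c) (W c) (U c) (u \o cinv (charts c))
       (gt c) (Ut c) (local_rep ut c) (local_rep lam c) (cfun (charts c) p)).

(* Main.v *)
(* Write N for the covariant derivative of V along d/dt and B_X for the one
   along a vector X tangent to M.  The lowered components of N and B are first
   order expressions in (g, U, u), the "defects" below.  Modulo lower order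
   identities, the scalar and vector equations say that N is transported by a
   homogeneous linear ODE in t, and the metric equation says that the curvature
   R(d/dt, X) V vanishes, so that once N = 0, B is transported by a homogeneous
   linear ODE as well.  If V is parallel, all defects vanish on an open set and
   the three equations are read off.  Conversely, the initial conditions and the
   constraint make the defects vanish at t = 0, and uniqueness for linear ODEs
   along the slices {t | D (t, p)}, which are intervals, makes N, then B, vanish
   everywhere; finally g(U, U) - u^2 is constant in t. *)
Require Import Defs.
From mathcomp Require Import all_boot all_order all_algebra.
From mathcomp Require Import all_classical all_reals all_analysis.
From mathcomp Require Import ring lra.
Set Implicit Arguments.
Unset Strict Implicit.
Unset Printing Implicit Defensive.
Import Order.TTheory GRing.Theory Num.Theory.
Import numFieldNormedType.Exports.
Local Open Scope classical_set_scope.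
Local Open Scope ring_scope.

(** * Second derivatives and smooth functions *)

(** Write T for the unit normal and lambda for the lapse. All coefficients of the transport systems
    come from two formulas, valid for t-independent X: the derivative of T along d/dt is grad
    lambda, and that of X is half the sharp of the time derivative of the metric applied to X, plus
    dlambda(X) T. Given the metric equation, the scalar and vector equations say exactly that N is
    parallel along d/dt. The obstacle is the commutator: differentiating B_X along d/dt yields
    R(d/dt, X) V together with the derivative of N along X. This spatial derivative would make the
    system a genuine PDE. It drops out because N vanishes on the whole open set and not merely along
    one time line, which forces N to be treated before B and lets ordinary differential equations
    suffice. The converse carries information only from t = 0 along the lines of constant p, hence
    its hypothesis that the slices of D are intervals: the data say nothing about another component
    of a slice. Metric duals, gradients and Christoffel terms enter the defect computations only
    through their pairings with the metric, which keeps inverse matrices out of the algebra. *)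

Lemma derive_line (R : realType) (V W : normedModType R) (f : V -> W) (v c : V)
  (s : R) : 'D_1 (fun r : R => f (r *: v + c)) s = 'D_v f (s *: v + c).
Proof.
rewrite /derive; set a := fun h => h^-1 *: _; set b := fun h => h^-1 *: _.
suff -> : a = b by []; apply/funext => h.
by rewrite /a /b /= [h%:A]mulr1 scalerDl addrA.
Qed.

Lemma derivable_line (R : realType) (V W : normedModType R) (f : V -> W)
  (v c : V) (s : R) :
  derivable (fun r : R => f (r *: v + c)) s 1 = derivable f (s *: v + c) v.
Proof.
rewrite /derivable; set a := fun h => h^-1 *: _; set b := fun h => h^-1 *: _.
suff -> : a = b by []; apply/funext => h.
by rewrite /a /b /= [h%:A]mulr1 scalerDl addrA.
Qed.

Lemma is_derive_line (R : realType) (V W : normedModType R) (f : V -> W)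
  (v c : V) (s : R) : derivable f (s *: v + c) v ->
  is_derive s 1 (fun r : R => f (r *: v + c)) ('D_v f (s *: v + c)).
Proof.
by move=> df; apply: DeriveDef; rewrite ?derivable_line ?derive_line.
Qed.

(** Young's version of the symmetry argument: the mean value theorem in direction [v] turns the
    second difference into [h] times a difference of two values of ['D_v f], and each value is
    expanded to first order at [x]. Differentiability of ['D_v f] at the one point [x] controls both
    remainders. *)
Lemma mixed_difference (R : realType) (V : normedModType R) (f : V -> R)
  (x v w : V) (e : R) : (\forall y \near x, derivable f y v) ->
  differentiable ('D_v f) x -> 0 < e ->
  \forall h \near 0^'+, `|f (h *: v + (h *: w + x)) - f (h *: w + x)
    - (f (h *: v + x) - f x) - h ^+ 2 * 'D_w ('D_v f) x| <= e * h ^+ 2.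
Proof.
(* Each of the two remainders will be at most [e / k] times [h * (|v| + |w|)], so their sum is below
   [e * h]; the [+ 1] keeps [k] positive when both vectors vanish. *)
move=> df dF e0; set F := 'D_v f; set k := 2 * (`|v| + `|w|) + 1.
have k0 : 0 < k by rewrite /k ltr_wpDl // mulr_ge0 // addr_ge0.
have ek0 : 0 < e / k by rewrite divr_gt0.
have H1 : \forall z \near (0 : V), `|F (z + x) - (F x + 'd F x z)| <= e / k * `|z|.
  have := diff_locally dF => /eqaddoP /(_ _ ek0).
  by apply: filterS => z.
have H2 : \forall z \near (0 : V), derivable f (z + x) v.
  by move: df; rewrite (near_shift 0 x); apply: filterS => z; rewrite /= subr0.
have [d /= d0 Hd] : nbhs_ball (0 : V) (fun z =>
    `|F (z + x) - (F x + 'd F x z)| <= e / k * `|z| /\ derivable f (z + x) v).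
  by apply/nbhs_ballP; exact: filterI H1 H2.
near=> h.
have h0 : 0 < h by near: h; exact: nbhs_right_gt.
have hd : h < d / k by near: h; apply: nbhs_right_lt; rewrite divr_gt0.
have vw0 : 0 <= `|v| + `|w| by rewrite addr_ge0.
(* The boolean selects [s v + h w] or [s v], the two points at which [F] is expanded. *)
have small s (b : bool) : 0 <= s <= h ->
    `|s *: v + b%:R *: (h *: w)| <= h * (`|v| + `|w|).
  case/andP=> s0 sh; rewrite (le_trans (ler_normD _ _)) // mulrDr lerD //.
    by rewrite normrZ ger0_norm // ler_wpM2r.
  rewrite normrZ normrZ (ger0_norm (ltW h0)); case: b => /=.
    by rewrite normr1 mul1r.
  by rewrite normr0 mul0r mulr_ge0 // ltW.
have inb s (b : bool) : 0 <= s <= h -> ball 0 d (s *: v + b%:R *: (h *: w) : V).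
  move=> sh; rewrite -ball_normE /= sub0r normrN.
  apply: le_lt_trans (small s b sh) _.
  have : h * k < d by rewrite -ltr_pdivlMr.
  by apply: le_lt_trans; rewrite ler_wpM2l ?(ltW h0) ?(ltW ek0) // /k; lra.
pose phi s := f (s *: v + (h *: w + x)) - f (s *: v + x).
have dphi s : 0 <= s <= h ->
    is_derive s 1 phi (F (s *: v + (h *: w + x)) - F (s *: v + x)).
  move=> sh; apply: is_deriveB; apply: is_derive_line.
    have [_ ] := Hd _ (inb s true sh).
    by rewrite /= scale1r addrA.
  have [_ ] := Hd _ (inb s false sh).
  by rewrite /= scale0r addr0.
have dphi' s : s \in `]0, h[ ->
    is_derive s 1 phi (F (s *: v + (h *: w + x)) - F (s *: v + x)).
  by rewrite in_itv /= => /andP[/ltW s0 /ltW sh]; apply: dphi; rewrite s0.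
have cphi : {within `[0, h], continuous phi}.
  apply: derivable_within_continuous => s; rewrite in_itv /= => sh.
  by have [] := dphi s sh.
have [c] := MVT h0 dphi' cphi.
rewrite in_itv /= => /andP [c0 ch].
rewrite /phi !scale0r !add0r subr0.
have -> : f (h *: v + (h *: w + x)) - f (h *: w + x) - (f (h *: v + x) - f x)
  = f (h *: v + (h *: w + x)) - f (h *: v + x) - (f (h *: w + x) - f x) by ring.
move=> ->; rewrite (deriveE _ dF).
have sh : 0 <= c <= h by rewrite !ltW.
have [A1 _] := Hd _ (inb c true sh); have [A2 _] := Hd _ (inb c false sh).
have dD : 'd F x (c *: v + h *: w) = 'd F x (c *: v) + h * 'd F x w.
  by rewrite linearD /= [X in _ + X]linearZ.
move: A1 A2; rewrite /= scale1r scale0r addr0 dD -(addrA (c *: v)).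
set p := F _; set q := F (c *: v + x); set r := 'd F x (c *: v) => A1 A2.
have := small c true sh; have := small c false sh.
rewrite /= scale0r scale1r addr0 => B2 B1.
have -> : (p - q) * h - h ^+ 2 * 'd F x w =
   h * ((p - (F x + (r + h * 'd F x w))) - (q - (F x + r))) by ring.
have -> : e * h ^+ 2 = h * (e * h) by ring.
rewrite normrM (ger0_norm (ltW h0)) ler_wpM2l ?(ltW h0) ?(ltW ek0) //.
apply: le_trans (ler_normB _ _) _.
apply: le_trans (lerD A1 A2) _.
have -> : e * h = e / k * (h * k) by field; rewrite gt_eqF.
rewrite -mulrDr ler_wpM2l ?(ltW h0) ?(ltW ek0) //.
by apply: le_trans (lerD B1 B2) _; rewrite -mulrDr ler_wpM2l ?(ltW h0) ?(ltW ek0) // /k; lra.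
Unshelve. all: by end_near. Qed.

(** The second difference is symmetric in [v] and [w], so the two iterated derivatives approximate
    the same number; one small [h] serving both estimates bounds their distance by an arbitrary
    [e]. *)
Lemma derive_comm (R : realType) (V : normedModType R) (f : V -> R) (x v w : V) :
  (\forall y \near x, differentiable f y) ->
  differentiable ('D_v f) x -> differentiable ('D_w f) x ->
  'D_v ('D_w f) x = 'D_w ('D_v f) x.
Proof.
move=> df dv dw; apply/eqP; rewrite -subr_eq0 -normr_le0; apply/ler_addgt0Pl.
move=> e e0; rewrite addr0.
have e20 : 0 < e / 2 by rewrite divr_gt0.
have dfv z : \forall y \near x, derivable f y z.
  by apply: filterS df => y; exact: diff_derivable.
have Hv := mixed_difference w (dfv v) dv e20.
have Hw := mixed_difference v (dfv w) dw e20.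
have [h [[{}Hv {}Hw] /= h0]] :=
  filter_ex (filterI (filterI Hv Hw) (nbhs_right_gt (0 : R))).
have h2 : 0 < h ^+ 2 by rewrite exprn_gt0.
move: Hv Hw; rewrite (addrCA (h *: w)); set a := f (_ + _); set b := f (_ + _).
set c := f (_ + _); set p := 'D_w _ _; set q := 'D_v _ _ => Hv Hw.
rewrite -(ler_pM2r h2) -{1}(ger0_norm (ltW h2)) -normrM.
have -> : (q - p) * h ^+ 2 = (a - b - (c - f x) - h ^+ 2 * p)
   - (a - c - (b - f x) - h ^+ 2 * q) by ring.
apply: le_trans (ler_normB _ _) _; apply: le_trans (lerD Hv Hw) _.
rewrite -mulrDl -splitr; exact: lexx.
Qed.

Lemma near_differentiable (R : realType) (V W : normedModType R) (f g : V -> W)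
  (x : V) : (\forall y \near x, f y = g y) -> differentiable f x ->
  differentiable g x.
Proof.
move=> fg df; have fgx : f x = g x by exact: nbhs_singleton fg.
have gx : g \o shift x = cst (g x) + 'd f x +o_ 0 id.
  apply/eqaddoP => e e0; have := diff_locally df => /eqaddoP /(_ _ e0).
  move: fg; rewrite (near_shift 0 x) => fg df'; near=> z.
  have : f (z + x) = g (z + x) by near: z; move: fg; apply: filterS => z /=; rewrite subr0.
  have : `|(f \o shift x - (cst (f x) + 'd f x)) z| <= e * `|z| by near: z.
  by rewrite !fctE /= fgx => + <-.
apply/diff_locallyP.
by rewrite (diff_unique (diff_continuous df) gx); split=> //; exact: diff_continuous.
Unshelve. all: by end_near. Qed.

Section smooth_on.
Variables (R : realType) (m : nat) (A : set 'rV[R]_m).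
Hypothesis openA : open A.

Lemma near_open (T : Type) (f g : 'rV[R]_m -> T) x : A x ->
  (forall y, A y -> f y = g y) -> \forall y \near x, f y = g y.
Proof.
move=> Ax fg; have : nbhs x A by exact: open_nbhs_nbhs.
by apply: filterS.
Qed.

(** Coinduction for smoothness: it is enough to exhibit a class of maps, differentiable on [A],
    whose partial derivatives agree on [A] with members of the class. Agreement on [A] suffices
    because [A] is open, so derivatives see only germs inside it. *)
Lemma smooth_on_coind (V : normedModType R) (P : ('rV[R]_m -> V) -> Prop) :
  (forall f, P f -> (forall x, A x -> differentiable f x) /\
     forall i, exists2 h, P h & forall x, A x -> partial i f x = h x) ->
  forall f, P f -> smooth_on A f.
Proof.
move=> PP f Pf s x Ax.
suff [h Ph fh] : exists2 h, P h &
    forall x, A x -> foldr (@partial R m V) f s x = h x.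
  apply: (@near_differentiable _ _ _ h); last by have [+ _] := PP _ Ph; apply.
  by apply: near_open => // y /fh.
elim: s {x Ax} => [|i s [h Ph sh]]; first by exists f.
have [_ /(_ i) [k Pk hk]] := PP _ Ph.
exists k => // x Ax; rewrite -hk //=; apply: near_eq_derive.
exact: near_open.
Qed.

Lemma smooth_on_diff (V : normedModType R) (f : 'rV[R]_m -> V) x :
  smooth_on A f -> A x -> differentiable f x.
Proof. by move=> /(_ [::] x). Qed.

Lemma smooth_on_derivable (V : normedModType R) (f : 'rV[R]_m -> V) x v :
  smooth_on A f -> A x -> derivable f x v.
Proof. by move=> fA Ax; apply: diff_derivable; exact: smooth_on_diff. Qed.

Lemma smooth_on_partial (V : normedModType R) (f : 'rV[R]_m -> V) i :
  smooth_on A f -> smooth_on A (partial i f).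
Proof. by move=> fA s x Ax; rewrite -foldr_rcons; exact: fA. Qed.

Lemma smooth_on_ext (V : normedModType R) (f g : 'rV[R]_m -> V) :
  (forall x, A x -> f x = g x) -> smooth_on A f -> smooth_on A g.
Proof.
move=> fg fA; apply: (smooth_on_coind (P := fun g =>
  exists2 f, smooth_on A f & forall x, A x -> f x = g x)); last by exists f.
move=> {f g fg fA} g [f fA fg]; split=> [x Ax|i].
  by apply: (@near_differentiable _ _ _ f); [exact: near_open|exact: smooth_on_diff].
exists (partial i f); last first.
  by move=> x Ax; apply: near_eq_derive; apply: near_open => // y /fg.
by exists (partial i f) => //; exact: smooth_on_partial.
Qed.

Lemma smooth_on_cst (V : normedModType R) (c : V) :
  smooth_on A (fun=> c : V).
Proof.
apply: (smooth_on_coind (P := fun f => exists c, f = cst c)); last by exists c.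
move=> _ [d ->]; split=> [x _|i]; first exact: differentiable_cst.
by exists (cst 0); [exists 0|move=> x _; rewrite /partial derive_cst].
Qed.

(* The partial derivatives of such an expression agree on A with such
   expressions, so a single induction gives all the closure properties. *)
Inductive smooth_expr : ('rV[R]_m -> R) -> Prop :=
| Smooth_base f of smooth_on A f : smooth_expr f
| Smooth_add f g of smooth_expr f & smooth_expr g : smooth_expr (f + g)
| Smooth_mul f g of smooth_expr f & smooth_expr g : smooth_expr (f * g)
| Smooth_inv f of smooth_expr f & (forall x, A x -> f x != 0) :
    smooth_expr (fun x => (f x)^-1).

Lemma smooth_exprP f : smooth_expr f -> smooth_on A f.
Proof.
apply: smooth_on_coind => {}f; elim=> {f}.
- move=> f fA; split=> [x Ax|i]; first exact: smooth_on_diff.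
  by exists (partial i f) => //; apply: Smooth_base; exact: smooth_on_partial.
- move=> f g _ [df fi] _ [dg gi]; split=> [x Ax|i].
    by apply: differentiableD; [exact: df|exact: dg].
  have [f' Pf' ff'] := fi i; have [g' Pg' gg'] := gi i.
  exists (f' + g'); first exact: Smooth_add.
  move=> x Ax; rewrite /partial deriveD; last 2 first.
  + by apply: diff_derivable; exact: df.
  + by apply: diff_derivable; exact: dg.
  by rewrite -[LHS]/(partial i f x + partial i g x) ff' ?gg'.
- move=> f g Pf [df fi] Pg [dg gi]; split=> [x Ax|i].
    by apply: differentiableM; [exact: df|exact: dg].
  have [f' Pf' ff'] := fi i; have [g' Pg' gg'] := gi i.
  exists (f * g' + g * f'); first by apply: Smooth_add; apply: Smooth_mul.
  move=> x Ax; rewrite /partial deriveM; last 2 first.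
  + by apply: diff_derivable; exact: df.
  + by apply: diff_derivable; exact: dg.
  by rewrite -[LHS]/(f x *: partial i g x + g x *: partial i f x) ff' ?gg'.
- move=> f Pf [df fi] f0; split=> [x Ax|i].
    by apply: differentiableV; [exact: df|exact: f0].
  have [f' Pf' ff'] := fi i.
  exists ((fun=> -1) * ((fun x => (f x)^-1) * (fun x => (f x)^-1) * f')).
    by do ! apply: Smooth_mul => //; [exact/Smooth_base/smooth_on_cst|
      exact: Smooth_inv..].
  move=> x Ax; rewrite /partial deriveV ?f0 //; last first.
    by apply: diff_derivable; exact: df.
  rewrite -[LHS]/(- f x ^- 2 * partial i f x) ff' // !fctE.
  by rewrite mulN1r -invfM -expr2 mulNr.
Qed.

Lemma smooth_onD (f g : 'rV[R]_m -> R) : smooth_on A f -> smooth_on A g ->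
  smooth_on A (fun x => f x + g x).
Proof. by move=> ? ?; apply: smooth_exprP; apply: Smooth_add; exact: Smooth_base. Qed.

Lemma smooth_onM (f g : 'rV[R]_m -> R) : smooth_on A f -> smooth_on A g ->
  smooth_on A (fun x => f x * g x).
Proof. by move=> ? ?; apply: smooth_exprP; apply: Smooth_mul; exact: Smooth_base. Qed.

Lemma smooth_onV (f : 'rV[R]_m -> R) : smooth_on A f ->
  (forall x, A x -> f x != 0) -> smooth_on A (fun x => (f x)^-1).
Proof. by move=> ? ?; apply: smooth_exprP; apply: Smooth_inv => //; exact: Smooth_base. Qed.

Lemma smooth_onN (f : 'rV[R]_m -> R) : smooth_on A f ->
  smooth_on A (fun x => - f x).
Proof.
move=> fA; apply: (@smooth_on_ext _ (fun x => -1 * f x)).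
  by move=> x _; rewrite mulN1r.
by apply: smooth_onM => //; exact: smooth_on_cst.
Qed.

Lemma smooth_on_sum (I : Type) (r : seq I) (P : pred I) (F : I -> 'rV[R]_m -> R) :
  (forall i, smooth_on A (F i)) -> smooth_on A (fun x => \sum_(i <- r | P i) F i x).
Proof.
move=> FA; elim: r => [|i r IH].
  by apply: (smooth_on_ext _ (smooth_on_cst 0)) => x _; rewrite big_nil.
have [Pi|nPi] := boolP (P i).
  by apply: (smooth_on_ext _ (smooth_onD (FA i) IH)) => x _; rewrite big_cons Pi.
by apply: (smooth_on_ext _ IH) => x _; rewrite big_cons (negbTE nPi).
Qed.

Lemma smooth_on_prod (I : Type) (r : seq I) (F : I -> 'rV[R]_m -> R) :
  (forall i, smooth_on A (F i)) -> smooth_on A (fun x => \prod_(i <- r) F i x).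
Proof.
move=> FA; elim: r => [|i r IH].
  apply: (@smooth_on_ext _ (fun=> 1 : R)); last exact: smooth_on_cst.
  by move=> x _; rewrite big_nil.
by apply: (smooth_on_ext _ (smooth_onM (FA i) IH)) => x _; rewrite big_cons.
Qed.

Lemma differentiable_mx p q (F : 'rV[R]_m -> 'M[R]_(p, q)) x :
  (forall i j, differentiable (fun y => F y i j : R) x) -> differentiable F x.
Proof.
move=> FA.
have -> : F = \sum_(k < p) \sum_(l < q) (fun y => F y k l *: delta_mx k l).
  apply/funext => y; rewrite fct_sumE [LHS]matrix_sum_delta.
  by apply: eq_bigr => k _; rewrite fct_sumE.
apply: differentiable_sum => k; apply: differentiable_sum => l.
exact: differentiableZl.
Qed.

Lemma derive_coef p q (F : 'rV[R]_m -> 'M[R]_(p, q)) x v i j :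
  derivable F x v -> 'D_v F x i j = 'D_v (fun y => F y i j : R) x.
Proof. by move=> dF; rewrite derive_mx // mxE. Qed.

(** Reduces matrix-valued smoothness to scalar smoothness, where the closure properties of
    [smooth_expr] are available. In both directions the coinductive class is stable because partial
    derivatives commute with taking entries. *)
Lemma smooth_on_mxP p q (F : 'rV[R]_m -> 'M[R]_(p, q)) :
  smooth_on A F <-> forall i j, smooth_on A (fun y => F y i j : R).
Proof.
split=> [FA i j|].
  apply: (smooth_on_coind (P := fun f => exists2 G : 'rV[R]_m -> 'M[R]_(p, q),
    smooth_on A G & f = fun y => G y i j)); last by exists F.
  move=> _ [G GA ->]; split=> [x Ax|k].
    apply: (@differentiable_comp _ _ _ _ G (fun M : 'M[R]_(p, q) => M i j : R)).
      exact: smooth_on_diff.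
    exact: differentiable_coord.
  exists (fun y => partial k G y i j).
    by exists (partial k G) => //; exact: smooth_on_partial.
  by move=> x Ax; rewrite /partial derive_coef //; exact: smooth_on_derivable.
apply: (smooth_on_coind (P := fun F : 'rV[R]_m -> 'M[R]_(p, q) =>
  forall i j, smooth_on A (fun y => F y i j : R))) => {}F FA; split=> [x Ax|k].
  by apply: differentiable_mx => i j; exact: smooth_on_diff.
exists (partial k F) => // i j.
apply: (smooth_on_ext _ (smooth_on_partial k (FA i j))) => x Ax.
rewrite /partial derive_coef //; apply: diff_derivable.
by apply: differentiable_mx => ? ?; exact: smooth_on_diff.
Qed.

Lemma derive_dir (V : normedModType R) (f : 'rV[R]_m -> V) x v :
  differentiable f x -> 'D_v f x = \sum_i v 0 i *: partial i f x.
Proof.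
move=> df; rewrite /partial deriveE // {1}(row_sum_delta v) linear_sum.
by apply: eq_bigr => i _; rewrite linearZ deriveE.
Qed.

Lemma smooth_on_derive_scalar (f : 'rV[R]_m -> R) v :
  smooth_on A f -> smooth_on A ('D_v f).
Proof.
move=> fA; apply: (@smooth_on_ext _ (fun x => \sum_i v 0 i * partial i f x)).
  by move=> x Ax; rewrite derive_dir //; exact: smooth_on_diff.
apply: smooth_on_sum => i; apply: smooth_onM; first exact: smooth_on_cst.
exact: smooth_on_partial.
Qed.

Lemma smooth_on_derive p q (F : 'rV[R]_m -> 'M[R]_(p, q)) v :
  smooth_on A F -> smooth_on A ('D_v F).
Proof.
move=> FA; apply/smooth_on_mxP => i j.
have /smooth_on_derive_scalar := (smooth_on_mxP F).1 FA i j => /(_ v).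
by apply: smooth_on_ext => x Ax; rewrite derive_coef //; exact: smooth_on_derivable.
Qed.

Lemma smooth_on_comm_scalar (f : 'rV[R]_m -> R) x v w : smooth_on A f -> A x ->
  'D_v ('D_w f) x = 'D_w ('D_v f) x.
Proof.
move=> fA Ax; apply: derive_comm.
- have : nbhs x A by exact: open_nbhs_nbhs.
  by apply: filterS => y; exact: smooth_on_diff.
- exact: smooth_on_diff (smooth_on_derive_scalar _ fA) Ax.
- exact: smooth_on_diff (smooth_on_derive_scalar _ fA) Ax.
Qed.

End smooth_on.

(** * Bilinear forms and derivatives of matrices *)

Section bil_algebra.
Variables (R : realType) (m : nat).
Implicit Types (h : 'M[R]_m) (a b : 'rV[R]_m).

Lemma bilDm h1 h2 a b : bil (h1 + h2) a b = bil h1 a b + bil h2 a b.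
Proof. by rewrite /bil mulmxDr mulmxDl mxE. Qed.

Lemma bilNm h a b : bil (- h) a b = - bil h a b.
Proof. by rewrite /bil mulmxN mulNmx mxE. Qed.

Lemma bilZm c h a b : bil (c *: h) a b = c * bil h a b.
Proof. by rewrite /bil -scalemxAr -scalemxAl mxE. Qed.

Lemma bilDl h a1 a2 b : bil h (a1 + a2) b = bil h a1 b + bil h a2 b.
Proof. by rewrite /bil !mulmxDl mxE. Qed.

Lemma bilNl h a b : bil h (- a) b = - bil h a b.
Proof. by rewrite /bil !mulNmx mxE. Qed.

Lemma bilZl c h a b : bil h (c *: a) b = c * bil h a b.
Proof. by rewrite /bil -!scalemxAl mxE. Qed.

Lemma bil0l h b : bil h 0 b = 0.
Proof. by rewrite /bil !mul0mx mxE. Qed.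

Lemma bil0m a b : bil (0 : 'M[R]_m) a b = 0.
Proof. by rewrite /bil mulmx0 mul0mx mxE. Qed.

Lemma bilDr h a b1 b2 : bil h a (b1 + b2) = bil h a b1 + bil h a b2.
Proof. by rewrite /bil raddfD /= mulmxDr mxE. Qed.

Lemma bilNr h a b : bil h a (- b) = - bil h a b.
Proof. by rewrite /bil raddfN /= mulmxN mxE. Qed.

Lemma bilZr c h a b : bil h a (c *: b) = c * bil h a b.
Proof. by rewrite /bil linearZ /= -scalemxAr mxE. Qed.

Lemma bil0r h a : bil h a 0 = 0.
Proof. by rewrite /bil trmx0 mulmx0 mxE. Qed.

Lemma bil_sumr h a (I : finType) (c : I -> R) (b : I -> 'rV[R]_m) :
  bil h a (\sum_i c i *: b i) = \sum_i c i * bil h a (b i).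
Proof.
elim/big_ind2 : _ => [|x1 x2 y1 y2 <- <-|i _]; first by rewrite bil0r.
  by rewrite bilDr.
by rewrite bilZr.
Qed.

Lemma bilC h a b : h^T = h -> bil h a b = bil h b a.
Proof.
move=> hT; transitivity ((a *m h *m b^T)^T 0 0); first by rewrite mxE.
by rewrite !trmx_mul trmxK hT mulmxA.
Qed.

Lemma bil_nondegenerate h a b : h \in unitmx ->
  (forall c, bil h a c = bil h b c) -> a = b.
Proof.
move=> hu hab; have : a *m h = b *m h.
  apply/rowP => j; have := hab (delta_mx 0 j).
  by rewrite /bil trmx_delta -!colE !mxE.
by move/(congr1 (mulmxr (invmx h))); rewrite /= !mulmxK.
Qed.

Lemma bil_sharp h k a b : h^T = h -> h \in unitmx ->
  bil h a (sharp h k b) = bil k a b.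
Proof. by move=> hT hu; rewrite /bil /sharp trmxK -!mulmxA mulKVmx. Qed.

Lemma bil_grad (G : 'rV[R]_m -> 'M[R]_m) f x X : differentiable f x ->
  G x \in unitmx -> bil (G x) (grad G f x) X = 'D_X f x.
Proof.
move=> df Gu; rewrite /bil /grad mulmxKV // derive_dir // mxE.
by apply: eq_bigr => i _; rewrite !mxE mulrC.
Qed.

End bil_algebra.

Section derive_mx.
Variables (R : realType) (V : normedModType R).
Implicit Types (x v : V).

Lemma is_derive_coef p q (F : V -> 'M[R]_(p, q)) (dF : 'M[R]_(p, q)) x v i j :
  is_derive x v F dF -> is_derive x v (fun y => F y i j : R) (dF i j).
Proof.
move=> [dF1 <-]; apply: DeriveDef; first by move: i j; apply/derivable_mxP.
by rewrite derive_mx // mxE.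
Qed.

Lemma is_derive_mx p q (F : V -> 'M[R]_(p, q)) (dF : 'M[R]_(p, q)) x v :
  (forall i j, is_derive x v (fun y => F y i j : R) (dF i j)) ->
  is_derive x v F dF.
Proof.
move=> H; have dF1 : derivable F x v by apply/derivable_mxP => i j; have [] := H i j.
apply: DeriveDef => //; rewrite derive_mx //; apply/matrixP => i j.
by rewrite mxE; have [] := H i j.
Qed.

Lemma is_derive_mulmx p q r (F : V -> 'M[R]_(p, q)) (G : V -> 'M[R]_(q, r))
    (dF : 'M[R]_(p, q)) (dG : 'M[R]_(q, r)) x v :
  is_derive x v F dF -> is_derive x v G dG ->
  is_derive x v (fun y => F y *m G y) (dF *m G x + F x *m dG).
Proof.
move=> HF HG; apply: is_derive_mx => i j.
have HFi k := is_derive_coef i k HF; have HGj k := is_derive_coef k j HG.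
have H := is_derive_sum (fun k => is_deriveM (HFi k) (HGj k)).
have -> : (fun y => (F y *m G y) i j) =
    \sum_(k < q) ((fun y => F y i k : R) * (fun y => G y k j : R)).
  by apply/funext => y; rewrite mxE fct_sumE.
apply: is_derive_eq H _; rewrite !mxE -big_split; apply: eq_bigr => k _ /=.
by rewrite addrC; congr (_ + _); exact: mulrC.
Qed.

Lemma is_derive_trmx p q (F : V -> 'M[R]_(p, q)) (dF : 'M[R]_(p, q)) x v :
  is_derive x v F dF -> is_derive x v (fun y => (F y)^T) dF^T.
Proof.
move=> HF; apply: is_derive_mx => i j; have := is_derive_coef j i HF.
rewrite mxE; congr is_derive; by apply/funext => y; rewrite mxE.
Qed.

Lemma is_derive_bil m (h : V -> 'M[R]_m) (a b : V -> 'rV[R]_m)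
    (dh : 'M[R]_m) (da db : 'rV[R]_m) x v :
  is_derive x v h dh -> is_derive x v a da -> is_derive x v b db ->
  is_derive x v (fun y => bil (h y) (a y) (b y))
    (bil dh (a x) (b x) + bil (h x) da (b x) + bil (h x) (a x) db).
Proof.
move=> Hh Ha Hb.
have H := is_derive_coef 0 0
  (is_derive_mulmx (is_derive_mulmx Ha Hh) (is_derive_trmx Hb)).
by apply: is_derive_eq H _; rewrite /bil mulmxDl !mxE; ring.
Qed.

Lemma is_derive_bil_cstr m (h : V -> 'M[R]_m) (a : V -> 'rV[R]_m) (b : 'rV[R]_m)
    (dh : 'M[R]_m) (da : 'rV[R]_m) x v :
  is_derive x v h dh -> is_derive x v a da ->
  is_derive x v (fun y => bil (h y) (a y) b) (bil dh (a x) b + bil (h x) da b).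
Proof.
move=> Hh Ha; apply: is_derive_eq (is_derive_bil Hh Ha (is_derive_cst b x v)) _.
by rewrite bil0r addr0.
Qed.

Lemma is_derive_bil_cstl m (h : V -> 'M[R]_m) (a : 'rV[R]_m) (b : V -> 'rV[R]_m)
    (dh : 'M[R]_m) (db : 'rV[R]_m) x v :
  is_derive x v h dh -> is_derive x v b db ->
  is_derive x v (fun y => bil (h y) a (b y)) (bil dh a (b x) + bil (h x) a db).
Proof.
move=> Hh Hb; apply: is_derive_eq (is_derive_bil Hh (is_derive_cst a x v) Hb) _.
by rewrite bil0l addr0.
Qed.

Lemma is_derive_bil_cst m (h : V -> 'M[R]_m) (a b : 'rV[R]_m)
    (dh : 'M[R]_m) x v :
  is_derive x v h dh -> is_derive x v (fun y => bil (h y) a b) (bil dh a b).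
Proof.
move=> Hh; apply: is_derive_eq (is_derive_bil_cstr b Hh (is_derive_cst a x v)) _.
by rewrite bil0l addr0.
Qed.

(** From here on the rules are stated for explicit functions, with ordinary ring products in place
    of scalings, so that derivatives of long expressions can be built by application and compared by
    [field]. *)
Lemma is_derive_add (f g : V -> R) (df dg : R) x v :
  is_derive x v f df -> is_derive x v g dg ->
  is_derive x v (fun y => f y + g y) (df + dg).
Proof. exact: is_deriveD. Qed.

Lemma is_derive_sub (f g : V -> R) (df dg : R) x v :
  is_derive x v f df -> is_derive x v g dg ->
  is_derive x v (fun y => f y - g y) (df - dg).
Proof. exact: is_deriveB. Qed.

Lemma is_derive_mul (f g : V -> R) (df dg : R) x v :
  is_derive x v f df -> is_derive x v g dg ->
  is_derive x v (fun y => f y * g y) (df * g x + f x * dg).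
Proof.
move=> Hf Hg; apply: is_derive_eq (is_deriveM Hf Hg) _.
by rewrite addrC; congr (_ + _); exact: mulrC.
Qed.

Lemma is_derive_const_mul c (f : V -> R) (df : R) x v :
  is_derive x v f df -> is_derive x v (fun y => c * f y) (c * df).
Proof.
move=> Hf; apply: is_derive_eq (is_derive_mul (is_derive_cst c x v) Hf) _.
by rewrite mul0r add0r.
Qed.

Lemma is_derive_inv (f : V -> R) (df : R) x v : f x != 0 ->
  is_derive x v f df -> is_derive x v (fun y => (f y)^-1) (- (f x ^- 2 * df)).
Proof.
move=> fx0 [df1 <-]; apply: DeriveDef; first exact: derivableV.
rewrite deriveV //; exact: mulNr.
Qed.

End derive_mx.

Lemma is_derive_smooth (R : realType) (m p q : nat) (A : set 'rV[R]_m)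
    (F : 'rV[R]_m -> 'M[R]_(p, q)) x v :
  smooth_on A F -> A x -> is_derive x v F ('D_v F x).
Proof.
by move=> FA Ax; apply: DeriveDef => //; exact: smooth_on_derivable FA Ax.
Qed.

Lemma is_derive_smooth_scalar (R : realType) (m : nat) (A : set 'rV[R]_m)
    (f : 'rV[R]_m -> R) x v :
  smooth_on A f -> A x -> is_derive x v f ('D_v f x).
Proof.
by move=> fA Ax; apply: DeriveDef => //; exact: smooth_on_derivable fA Ax.
Qed.

Lemma smooth_on_comm (R : realType) (m p q : nat) (A : set 'rV[R]_m)
    (F : 'rV[R]_m -> 'M[R]_(p, q)) x v w : open A ->
  smooth_on A F -> A x -> 'D_v ('D_w F) x = 'D_w ('D_v F) x.
Proof.
move=> oA FA Ax; apply/matrixP => i j.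
have dF z z' : derivable ('D_z F) x z'.
  exact: smooth_on_derivable (smooth_on_derive oA z FA) Ax.
have FAij := (smooth_on_mxP oA F).1 FA i j.
have E z : \forall y \near x, 'D_z F y i j = 'D_z (fun y => F y i j : R) y.
  apply: (near_open oA Ax) => y Ay.
  exact: (derive_coef i j (smooth_on_derivable (v := z) FA Ay)).
apply: (etrans (derive_coef i j (dF w v))); apply: esym.
apply: (etrans (derive_coef i j (dF v w))).
apply: (etrans (near_eq_derive _ (E v))); apply: esym.
apply: (etrans (near_eq_derive _ (E w))).
exact: (smooth_on_comm_scalar oA v w FAij Ax).
Qed.

(* The second term is the derivative along a frozen direction: only the first
   one sees the variation of [w]. *)
Lemma derive_along_scalar (R : realType) (m : nat) (A : set 'rV[R]_m)
    (f : 'rV[R]_m -> R) (w : 'rV[R]_m -> 'rV[R]_m) (dw : 'rV[R]_m) x v : open A ->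
  smooth_on A f -> A x -> is_derive x v w dw ->
  is_derive x v (fun y => 'D_(w y) f y) ('D_dw f x + 'D_(w x) ('D_v f) x).
Proof.
move=> oA fA Ax Hw.
have H := is_derive_sum (fun i => is_deriveM (is_derive_coef 0 i Hw)
  (is_derive_smooth_scalar v (smooth_on_partial i fA) Ax)).
apply: (near_eq_is_derive _ (is_derive_eq H _)).
  apply: (near_open oA) => // y Ay.
  by rewrite (derive_dir _ (smooth_on_diff fA Ay)) fct_sumE.
rewrite (derive_dir _ (smooth_on_diff fA Ax)).
rewrite (derive_dir _ (smooth_on_diff (smooth_on_derive_scalar oA v fA) Ax)).
rewrite -big_split; apply: eq_bigr => i _ /=.
have -> : 'D_v (partial i f) x = partial i ('D_v f) x.
  exact: (smooth_on_comm_scalar oA).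
rewrite addrC; congr (_ + _); exact: mulrC.
Qed.

Lemma derive_along (R : realType) (m p q : nat) (A : set 'rV[R]_m)
    (F : 'rV[R]_m -> 'M[R]_(p, q)) (w : 'rV[R]_m -> 'rV[R]_m) (dw : 'rV[R]_m) x v : open A ->
  smooth_on A F -> A x -> is_derive x v w dw ->
  is_derive x v (fun y => 'D_(w y) F y) ('D_dw F x + 'D_(w x) ('D_v F) x).
Proof.
move=> oA FA Ax Hw; apply: is_derive_mx => i j.
have FAij := (smooth_on_mxP oA F).1 FA i j.
have E z : \forall y \near x, 'D_z (fun y => F y i j : R) y = 'D_z F y i j.
  apply: (near_open oA Ax) => y Ay; apply: esym.
  exact: (derive_coef i j (smooth_on_derivable (v := z) FA Ay)).
have -> : ('D_dw F x + 'D_(w x) ('D_v F) x) i j =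
    'D_dw (fun y => F y i j : R) x + 'D_(w x) ('D_v (fun y => F y i j : R)) x.
  rewrite mxE; congr (_ + _).
    exact: (derive_coef i j (smooth_on_derivable (v := dw) FA Ax)).
  have dF := smooth_on_derivable (v := w x) (smooth_on_derive oA v FA) Ax.
  apply: (etrans (derive_coef i j dF)); apply: esym.
  exact: near_eq_derive (E v).
apply: near_eq_is_derive (derive_along_scalar oA FAij Ax Hw).
apply: (near_open oA Ax) => y Ay; apply: esym.
exact: (derive_coef i j (smooth_on_derivable (v := w y) FA Ay)).
Qed.

(** * Defects of parallelism and their time derivatives *)

Definition timev (R : realType) (n : nat) : 'rV[R]_(1 + n) := row_mx 1%:M 0.
Arguments timev {R n}.

Definition spacev (R : realType) (n : nat) (X : 'rV[R]_n) : 'rV[R]_(1 + n) :=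
  row_mx 0 X.

(* Up to sign and lapse factors, the components of the covariant derivative of
   V along d/dt and along M, tested against d/dt and M; they all vanish exactly
   where V is parallel (see [bil_nabla_Vbar]). *)
Section defects.
Variables (R : realType) (n : nat).
Variables (g : 'rV[R]_(1 + n) -> 'M[R]_n) (U : 'rV[R]_(1 + n) -> 'rV[R]_n).
Variables (u l : 'rV[R]_(1 + n) -> R).
Implicit Types (X Y Z : 'rV[R]_n) (y : 'rV[R]_(1 + n)).

(** The Christoffel symbol of the first kind of the slice metric: Koszul's formula for constant
    fields [X], [Z], paired with [Y]. *)
Definition lowered_gamma X Z Y y : R := 2^-1 *
  (bil ('D_(spacev X) g y) Z Y + bil ('D_(spacev Z) g y) X Y
   - bil ('D_(spacev Y) g y) X Z).

(** Minus the product of N with the unit normal. At t = 0 its vanishing is the initial condition on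
    the time derivative of [u]. *)
Definition defect_tt y : R := 'D_timev u y - 'D_(spacev (U y)) l y.

(** The product of N with [Y]. At t = 0, where the time derivative of the metric is -2 lambda II,
    its vanishing is the initial condition on the time derivative of [U]. *)
Definition defect_tx Y y : R :=
  u y * 'D_(spacev Y) l y - 2^-1 * bil ('D_timev g y) (U y) Y
  - bil (g y) ('D_timev U y) Y.

(** Equals du(X) + II(X, U), which is what differentiating u^2 = g(U, U) produces under the
    constraint equation. *)
Definition defect_xt X y : R :=
  'D_(spacev X) u y - 2^-1 * ((l y)^-1 * bil ('D_timev g y) X (U y)).

(** The constraint equation of the slice, paired with [Y]: the Weingarten term of the slice is the
    last one, as II is minus the time derivative of the metric divided by twice the lapse. *)
Definition defect_xx X Y y : R :=
  bil (g y) ('D_(spacev X) U y) Y + lowered_gamma X (U y) Y y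
  - 2^-1 * (u y * (l y)^-1 * bil ('D_timev g y) X Y).

Section evolution.
Local Opaque derive.
Variable O : set 'rV[R]_(1 + n).
Hypotheses (oO : open O) (sg : smooth_on O g) (sU : smooth_on O U)
  (su : smooth_on O u) (sl : smooth_on O l).
Hypotheses (gT : forall y, O y -> (g y)^T = g y)
  (u0 : forall y, O y -> u y != 0) (l0 : forall y, O y -> l y != 0).

Lemma derive_sym y v : O y -> ('D_v g y)^T = 'D_v g y.
Proof.
move=> Oy; have H := is_derive_smooth v sg Oy.
rewrite -[LHS](@derive_val _ _ _ _ _ _ _ (is_derive_trmx H)).
by apply: near_eq_derive; apply: (near_open oO Oy) => z /gT.
Qed.

Lemma derive2_sym y v w : O y -> ('D_w ('D_v g) y)^T = 'D_w ('D_v g) y.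
Proof.
move=> Oy; have H := is_derive_smooth w (smooth_on_derive oO v sg) Oy.
rewrite -[LHS](@derive_val _ _ _ _ _ _ _ (is_derive_trmx H)).
by apply: near_eq_derive; apply: (near_open oO Oy) => z /derive_sym.
Qed.

Lemma is_derive_spacev y v : O y ->
  is_derive y v (fun z => spacev (U z)) (spacev ('D_v U y)).
Proof.
move=> Oy; have H := is_derive_smooth v sU Oy.
apply: is_derive_mx => i j; rewrite /spacev.
case: (split_ordP j) => k ->.
  rewrite row_mxEl mxE.
  rewrite (_ : (fun _ => _) = cst 0); first exact: is_derive_cst.
  by apply/funext => z; rewrite row_mxEl mxE.
rewrite row_mxEr.
rewrite (_ : (fun _ => _) = (fun z => U z i k)); first exact: is_derive_coef.
by apply/funext => z; rewrite row_mxEr.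
Qed.

Lemma is_derive_defect_tt y v : O y -> is_derive y v defect_tt
  ('D_v ('D_timev u) y
   - ('D_(spacev ('D_v U y)) l y + 'D_(spacev (U y)) ('D_v l) y)).
Proof.
move=> Oy; apply: is_derive_sub.
  exact: is_derive_smooth_scalar (smooth_on_derive_scalar oO timev su) Oy.
exact: derive_along_scalar oO sl Oy (is_derive_spacev v Oy).
Qed.

Lemma is_derive_defect_tx Y y v : O y -> is_derive y v (defect_tx Y)
  ('D_v u y * 'D_(spacev Y) l y + u y * 'D_v ('D_(spacev Y) l) y
   - 2^-1 * (bil ('D_v ('D_timev g) y) (U y) Y + bil ('D_timev g y) ('D_v U y) Y)
   - (bil ('D_v g y) ('D_timev U y) Y + bil (g y) ('D_v ('D_timev U) y) Y)).
Proof.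
move=> Oy.
have Hg := is_derive_smooth v sg Oy.
have Hg' := is_derive_smooth v (smooth_on_derive oO timev sg) Oy.
have HU := is_derive_smooth v sU Oy.
have HU' := is_derive_smooth v (smooth_on_derive oO timev sU) Oy.
have Hu := is_derive_smooth_scalar v su Oy.
have Hl := is_derive_smooth_scalar v (smooth_on_derive_scalar oO (spacev Y) sl) Oy.
have H := is_derive_sub (is_derive_sub (is_derive_mul Hu Hl)
  (is_derive_const_mul 2^-1 (is_derive_bil_cstr Y Hg' HU))) (is_derive_bil_cstr Y Hg HU').
exact: H.
Qed.

Lemma is_derive_defect_xt X y v : O y -> is_derive y v (defect_xt X)
  ('D_v ('D_(spacev X) u) y
   - 2^-1 * (- (l y ^- 2 * 'D_v l y) * bil ('D_timev g y) X (U y)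
       + (l y)^-1 * (bil ('D_v ('D_timev g) y) X (U y)
                     + bil ('D_timev g y) X ('D_v U y)))).
Proof.
move=> Oy.
have Hg' := is_derive_smooth v (smooth_on_derive oO timev sg) Oy.
have HU := is_derive_smooth v sU Oy.
have Hu := is_derive_smooth_scalar v (smooth_on_derive_scalar oO (spacev X) su) Oy.
have Hl := is_derive_inv (l0 Oy) (is_derive_smooth_scalar v sl Oy).
have H := is_derive_sub Hu (is_derive_const_mul 2^-1
  (is_derive_mul Hl (is_derive_bil_cstl X Hg' HU))).
exact: H.
Qed.

Lemma is_derive_defect_xx X Y y v : O y -> is_derive y v (defect_xx X Y)
  (bil ('D_v g y) ('D_(spacev X) U y) Y
   + bil (g y) ('D_v ('D_(spacev X) U) y) Y
   + 2^-1 * (bil ('D_v ('D_(spacev X) g) y) (U y) Y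
       + bil ('D_(spacev X) g y) ('D_v U y) Y
       + bil ('D_(spacev ('D_v U y)) g y + 'D_(spacev (U y)) ('D_v g) y) X Y
       - (bil ('D_v ('D_(spacev Y) g) y) X (U y)
          + bil ('D_(spacev Y) g y) X ('D_v U y)))
   - 2^-1 * (('D_v u y * (l y)^-1 + u y * - (l y ^- 2 * 'D_v l y))
               * bil ('D_timev g y) X Y
             + u y * (l y)^-1 * bil ('D_v ('D_timev g) y) X Y)).
Proof.
move=> Oy.
have Hg := is_derive_smooth v sg Oy.
have Hgd w := is_derive_smooth v (smooth_on_derive oO w sg) Oy.
have HU := is_derive_smooth v sU Oy.
have HUX := is_derive_smooth v (smooth_on_derive oO (spacev X) sU) Oy.
have Hu := is_derive_smooth_scalar v su Oy.
have Hl := is_derive_inv (l0 Oy) (is_derive_smooth_scalar v sl Oy).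
have HgU := derive_along oO sg Oy (is_derive_spacev v Oy).
have H := is_derive_sub
  (is_derive_add (is_derive_bil_cstr Y Hg HUX)
    (is_derive_const_mul 2^-1
       (is_derive_sub (is_derive_add (is_derive_bil_cstr Y (Hgd (spacev X)) HU)
                                     (is_derive_bil_cst X Y HgU))
                      (is_derive_bil_cstl X (Hgd (spacev Y)) HU))))
  (is_derive_const_mul 2^-1
     (is_derive_mul (is_derive_mul Hu Hl) (is_derive_bil_cst X Y (Hgd timev)))).
exact: H.
Qed.

End evolution.
End defects.

(* [ring] and [field] compare atoms up to conversion, and the unifier then
   unfolds the limits inside [derive]; naming the atoms first avoids this. *)
Ltac abstract_derivatives :=
  repeat match goal with
  | |- context [@derive ?R ?V ?W ?f ?x ?v] =>
      let z := fresh "z" in generalize (@derive R V W f x v); intro z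
  end.

Ltac abstract_atoms :=
  repeat match goal with
  | |- context [bil ?h ?a ?b] =>
      let z := fresh "z" in generalize (bil h a b); intro z
  end; abstract_derivatives.

(** * Evolution of the four defects at one event *)

Section identities.
Variables (R : realType) (n : nat).
Variables (g : 'rV[R]_(1 + n) -> 'M[R]_n) (U : 'rV[R]_(1 + n) -> 'rV[R]_n).
Variables (u l : 'rV[R]_(1 + n) -> R).
Variable O : set 'rV[R]_(1 + n).
Hypotheses (oO : open O) (sg : smooth_on O g) (sU : smooth_on O U)
  (su : smooth_on O u) (sl : smooth_on O l).
Hypotheses (gT : forall y, O y -> (g y)^T = g y)
  (u0 : forall y, O y -> u y != 0) (l0 : forall y, O y -> l y != 0).
Variables (y : 'rV[R]_(1 + n)).
Hypothesis Oy : O y.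
Implicit Types (X Y Z A B C : 'rV[R]_n).

(** These stand for the Christoffel term, the metric dual of the time derivative of [g], the
    gradient of the lapse and its time derivative. They stay abstract, known only through their
    pairings with [g], so that the identities below become polynomial algebra. *)
Variables (Gam : 'rV[R]_n -> 'rV[R]_n -> 'rV[R]_n) (S : 'rV[R]_n -> 'rV[R]_n)
  (gr dgr : 'rV[R]_n).
Hypotheses (gamma_low : forall A B Z,
    bil (g y) (Gam A B) Z = lowered_gamma g A B Z y)
  (gamma_sym : forall A B, Gam A B = Gam B A)
  (sharp_low : forall Z Y, bil (g y) Z (S Y) = bil ('D_timev g y) Z Y)
  (grad_low : forall Z, bil (g y) gr Z = 'D_(spacev Z) l y)
  (dgrad_low : forall Z, bil (g y) dgr Z =
     'D_(spacev Z) ('D_timev l) y - bil ('D_timev g y) gr Z).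

(** The covariant derivative of the time derivative of [g] divided by the lapse, that is of -2 II,
    with the quotient rule carried out. Its skew part in [A], [B] is the Codazzi term of the
    equations. *)
Definition nabla_K A B C : R :=
  (l y)^-1 * bil ('D_(spacev A) ('D_timev g) y) B C
  - l y ^- 2 * 'D_(spacev A) l y * bil ('D_timev g y) B C
  - (l y)^-1 * bil ('D_timev g y) (Gam A B) C
  - (l y)^-1 * bil ('D_timev g y) B (Gam A C).

Definition hess_low X Y : R :=
  'D_(spacev X) ('D_(spacev Y) l) y - 'D_(spacev (Gam X Y)) l y.

Definition metric_residual X Y : R :=
  bil ('D_timev ('D_timev g) y) X Y
  - (l y ^+ 2 / u y * (nabla_K (U y) Y X - nabla_K Y (U y) X)
     + 2^-1 * bil ('D_timev g y) X (S Y)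
     + 'D_timev l y / l y * bil ('D_timev g y) X Y
     + 2 * l y * hess_low X Y).

Definition vector_residual X : R :=
  bil (g y) ('D_timev ('D_timev U) y) X
  - (- (l y ^+ 2 / (2 * u y)) * (nabla_K (U y) X (U y) - nabla_K X (U y) (U y))
     - bil ('D_timev g y) ('D_timev U y) X
     - 2^-1 * ('D_timev l y / l y) * bil ('D_timev g y) (U y) X
     - l y * hess_low (U y) X
     + u y * bil (g y) dgr X
     + u y / 2 * bil ('D_timev g y) gr X
     + (2 * 'D_timev u y - 'D_(spacev (U y)) l y) * 'D_(spacev X) l y).

Definition scalar_residual : R :=
  'D_timev ('D_timev u) y
  - (bil (g y) dgr (U y) + 2 * 'D_(spacev ('D_timev U y)) l y
     + 3 / 2 * bil ('D_timev g y) gr (U y) - u y * bil (g y) gr gr).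


Lemma sharp_sym X Y : bil ('D_timev g y) X (S Y) = bil ('D_timev g y) Y (S X).
Proof.
have dT := derive_sym oO sg gT timev Oy.
by rewrite (bilC X _ dT) (bilC Y _ dT) -!sharp_low (bilC _ _ (gT Oy)).
Qed.

Local Opaque derive timev spacev bil.

(** The residual is minus the product of T with the derivative of N along d/dt; the other term
    arises because the derivative of T along d/dt is the gradient of the lapse. *)
Lemma derive_time_defect_tt :
  'D_timev (defect_tt U u l) y = scalar_residual - defect_tx g U u l gr y.
Proof.
apply: (etrans (@derive_val _ _ _ _ _ _ _ (is_derive_defect_tt oO sU su sl timev Oy))).
rewrite /scalar_residual /defect_tx dgrad_low -(grad_low gr).
have -> : bil (g y) ('D_timev U y) gr = 'D_(spacev ('D_timev U y)) l y.
  by rewrite (bilC _ _ (gT Oy)) grad_low.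
have -> : bil ('D_timev g y) (U y) gr = bil ('D_timev g y) gr (U y).
  exact: (bilC _ _ (derive_sym oO sg gT timev Oy)).
by abstract_atoms; field.
Qed.

(** Differentiating the defect brings in the second time derivative of [g] applied to [U] and [X].
    The vector equation has it already replaced by means of the metric equation, whence half of
    [metric_residual (U y) X] and the factor -1/2 in front of its Codazzi term. *)
Lemma derive_time_defect_tx X : 'D_timev (defect_tx g U u l X) y =
  2^-1 * defect_tx g U u l (S X) y - defect_tt U u l y * 'D_(spacev X) l y
  - vector_residual X - 2^-1 * metric_residual (U y) X.
Proof.
apply: (etrans (@derive_val _ _ _ _ _ _ _ (is_derive_defect_tx oO sg sU su sl X timev Oy))).
have dT := derive_sym oO sg gT timev Oy.
rewrite /vector_residual /metric_residual /defect_tx /defect_tt dgrad_low.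
have -> : 'D_timev ('D_(spacev X) l) y = 'D_(spacev X) ('D_timev l) y.
  exact: (smooth_on_comm_scalar oO timev (spacev X) sl Oy).
have -> : 'D_(spacev (S X)) l y = bil ('D_timev g y) gr X.
  by rewrite -(grad_low (S X)) sharp_low.
rewrite (sharp_low ('D_timev U y) X).
move: (u0 Oy) (l0 Oy).
by abstract_atoms => uy ly; field; rewrite uy ly.
Qed.

(** The residual is the normal component of R(d/dt, X) V. It is the same residual with second
    argument [U] since R(d/dt, X) V is orthogonal to V, which ties its normal component to its [U]
    component. The [defect_tt] and [defect_tx] terms make up the derivative of N along [X]. *)
Lemma derive_time_defect_xt X : 'D_timev (defect_xt g U u l X) y =
  defect_xx g U u l X gr y + 'D_(spacev X) (defect_tt U u l) y
  + (2 * l y)^-1 * defect_tx g U u l (S X) y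
  - (2 * l y)^-1 * metric_residual X (U y).
Proof.
apply: (etrans (@derive_val _ _ _ _ _ _ _ (is_derive_defect_xt oO sg sU su sl l0 X timev Oy))).
have dT := derive_sym oO sg gT timev Oy.
have -> : 'D_(spacev X) (defect_tt U u l) y = 'D_(spacev X) ('D_timev u) y
   - ('D_(spacev ('D_(spacev X) U y)) l y + 'D_(spacev (U y)) ('D_(spacev X) l) y).
  exact: (@derive_val _ _ _ _ _ _ _ (is_derive_defect_tt oO sU su sl (spacev X) Oy)).
rewrite /metric_residual /defect_tx /defect_xx /hess_low -(gamma_low X (U y) gr).
have -> : 'D_timev ('D_(spacev X) u) y = 'D_(spacev X) ('D_timev u) y.
  exact: (smooth_on_comm_scalar oO timev (spacev X) su Oy).
have -> : 'D_(spacev (U y)) ('D_(spacev X) l) y = 'D_(spacev X) ('D_(spacev (U y)) l) y.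
  exact: (smooth_on_comm_scalar oO (spacev (U y)) (spacev X) sl Oy).
have -> : 'D_(spacev (S X)) l y = bil ('D_timev g y) X gr.
  by rewrite -(grad_low (S X)) sharp_low (bilC _ _ dT).
have toD Z : bil (g y) Z gr = 'D_(spacev Z) l y.
  by rewrite (bilC _ _ (gT Oy)) grad_low.
have dXU := toD ('D_(spacev X) U y).
rewrite (toD (Gam X (U y))).
have -> : bil (g y) ('D_timev U y) (S X) = bil ('D_timev g y) X ('D_timev U y).
  by rewrite sharp_low (bilC _ _ dT).
rewrite (sharp_sym X (U y)).
move: (u0 Oy) (l0 Oy) dXU.
by abstract_atoms => uy ly ->; field; rewrite uy ly.
Qed.

(** The tangential part of the same commutation: [u / (2 l)] times the residual is the product of
    R(d/dt, X) V with [Y], the second line and the [defect_tt] term come from the derivative of N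
    along [X], and the rest from differentiating [Y] along d/dt. *)
Lemma derive_time_defect_xx X Y : 'D_timev (defect_xx g U u l X Y) y =
  2^-1 * defect_xx g U u l X (S Y) y + 'D_(spacev Y) l y * defect_xt g U u l X y
  - 'D_(spacev X) (defect_tx g U u l Y) y + defect_tx g U u l (Gam X Y) y
  - (2 * l y)^-1 * defect_tt U u l y * bil ('D_timev g y) X Y
  - u y / (2 * l y) * metric_residual X Y.
Proof.
apply: (etrans (@derive_val _ _ _ _ _ _ _
  (is_derive_defect_xx oO sg sU su sl l0 X Y timev Oy))).
have dT := derive_sym oO sg gT timev Oy.
have dsT := derive2_sym oO sg gT timev _ Oy.
have -> := @derive_val _ _ _ _ _ _ _
  (is_derive_defect_tx oO sg sU su sl Y (spacev X) Oy).
rewrite /metric_residual /defect_tx /defect_tt /defect_xt /defect_xx /hess_low.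
rewrite /nabla_K bilDm (gamma_sym Y (U y)) (gamma_sym (U y) X) (gamma_sym Y X).
(* All relations between the atoms are collected first: equality of mixed derivatives, Koszul's
   formula, and symmetry of the forms. Once the atoms are variables, each relation solves for one of
   them and [subst] eliminates it. *)
move: (u0 Oy) (l0 Oy)
  (congr1 (fun w => bil (g y) w Y) (smooth_on_comm timev (spacev X) oO sU Oy))
  (congr1 (fun h => bil h (U y) Y) (smooth_on_comm timev (spacev X) oO sg Oy))
  (congr1 (fun h => bil h X (U y)) (smooth_on_comm timev (spacev Y) oO sg Oy))
  (esym (etrans (esym (gamma_low X (U y) (S Y))) (sharp_low (Gam X (U y)) Y)))
  (sharp_low ('D_(spacev X) U y) Y)
  (etrans (bilC ('D_timev U y) (Gam X Y) (gT Oy)) (gamma_low X Y ('D_timev U y)))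
  (bilC Y X (dsT (spacev (U y)))) (bilC Y X dT)
  (bilC Y (Gam X (U y)) dT)
  (bilC Y ('D_timev U y) (derive_sym oO sg gT (spacev X) Oy))
  (bilC (U y) X (dsT (spacev Y))) (bilC (U y) X dT) (bilC (U y) (Gam X Y) dT).
rewrite /lowered_gamma.
abstract_atoms.
move=> uy ly *; subst.
by field; rewrite uy ly.
Qed.

End identities.

(** * Linear ordinary differential equations *)

Lemma is_derive_bigsum (R : realType) (V : normedModType R) (I : Type)
    (r : seq I) (f : I -> V -> R) (df : I -> R) x v :
  (forall i, is_derive x v (f i) (df i)) ->
  is_derive x v (fun y => \sum_(i <- r) f i y) (\sum_(i <- r) df i).
Proof.
move=> Hf; elim: r => [|i r IH].
  rewrite big_nil (_ : (fun _ => _) = cst 0); first exact: is_derive_cst.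
  by apply/funext => y; rewrite big_nil.
rewrite big_cons (_ : (fun _ => _) = (fun y => f i y + \sum_(j <- r) f j y)).
  exact: is_derive_add.
by apply/funext => y; rewrite big_cons.
Qed.

(* The energy [\sum_k w k ^+ 2] satisfies [E' <= L * E], so [E * exp (- L s)]
   is nonincreasing. *)
Lemma linear_ode_zero (R : realType) (I : finType) (w : I -> R -> R)
    (a : I -> I -> R -> R) :
  (forall k (s : R), 0 <= s <= 1 ->
     is_derive s 1 (w k) (\sum_l a k l s * w l s)) ->
  (forall k l (s : R), 0 <= s <= 1 -> {for s, continuous (a k l)}) ->
  (forall k, w k 0 = 0) -> forall k, w k 1 = 0.
Proof.
move=> dw ca w0.
(* The coefficients are continuous on the compact interval, hence bounded there. *)
have [C HC] : exists C : I -> I -> R, forall k l (s : R), 0 <= s <= 1 ->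
    `|a k l s| <= C k l.
  have bound k l : exists c, forall s : R, 0 <= s <= 1 -> `|a k l s| <= c.
    have ck : {within `[0, 1], continuous (fun s => `|a k l s|)}.
      apply: continuous_in_subspaceT => s; rewrite inE /= in_itv /= => s01.
      apply: (@continuous_comp _ _ _ (a k l) (fun z : R => `|z|)); first exact: ca.
      exact: norm_continuous.
    have [c _ Hc] := EVT_max ler01 ck.
    by exists `|a k l c| => s s01; apply: Hc; rewrite in_itv.
  have /choice [C HC] : forall kl : I * I, exists c, forall s : R, 0 <= s <= 1 ->
    `|a kl.1 kl.2 s| <= c by move=> [k l]; exact: bound.
  by exists (fun k l => C (k, l)) => k l; exact: (HC (k, l)).
pose E s := \sum_k w k s * w k s.
pose dE s := \sum_k (2 * w k s * \sum_l a k l s * w l s).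
pose L := \sum_k \sum_l 2 * C k l.
have E_ge k s : w k s * w k s <= E s.
  rewrite /E (bigD1 k) //= lerDl; apply: sumr_ge0 => i _.
  by rewrite -expr2 sqr_ge0.
have dEP (s : R) : 0 <= s <= 1 -> is_derive s 1 E (dE s).
  move=> s01; apply: is_derive_eq (is_derive_bigsum _ (fun k =>
    is_derive_mul (dw k s s01) (dw k s s01))) _.
  by apply: eq_bigr => k _; ring.
have dE_le (s : R) : 0 <= s <= 1 -> dE s <= L * E s.
  move=> s01; rewrite /dE /L mulr_suml; apply: ler_sum => k _.
  rewrite mulr_sumr mulr_suml; apply: ler_sum => l _.
  apply: le_trans (ler_norm _) _.
  have -> : 2 * w k s * (a k l s * w l s) = a k l s * (2 * w k s * w l s) by ring.
  rewrite normrM.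
  have C0 : 0 <= C k l by apply: le_trans (HC k l s s01).
  (* The crude factor 2 on the right covers the diagonal case [k = l] together with the others. *)
  have : `|2 * w k s * w l s| <= 2 * E s.
    have := E_ge k s; have := E_ge l s.
    have := sqr_ge0 (w k s + w l s); have := sqr_ge0 (w k s - w l s).
    by rewrite !expr2 ler_norml; nra.
  move=> Hw; apply: le_trans (ler_pM _ _ (HC k l s s01) Hw) _ => //.
  by rewrite mulrCA mulrA.
pose F (s : R) := E s * expR (- L * s).
have dF (s : R) : 0 <= s <= 1 -> is_derive s 1 F ((dE s - L * E s) * expR (- L * s)).
  move=> s01; have He : is_derive s 1 (fun s => expR (- L * s)) (- L * expR (- L * s)).
    have Hl : is_derive s 1 (fun s : R => - L * s) (- L).
      apply: is_derive_eq (is_derive_const_mul (- L) (is_derive_id s 1)) _.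
      exact: mulr1.
    have H := @is_derive1_comp _ expR (fun s => - L * s) s _ _ (is_derive_expR _) Hl.
    by apply: is_derive_eq H _; rewrite mulrC.
  by apply: is_derive_eq (is_derive_mul (dEP s s01) He) _; ring.
have cF : {within `[0, 1], continuous F}.
  apply: derivable_within_continuous => s; rewrite in_itv /= => s01.
  by have [] := dF s s01.
have F10 : F 1 <= F 0.
  have oo (s : R) : s \in `]0, 1[ -> 0 <= s <= 1.
    by rewrite in_itv /= => /andP [/ltW -> /ltW].
  apply: (@ler0_derive1_le_cc _ F 0 1) => //; rewrite ?in_itv /= ?lexx ?ler01 //.
    by move=> s /oo /dF [].
  move=> s /oo s01; have dFs := dF s s01; rewrite derive1E derive_val.
  by rewrite pmulr_lle0 ?expR_gt0 // subr_le0 dE_le.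
have E0 : E 0 = 0 by apply: big1 => k _; rewrite w0 mulr0.
have E1 : E 1 <= 0.
  move: F10; rewrite /F E0 mul0r => F10.
  by rewrite -(pmulr_lle0 _ (expR_gt0 (- L * 1))).
move=> k; apply/eqP; rewrite -sqrf_eq0 -normr_le0 normrX.
by rewrite -normrX ger0_norm ?sqr_ge0 // expr2 (le_trans (E_ge k 1)).
Qed.

Lemma is_derive_scale (R : realType) (V : normedModType R) (f : V -> R) (df : R)
    x v (c : R) : is_derive x v f df -> is_derive x (c *: v) f (c * df).
Proof.
move=> [dfv <-].
have Hl : is_derive (0 : R) 1 (fun r : R => f (r *: v + x)) ('D_v f x).
  have {}dfv : derivable f ((0 : R) *: v + x) v by rewrite scale0r add0r.
  by have := is_derive_line dfv; rewrite scale0r add0r.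
have Hc : is_derive (0 : R) 1 (fun r : R => c * r) c.
  by apply: is_derive_eq (is_derive_const_mul c (is_derive_id (0 : R) 1)) _; exact: mulr1.
have Hl' : is_derive (c * 0) 1 (fun r : R => f (r *: v + x)) ('D_v f x).
  by rewrite mulr0.
have H := @is_derive1_comp _ (fun r : R => f (r *: v + x)) (fun r => c * r) 0 _ _ Hl' Hc.
have E : (fun r : R => f (r *: (c *: v) + x)) =
    (fun r : R => f (r *: v + x)) \o (fun r => c * r).
  by apply/funext => r; rewrite /= scalerA mulrC.
rewrite -E in H; have [H1 H2] := H.
have x0 : x = (0 : R) *: (c *: v) + x by rewrite scale0r add0r.
apply: DeriveDef; first by rewrite x0 -derivable_line.
by rewrite [X in 'D__ _ X]x0 -derive_line H2 mulrC.
Qed.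

(** The segment from [x] to [t e + x] is parametrised by [0, 1], which multiplies the coefficients
    by [t]; positive and negative times are thus treated alike. *)
Lemma linear_transport_zero (R : realType) (m : nat) (I : finType)
    (O : set 'rV[R]_m) (F : I -> 'rV[R]_m -> R) (a : I -> I -> 'rV[R]_m -> R)
    (e x : 'rV[R]_m) (t : R) :
  (forall s, 0 <= s <= 1 -> O (s *: (t *: e) + x)) ->
  (forall k y, O y -> is_derive y e (F k) (\sum_l a k l y * F l y)) ->
  (forall k l y, O y -> differentiable (a k l) y) ->
  (forall k, F k x = 0) -> forall k, F k (t *: e + x) = 0.
Proof.
move=> HO HF da F0 k.
pose w k s := F k (s *: (t *: e) + x).
pose b k l s := t * a k l (s *: (t *: e) + x).
suff : w k 1 = 0 by rewrite /w scale1r.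
apply: (linear_ode_zero (w := w) (a := b)).
- move=> i s s01; have [dFs Fs] := is_derive_scale t (HF i _ (HO s s01)).
  have H : is_derive s 1 (w i) ('D_(t *: e) (F i) (s *: (t *: e) + x)).
    exact: is_derive_line.
  apply: is_derive_eq H _; rewrite Fs mulr_sumr.
  by apply: eq_bigr => l _; rewrite /b mulrA.
- move=> i l s s01; have das := da i l _ (HO s s01).
  have H : is_derive s 1 (fun r : R => a i l (r *: (t *: e) + x))
      ('D_(t *: e) (a i l) (s *: (t *: e) + x)).
    by apply: is_derive_line; exact: diff_derivable.
  have [dH _] := is_derive_const_mul t H.
  by apply: differentiable_continuous; apply/derivable1_diffP.
- by move=> i; rewrite /w scale0r add0r.
Qed.

(** * Spacetime coordinates in a chart *)

(** Lowering the index cancels the inverse matrix in the Christoffel symbols and leaves Koszul's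
    formula for constant vectors. *)
Lemma bil_Gamma (R : realType) (m : nat) (G : 'rV[R]_m -> 'M[R]_m) x a b c :
  (\forall y \near x, (G y)^T = G y) -> G x \in unitmx -> differentiable G x ->
  bil (G x) (Gamma G x a b) c =
  2^-1 * (bil ('D_a G x) b c + bil ('D_b G x) a c - bil ('D_c G x) a b).
Proof.
move=> symG unitG dG; have Gx := nbhs_singleton symG.
have Dv v i j : 'D_v G x i j = \sum_k v 0 k * partial k (fun y => G y i j) x.
  rewrite (derive_dir _ dG) summxE; apply: eq_bigr => k _.
  by rewrite mxE /partial derive_coef //; exact: diff_derivable.
pose E l := 'D_(delta_mx 0 l) G x.
have Dc : 'D_c G x = \sum_l c 0 l *: E l by rewrite (derive_dir _ dG).
have El l i j : E l i j = partial l (fun y => G y i j) x.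
  by rewrite /E /partial derive_coef //; exact: diff_derivable.
rewrite Dc; move: (Dv a) (Dv b) El; clear Dc; move: ('D_a G x) ('D_b G x) E.
move=> A B E Da Db El {Dv}.
(* The covector on the right-hand side, of which [Gamma] is the metric dual; symmetry of the inverse
   matrix is used to identify the two. *)
pose low : 'rV[R]_m := \row_l (2^-1 * ((b *m A) 0 l + (a *m B) 0 l
  - bil (E l) a b)).
have -> : Gamma G x a b = low *m invmx (G x).
  apply/rowP => k; rewrite !mxE.
  transitivity (\sum_l (invmx (G x) k l * low 0 l)).
    rewrite /christoffel /low; under [RHS]eq_bigr do rewrite mxE.
    transitivity (\sum_i \sum_j \sum_l invmx (G x) k l * (2^-1 *
      (partial i (fun y => G y j l) x + partial j (fun y => G y i l) x
       - partial l (fun y => G y i j) x) * (a 0 i * b 0 j))).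
      apply: eq_bigr => i _; apply: eq_bigr => j _.
      rewrite -mulrA mulrAC mulr_sumr.
      by apply: eq_bigr => l _; ring.
    transitivity (\sum_l \sum_i \sum_j invmx (G x) k l * (2^-1 *
      (partial i (fun y => G y j l) x + partial j (fun y => G y i l) x
       - partial l (fun y => G y i j) x) * (a 0 i * b 0 j))).
      rewrite [RHS]exchange_big; apply: eq_bigr => i _; exact: exchange_big.
    apply: eq_bigr => l _.
    under eq_bigr do rewrite -mulr_sumr; rewrite -mulr_sumr; congr (_ * _).
    have -> : (b *m A) 0 l =
        \sum_i \sum_j partial i (fun y => G y j l) x * (a 0 i * b 0 j).
      rewrite mxE exchange_big; apply: eq_bigr => j _ /=; rewrite Da mulr_sumr.
      by apply: eq_bigr => i _; ring.
    have -> : (a *m B) 0 l =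
        \sum_i \sum_j partial j (fun y => G y i l) x * (a 0 i * b 0 j).
      rewrite mxE; apply: eq_bigr => i _ /=; rewrite Db mulr_sumr.
      by apply: eq_bigr => j _; ring.
    have -> : bil (E l) a b =
        \sum_i \sum_j partial l (fun y => G y i j) x * (a 0 i * b 0 j).
      rewrite /bil mxE exchange_big; apply: eq_bigr => j _ /=; rewrite !mxE mulr_suml.
      by apply: eq_bigr => i _; rewrite El; ring.
    rewrite -!big_split -sumrB mulr_sumr /=; apply: eq_bigr => i _.
    rewrite -!big_split -sumrB mulr_sumr /=; apply: eq_bigr => j _; ring.
  apply: eq_bigr => l _; rewrite mulrC; congr (_ * _).
  by rewrite -{1}Gx -trmx_inv mxE.
rewrite /bil mulmxKV // mxE.
rewrite /low; under eq_bigr do rewrite !mxE.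
have -> : (b *m A *m c^T) 0 0 = \sum_l (b *m A) 0 l * c 0 l.
  by rewrite mxE; apply: eq_bigr => l _; rewrite !mxE.
have -> : (a *m B *m c^T) 0 0 = \sum_l (a *m B) 0 l * c 0 l.
  by rewrite mxE; apply: eq_bigr => l _; rewrite !mxE.
have -> : (a *m (\sum_l c 0 l *: E l) *m b^T) 0 0 =
    \sum_l bil (E l) a b * c 0 l.
  rewrite mulmx_sumr mulmx_suml summxE; apply: eq_bigr => l _.
  by rewrite -[LHS]/(bil _ _ _) bilZm mulrC.
rewrite -big_split -sumrB mulr_sumr /=; apply: eq_bigr => l _.
by rewrite !mxE; ring.
Qed.

(** Regarding a family as a map of one row vector turns [dt] and the derivatives along a slice into
    directional derivatives of the same map, to which equality of mixed derivatives applies. *)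
Definition spacetime (R : realType) (n : nat) (V : Type)
  (F : R -> 'rV[R]_n -> V) (y : 'rV[R]_(1 + n)) : V := F (tcoord y) (xcoord y).

Definition event (R : realType) (n : nat) (t : R) (x : 'rV[R]_n) :
  'rV[R]_(1 + n) := row_mx t%:M x.

Section spacetime.
Variables (R : realType) (n : nat).
Implicit Types (t : R) (x : 'rV[R]_n) (y : 'rV[R]_(1 + n)).

Lemma tcoord_row (a : 'M[R]_1) x : tcoord (row_mx a x) = a 0 0.
Proof. by rewrite /tcoord row_mxKl. Qed.

Lemma xcoord_row (a : 'M[R]_1) x : xcoord (row_mx a x) = x.
Proof. by rewrite /xcoord row_mxKr. Qed.

Lemma tcoord_event t x : tcoord (event t x) = t.
Proof. by rewrite tcoord_row mxE eqxx mulr1n. Qed.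

Lemma xcoord_event t x : xcoord (event t x) = x.
Proof. by rewrite xcoord_row. Qed.

Lemma event_coord y : event (tcoord y) (xcoord y) = y.
Proof. by rewrite /event /tcoord -mx11_scalar hsubmxK. Qed.

Lemma eventD t s x z : event t x + event s z = event (t + s) (x + z).
Proof. by rewrite /event add_row_mx raddfD. Qed.

Lemma eventZ (c : R) t x : c *: event t x = event (c * t) (c *: x).
Proof. by rewrite /event scale_row_mx scale_scalar_mx. Qed.

Lemma timevE : timev = event 1 0 :> 'rV[R]_(1 + n).
Proof. by []. Qed.

Lemma spacevE x : spacev x = event 0 x.
Proof. by rewrite /event /spacev raddf0. Qed.

Lemma event_decomp t x : event t x = t *: timev + spacev x.
Proof. by rewrite timevE spacevE eventZ eventD mulr1 addr0 scaler0 add0r. Qed.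

Lemma spacetime_event (V : Type) (F : R -> 'rV[R]_n -> V) t x :
  spacetime F (event t x) = F t x.
Proof. by rewrite /spacetime tcoord_event xcoord_event. Qed.

Variable V : normedModType R.
Implicit Types F : R -> 'rV[R]_n -> V.

(** The two difference quotients are the same function of [h], so the limits agree as they stand;
    the same holds for [dtE]. *)
Lemma derive_space F t x a :
  'D_a (F t) x = 'D_(spacev a) (spacetime F) (event t x).
Proof.
rewrite /derive; set p := fun h => h^-1 *: _; set q := fun h => h^-1 *: _.
suff -> : p = q by []; apply/funext => h; rewrite /p /q /=.
by rewrite spacevE eventZ eventD mulr0 add0r !spacetime_event.
Qed.

Lemma dtE F t x : dt F t x = 'D_timev (spacetime F) (event t x).
Proof.
rewrite /dt /derive1 /derive.
set p := fun h => h^-1 *: _; set q := fun h => h^-1 *: _.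
suff -> : p = q by []; apply/funext => h; rewrite /p /q /=.
by rewrite timevE eventZ eventD mulr1 scaler0 add0r !spacetime_event.
Qed.

Lemma spacetime_derive F a :
  spacetime (fun t x => 'D_a (F t) x) = 'D_(spacev a) (spacetime F).
Proof. by apply/funext => y; rewrite /spacetime derive_space event_coord. Qed.

Lemma spacetime_dt F : spacetime (dt F) = 'D_timev (spacetime F).
Proof. by apply/funext => y; rewrite /spacetime dtE event_coord. Qed.

Lemma differentiable_event t x : differentiable (event t : 'rV[R]_n -> _) x.
Proof.
apply: differentiable_mx => i j.
case: (split_ordP j) => k ->.
  rewrite (_ : (fun _ => _) = cst (t%:M i k)); first exact: differentiable_cst.
  by apply/funext => z; rewrite row_mxEl.
rewrite (_ : (fun _ => _) = (fun z : 'rV[R]_n => z i k)).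
  exact: differentiable_coord.
by apply/funext => z; rewrite row_mxEr.
Qed.

Lemma differentiable_slice F t x : differentiable (spacetime F) (event t x) ->
  differentiable (F t) x.
Proof.
move=> dF; have -> : F t = spacetime F \o event t.
  by apply/funext => z; rewrite /= spacetime_event.
by apply: differentiable_comp => //; exact: differentiable_event.
Qed.

Lemma near_slice (P : 'rV[R]_(1 + n) -> Prop) t x :
  (\forall y \near event t x, P y) -> \forall z \near x, P (event t z).
Proof. exact: (differentiable_continuous (differentiable_event t x)). Qed.

End spacetime.

Lemma smooth_on_det (R : realType) (m p : nat) (A : set 'rV[R]_m)
    (F : 'rV[R]_m -> 'M[R]_p) : open A ->
  (forall i j, smooth_on A (fun y => F y i j : R)) ->
  smooth_on A (fun y => \det (F y)).
Proof.
move=> oA FA; apply: (smooth_on_sum oA) => s; apply: (smooth_onM oA).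
  exact: smooth_on_cst.
exact: (smooth_on_prod oA).
Qed.

(** By Cramer's rule the entries are cofactors divided by a nonvanishing determinant, hence built
    from the entries of [F] by sums, products and one inverse. *)
Lemma smooth_on_invmx (R : realType) (m p : nat) (A : set 'rV[R]_m)
    (F : 'rV[R]_m -> 'M[R]_p) : open A -> smooth_on A F ->
  (forall y, A y -> F y \in unitmx) -> smooth_on A (fun y => invmx (F y)).
Proof.
move=> oA FA Fu; have FAij := (smooth_on_mxP oA F).1 FA.
apply/(smooth_on_mxP oA) => i j.
apply: (smooth_on_ext oA (f := fun y => (\det (F y))^-1 * cofactor (F y) j i)).
  by move=> y Ay; rewrite /invmx Fu // !mxE.
apply: (smooth_onM oA).
  apply: (smooth_onV oA); first exact: smooth_on_det.
  by move=> y Ay; have := Fu y Ay; rewrite unitmxE unitfE.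
apply: (smooth_onM oA); first exact: smooth_on_cst.
apply: smooth_on_det => // k l.
by apply: (smooth_on_ext oA _ (FAij (lift j k) (lift i l))) => y _; rewrite !mxE.
Qed.

Lemma smooth_on_mulmx (R : realType) (m p q r : nat) (A : set 'rV[R]_m)
    (F : 'rV[R]_m -> 'M[R]_(p, q)) (G : 'rV[R]_m -> 'M[R]_(q, r)) : open A ->
  smooth_on A F -> smooth_on A G -> smooth_on A (fun y => F y *m G y).
Proof.
move=> oA FA GA; have FAij := (smooth_on_mxP oA F).1 FA.
have GAij := (smooth_on_mxP oA G).1 GA; apply/(smooth_on_mxP oA) => i j.
apply: (smooth_on_ext oA (f := fun y => \sum_k F y i k * G y k j)).
  by move=> y Ay; rewrite mxE.
by apply: (smooth_on_sum oA) => k; exact: smooth_onM.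
Qed.

Lemma bil_block (R : realType) (n : nat) (a : R) (h : 'M[R]_n) (p q : 'M[R]_1)
    (X Y : 'rV[R]_n) :
  bil (block_mx a%:M 0 0 h : 'M[R]_(1 + n)) (row_mx p X) (row_mx q Y) =
  a * p 0 0 * q 0 0 + bil h X Y.
Proof.
rewrite /bil mul_row_block !mulmx0 addr0 add0r tr_row_mx mul_row_col mxE.
by congr (_ + _); rewrite mul_mx_scalar mxE big_ord1 !mxE.
Qed.

Lemma spacev0 (R : realType) (n : nat) : spacev 0 = 0 :> 'rV[R]_(1 + n).
Proof. exact: row_mx0. Qed.

Lemma spacevN (R : realType) (n : nat) (X : 'rV[R]_n) : spacev (- X) = - spacev X.
Proof. by rewrite /spacev opp_row_mx oppr0. Qed.

Lemma derive_event (R : realType) (n : nat) (V : normedModType R)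
    (f : 'rV[R]_(1 + n) -> V) y (a : R) X : differentiable f y ->
  'D_(event a X) f y = a *: 'D_timev f y + 'D_(spacev X) f y.
Proof. by move=> df; rewrite event_decomp !deriveE // linearP. Qed.

Lemma derive_dirN (R : realType) (V W : normedModType R) (f : V -> W) y v :
  differentiable f y -> 'D_(- v) f y = - 'D_v f y.
Proof. by move=> df; rewrite !deriveE // linearN. Qed.

Lemma derive_event_scalar (R : realType) (n : nat) (f : 'rV[R]_(1 + n) -> R) y
    (a : R) X : differentiable f y ->
  'D_(event a X) f y = a * 'D_timev f y + 'D_(spacev X) f y.
Proof. exact: derive_event. Qed.

Lemma derive_spacevN (R : realType) (n : nat) (V : normedModType R)
    (f : 'rV[R]_(1 + n) -> V) y X : differentiable f y ->
  'D_(spacev (- X)) f y = - 'D_(spacev X) f y.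
Proof. by rewrite spacevN; exact: derive_dirN. Qed.

(** Evaluating [(a, b)] at the four corners of the unit square isolates the four terms one after
    another. *)
Lemma separate_defects (R : realType) (T : lmodType R) (l tt : R)
    (tx xt : T -> R) (xx : T -> T -> R) : l != 0 ->
  (forall a b X Y, - (l * a * b * tt) + a * tx Y - l * b * xt X - xx X Y = 0) ->
  [/\ tt = 0, (forall Y, tx Y = 0), (forall X, xt X = 0) &
      (forall X Y, xx X Y = 0)].
Proof.
move=> l1 H.
have xx0 X Y : xx X Y = 0 by have := H 0 0 X Y; lra.
have xt0 X : xt X = 0.
    by apply: (mulfI l1); have := H 0 1 X 0; rewrite xx0; lra.
have tx0 Y : tx Y = 0 by have := H 1 0 0 Y; rewrite xx0; lra.
split=> //; apply: (mulfI l1).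
by have := H 1 1 0 0; rewrite xx0 xt0 tx0; lra.
Qed.

(** * The Levi-Civita connection of the Lorentzian metric *)

Section nabla_gbar.
Variables (R : realType) (n : nat).
Variables (g : R -> 'rV[R]_n -> 'M[R]_n) (U : R -> 'rV[R]_n -> 'rV[R]_n).
Variables (u lam : R -> 'rV[R]_n -> R).
Variable O : set 'rV[R]_(1 + n).
Let gh := spacetime g.
Let Uh := spacetime U.
Let uh := spacetime u.
Let lh := spacetime lam.
Hypotheses (oO : open O) (sg : smooth_on O gh) (sU : smooth_on O Uh)
  (su : smooth_on O uh) (sl : smooth_on O lh).
Hypotheses (gT : forall y, O y -> (gh y)^T = gh y)
  (gu : forall y, O y -> gh y \in unitmx)
  (u0 : forall y, O y -> uh y != 0) (l0 : forall y, O y -> lh y != 0).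

Lemma smooth_on_gbar : smooth_on O (gbar lam g).
Proof.
have sgij := (smooth_on_mxP oO gh).1 sg; apply/(smooth_on_mxP oO) => i j.
have s0 : smooth_on O (fun=> 0 : R) by exact: smooth_on_cst.
case: (split_ordP i) => k ->; case: (split_ordP j) => l' ->.
- apply: (smooth_on_ext oO (f := fun y => - (lh y * lh y))).
    by move=> y _; rewrite /gbar block_mxEul !ord1 mxE eqxx mulr1n -expr2.
  by apply: (smooth_onN oO); exact: smooth_onM.
- by apply: (smooth_on_ext oO _ s0) => y _; rewrite /gbar block_mxEur mxE.
- by apply: (smooth_on_ext oO _ s0) => y _; rewrite /gbar block_mxEdl mxE.
- by apply: (smooth_on_ext oO _ (sgij k l')) => y _; rewrite /gbar block_mxEdr.
Qed.

Lemma smooth_on_Vbar : smooth_on O (Vbar lam u U).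
Proof.
have sUij := (smooth_on_mxP oO Uh).1 sU; apply/(smooth_on_mxP oO) => i j.
case: (split_ordP j) => k ->.
  apply: (smooth_on_ext oO (f := fun y => uh y * (lh y)^-1)).
    by move=> y _; rewrite /Vbar row_mxEl !ord1 mxE eqxx mulr1n.
  by apply: (smooth_onM oO) => //; exact: smooth_onV.
apply: (smooth_on_ext oO (f := fun y => - Uh y i k)).
  by move=> y _; rewrite /Vbar row_mxEr mxE.
exact: (smooth_onN oO).
Qed.

Lemma gbar_sym y : O y -> (gbar lam g y)^T = gbar lam g y.
Proof.
by move=> Oy; rewrite /gbar tr_block_mx !trmx0 tr_scalar_mx; congr block_mx; exact: gT.
Qed.

Lemma gbar_unit y : O y -> gbar lam g y \in unitmx.
Proof.
move=> Oy; rewrite /gbar unitmxE det_ublock det_scalar1 unitrM -unitmxE.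
apply/andP; split; last exact: gu.
by rewrite unitfE oppr_eq0 sqrf_eq0; exact: l0.
Qed.

Lemma derive_gbar y v : O y -> 'D_v (gbar lam g) y =
  block_mx (- (2 * lh y * 'D_v lh y))%:M 0 0 ('D_v gh y).
Proof.
move=> Oy; have Hl := is_derive_smooth_scalar v sl Oy.
have Hg := is_derive_smooth v sg Oy.
apply: (@derive_val _ _ _ _ _ _ _ (is_derive_mx _)) => i j.
case: (split_ordP i) => k ->; case: (split_ordP j) => l' ->.
- rewrite block_mxEul !ord1 mxE eqxx mulr1n.
  have H := is_derive_const_mul (- 1) (is_derive_mul Hl Hl).
  rewrite (_ : (fun _ => _) = (fun y => - 1 * (lh y * lh y))).
    by apply: is_derive_eq H _; ring.
  apply/funext => z; rewrite /gbar block_mxEul mxE eqxx mulr1n.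
  by rewrite expr2 mulN1r.
- rewrite block_mxEur mxE (_ : (fun _ => _) = cst 0); first exact: is_derive_cst.
  by apply/funext => z; rewrite /gbar block_mxEur mxE.
- rewrite block_mxEdl mxE (_ : (fun _ => _) = cst 0); first exact: is_derive_cst.
  by apply/funext => z; rewrite /gbar block_mxEdl mxE.
- rewrite block_mxEdr (_ : (fun _ => _) = (fun y => gh y k l')).
    exact: is_derive_coef.
  by apply/funext => z; rewrite /gbar block_mxEdr.
Qed.

Lemma derive_Vbar y v : O y -> 'D_v (Vbar lam u U) y =
  row_mx ('D_v uh y * (lh y)^-1 + uh y * - (lh y ^- 2 * 'D_v lh y))%:M
    (- 'D_v Uh y).
Proof.
move=> Oy; have Hl := is_derive_inv (l0 Oy) (is_derive_smooth_scalar v sl Oy).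
have Hu := is_derive_smooth_scalar v su Oy.
have HU := is_derive_smooth v sU Oy.
apply: (@derive_val _ _ _ _ _ _ _ (is_derive_mx _)) => i j.
case: (split_ordP j) => k ->.
  rewrite row_mxEl !ord1 mxE eqxx mulr1n.
  rewrite (_ : (fun _ => _) = (fun y => uh y * (lh y)^-1)).
    exact: is_derive_mul.
  by apply/funext => z; rewrite /Vbar row_mxEl mxE eqxx mulr1n.
rewrite row_mxEr mxE (_ : (fun _ => _) = (fun y => - (Uh y i k))).
  by apply: is_deriveN; exact: is_derive_coef.
by apply/funext => z; rewrite /Vbar row_mxEr mxE.
Qed.

(** The value of the time component is left open: it is only ever paired with vectors tangent to the
    slice, to which d/dt is orthogonal. *)
Lemma derive_Tbar_right y v : O y ->
  exists a : R, 'D_v (Tbar lam) y = row_mx a%:M 0 :> 'rV[R]_(1 + n).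
Proof.
move=> Oy; have Hl := is_derive_inv (l0 Oy) (is_derive_smooth_scalar v sl Oy).
exists (- (lh y ^- 2 * 'D_v lh y)).
apply: (@derive_val _ _ _ _ _ _ _ (is_derive_mx _)) => i j.
case: (split_ordP j) => k ->.
  rewrite row_mxEl !ord1 mxE eqxx mulr1n.
  rewrite (_ : (fun _ => _) = (fun y => (lh y)^-1)) //.
  by apply/funext => z; rewrite /Tbar row_mxEl mxE eqxx mulr1n.
rewrite row_mxEr mxE (_ : (fun _ => _) = cst 0); first exact: is_derive_cst.
by apply/funext => z; rewrite /Tbar row_mxEr mxE.
Qed.

Lemma bil_Gamma_gbar y a b c : O y ->
  bil (gbar lam g y) (Gamma (gbar lam g) y a b) c =
  2^-1 * (bil ('D_a (gbar lam g) y) b c + bil ('D_b (gbar lam g) y) a c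
          - bil ('D_c (gbar lam g) y) a b).
Proof.
move=> Oy; apply: bil_Gamma; last 2 first.
- exact: gbar_unit.
- exact: smooth_on_diff smooth_on_gbar Oy.
have : nbhs y O by exact: open_nbhs_nbhs.
by apply: filterS => z; exact: gbar_sym.
Qed.

Local Opaque derive bil timev spacev.

(** The dictionary between the defects and the covariant derivative of V. The metric is block
    diagonal, so Koszul's formula splits into lapse and slice contributions, and the derivatives of
    [u / lambda] combine with those of the lapse. *)
Lemma bil_nabla_Vbar y (a b : R) X Y : O y ->
  bil (gbar lam g y) (nabla (gbar lam g) (Vbar lam u U) y (event a X)) (event b Y) =
  - (lh y * a * b * defect_tt Uh uh lh y) + a * defect_tx gh Uh uh lh Y y
  - lh y * b * defect_xt gh Uh uh lh X y - defect_xx gh Uh uh lh X Y y.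
Proof.
move=> Oy; rewrite /nabla bilDl bil_Gamma_gbar // derive_Vbar // !derive_gbar //.
have -> : Vbar lam u U y = event (uh y / lh y) (- Uh y) by [].
rewrite /gbar -!/(spacetime _ y) -/lh -/gh.
have dl := smooth_on_diff sl Oy; have dg := smooth_on_diff sg Oy.
have du := smooth_on_diff su Oy; have dU := smooth_on_diff sU Oy.
rewrite /defect_tt /defect_tx /defect_xt /defect_xx /lowered_gamma.
(* Every derivative along a spacetime vector is split into its time and space parts before the
   derivatives are replaced by variables. *)
move: (u0 Oy) (l0 Oy)
  (derive_event_scalar a X dl) (derive_event_scalar b Y dl)
  (derive_event_scalar (uh y / lh y) (- Uh y) dl) (derive_spacevN (Uh y) dl)
  (derive_event a X dg) (derive_event b Y dg)
  (derive_event (uh y / lh y) (- Uh y) dg) (derive_spacevN (Uh y) dg)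
  (derive_event_scalar a X du) (derive_event a X dU).
abstract_derivatives.
move: (uh y) (lh y) (Uh y) (gh y) => p q V h p0 q0 *; subst.
rewrite /event !bil_block !mxE !eqxx !mulr1n.
rewrite ?(bilDm, bilZm, bilNm, bilNl, bilNr, bilDl, bilZl).
by abstract_atoms; field.
Qed.

Lemma parallel_Vbar y : O y ->
  (forall xi, nabla (gbar lam g) (Vbar lam u U) y xi = 0) <->
  [/\ defect_tt Uh uh lh y = 0, (forall Y, defect_tx gh Uh uh lh Y y = 0),
      (forall X, defect_xt gh Uh uh lh X y = 0) &
      (forall X Y, defect_xx gh Uh uh lh X Y y = 0)].
Proof.
move=> Oy; split=> [par|[tt tx xt xx] xi].
  apply: (@separate_defects _ _ (lh y) (defect_tt Uh uh lh y)
    (fun Y => defect_tx gh Uh uh lh Y y) (fun X => defect_xt gh Uh uh lh X y)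
    (fun X Y => defect_xx gh Uh uh lh X Y y) (l0 Oy)) => a b X Y.
  by rewrite -bil_nabla_Vbar // par bil0l.
apply: (bil_nondegenerate (gbar_unit Oy)) => c; rewrite bil0l.
rewrite -(event_coord xi) -(event_coord c) bil_nabla_Vbar // tt tx xt xx.
by rewrite !mulr0 oppr0 !addr0.
Qed.

(** T is normal to the slice and its derivative along the slice has no space component, so only the
    Christoffel term contributes; the derivatives of the slice metric along [X] and [Y] are
    multiplied by the zero space component of T, and the time derivative survives. *)
Lemma bil_weingarten t x X Y : O (event t x) ->
  bil (g t x) (weingarten lam g t x X) Y =
  - ((2 * lam t x)^-1 * bil (dt g t x) X Y).
Proof.
set y := event t x => Oy; rewrite /weingarten bilNl; congr (- _).
rewrite -[row_mx t%:M x]/y -[row_mx 0 X]/(spacev X).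
set N := nabla _ _ _ _.
have -> : bil (g t x) (rsubmx N) Y = bil (gbar lam g y) N (row_mx 0%:M Y).
  rewrite -{2}(hsubmxK N) /gbar bil_block !mxE mul0rn mulr0 add0r.
  by rewrite /y tcoord_event xcoord_event.
rewrite /N /nabla bilDl bil_Gamma_gbar //.
have [a ->] := derive_Tbar_right (spacev X) Oy.
rewrite !derive_gbar // {1}/gbar dtE -/y.
have dg := smooth_on_diff sg Oy.
have lhy : lh y = lam t x by exact: spacetime_event.
have -> : Tbar lam y = event (lh y)^-1 0 by [].
move: (l0 Oy); rewrite -lhy.
move: (derive_event (lh y)^-1 0 dg).
rewrite spacev0 derive0 addr0 -[spacetime g]/gh.
abstract_derivatives.
move=> -> l1; rewrite !spacevE /event !bil_block !mxE !mul0rn !(mulr0, mul0r) !add0r.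
rewrite bilZm !bil0l !bil0r.
by abstract_atoms; field.
Qed.

End nabla_gbar.

Lemma is_derive_scalemx (R : realType) (V : normedModType R) (p q : nat)
    (f : V -> R) (F : V -> 'M[R]_(p, q)) (df : R) (dF : 'M[R]_(p, q)) x v :
  is_derive x v f df -> is_derive x v F dF ->
  is_derive x v (fun y => f y *: F y) (df *: F x + f x *: dF).
Proof.
move=> Hf HF; apply: is_derive_mx => i j.
rewrite (_ : (fun _ => _) = (fun y => f y * F y i j)).
  by apply: is_derive_eq (is_derive_mul Hf (is_derive_coef i j HF)) _; rewrite !mxE.
by apply/funext => y; rewrite mxE.
Qed.

(** * The evolution equations as vanishing residuals *)

Section equations.
Variables (R : realType) (n : nat).
Variables (g : R -> 'rV[R]_n -> 'M[R]_n) (U : R -> 'rV[R]_n -> 'rV[R]_n).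
Variables (u lam : R -> 'rV[R]_n -> R).
Variable O : set 'rV[R]_(1 + n).
Let gh := spacetime g.
Let Uh := spacetime U.
Let uh := spacetime u.
Let lh := spacetime lam.
Hypotheses (oO : open O) (sg : smooth_on O gh) (sU : smooth_on O Uh)
  (su : smooth_on O uh) (sl : smooth_on O lh).
Hypotheses (gT : forall y, O y -> (gh y)^T = gh y)
  (gu : forall y, O y -> gh y \in unitmx)
  (u0 : forall y, O y -> uh y != 0) (lp : forall y, O y -> 0 < lh y).
Variables (t : R) (x : 'rV[R]_n).
Let y := event t x.
Hypothesis Oy : O y.

Let gE : gh y = g t x. Proof. exact: spacetime_event. Qed.
Let UE : Uh y = U t x. Proof. exact: spacetime_event. Qed.
Let uE : uh y = u t x. Proof. exact: spacetime_event. Qed.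
Let lE : lh y = lam t x. Proof. exact: spacetime_event. Qed.

Local Opaque derive timev spacev bil.

(** With the lemmas that follow, this supplies the pairings under which the evolution identities
    were proved, now for the actual Christoffel term, metric dual and gradient of the slice. *)
Lemma Gamma_low A B Z :
  bil (gh y) (Gamma (g t) x A B) Z = lowered_gamma gh A B Z y.
Proof.
have dg : differentiable (g t) x.
  by apply: differentiable_slice; exact: smooth_on_diff sg Oy.
have nO : \forall z \near x, (g t z)^T = g t z.
  have : \forall z \near y, O z by exact: open_nbhs_nbhs.
  move/near_slice; apply: filterS => z Oz.
  by have := gT Oz; rewrite /gh spacetime_event.
rewrite /lowered_gamma gE.
have gux : g t x \in unitmx by rewrite -gE; exact: gu.
apply: (etrans (bil_Gamma A B Z nO gux dg)).
by rewrite (derive_space g t x A) (derive_space g t x B) (derive_space g t x Z).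
Qed.

Lemma Gamma_sym A B : Gamma (g t) x A B = Gamma (g t) x B A.
Proof.
apply: (bil_nondegenerate (gu Oy)) => Z; rewrite !Gamma_low.
rewrite /lowered_gamma; move: (bilC A B (derive_sym oO sg gT (spacev Z) Oy)).
by abstract_atoms => ->; congr (_ * (_ - _)); exact: addrC.
Qed.

Lemma sharp_low Z Y :
  bil (gh y) Z (sharp (g t x) (dt g t x) Y) = bil ('D_timev gh y) Z Y.
Proof.
rewrite gE bil_sharp ?dtE // -gE; [exact: gT|exact: gu].
Qed.

Lemma grad_low Z : bil (gh y) (grad (g t) (lam t) x) Z = 'D_(spacev Z) lh y.
Proof.
rewrite gE bil_grad.
- by rewrite derive_space.
- by apply: differentiable_slice; exact: smooth_on_diff sl Oy.
- by rewrite -gE; exact: gu.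
Qed.

(** Serves twice: the gradient is differentiated in t in the equations, and it is a coefficient of
    the transport systems. *)
Lemma smooth_on_grad : smooth_on O (spacetime (fun s => grad (g s) (lam s))).
Proof.
pose F z : 'rV[R]_n := \row_i 'D_(spacev (delta_mx 0 i)) lh z.
apply: (smooth_on_ext oO (f := fun z => F z *m invmx (gh z))).
  move=> z Oz; rewrite /spacetime /grad /F; congr (_ *m _).
  apply/rowP => i; have rowE (f : 'I_n -> R) : (\row_i f i) 0 i = f i by rewrite mxE.
  apply: (etrans (rowE _)); apply: esym; apply: (etrans (rowE _)).
  apply: (etrans (derive_space lam (tcoord z) (xcoord z) (delta_mx 0 i))).
  by rewrite event_coord.
apply: (smooth_on_mulmx oO); last exact: smooth_on_invmx.
apply/(smooth_on_mxP oO) => i j.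
apply: (smooth_on_ext oO (f := 'D_(spacev (delta_mx 0 j)) lh)).
  by move=> z _; rewrite mxE.
exact: smooth_on_derive_scalar.
Qed.

End equations.

Section residuals.
Variables (R : realType) (n : nat).
Variables (g : R -> 'rV[R]_n -> 'M[R]_n) (U : R -> 'rV[R]_n -> 'rV[R]_n).
Variables (u lam : R -> 'rV[R]_n -> R).
Variable O : set 'rV[R]_(1 + n).
Let gh := spacetime g.
Let Uh := spacetime U.
Let uh := spacetime u.
Let lh := spacetime lam.
Hypotheses (oO : open O) (sg : smooth_on O gh) (sU : smooth_on O Uh)
  (su : smooth_on O uh) (sl : smooth_on O lh).
Hypotheses (gT : forall y, O y -> (gh y)^T = gh y)
  (gu : forall y, O y -> gh y \in unitmx)
  (u0 : forall y, O y -> uh y != 0) (lp : forall y, O y -> 0 < lh y).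
Variables (t : R) (x : 'rV[R]_n).
Let y := event t x.
Hypothesis Oy : O y.
Let gE : gh y = g t x. Proof. exact: spacetime_event. Qed.
Let UE : Uh y = U t x. Proof. exact: spacetime_event. Qed.
Let uE : uh y = u t x. Proof. exact: spacetime_event. Qed.
Let lE : lh y = lam t x. Proof. exact: spacetime_event. Qed.

Let l0 z : O z -> lh z != 0. Proof. by move=> /lp; exact: lt0r_neq0. Qed.

Local Opaque derive timev spacev bil.

(** Obtained by differentiating g(grad lambda, Z) = dlambda(Z) in t for fixed [Z]; the product rule
    leaves the term with the time derivative of [g]. *)
Lemma dt_grad_low Z : bil (gh y) (dt_grad g lam t x) Z =
  'D_(spacev Z) ('D_timev lh) y - bil ('D_timev gh y) (grad (g t) (lam t) x) Z.
Proof.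
pose G := spacetime (fun s => grad (g s) (lam s)).
have sG : smooth_on O G := smooth_on_grad oO sg sl gu.
have Gy : G y = grad (g t) (lam t) x.
  exact: (spacetime_event (fun s => grad (g s) (lam s))).
have -> : dt_grad g lam t x = 'D_timev G y.
  exact: (dtE (fun s => grad (g s) (lam s))).
have H := @derive_val _ _ _ _ _ _ _ (is_derive_bil_cstr Z
  (is_derive_smooth timev sg Oy) (is_derive_smooth timev sG Oy)).
have E : 'D_timev (fun z => bil (gh z) (G z) Z) y = 'D_timev ('D_(spacev Z) lh) y.
  apply: near_eq_derive; apply: (near_open oO Oy) => z Oz.
  have Oe : O (event (tcoord z) (xcoord z)) by rewrite event_coord.
  by have := grad_low sl gu Oe Z; rewrite event_coord.
have C := smooth_on_comm_scalar oO timev (spacev Z) sl Oy.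
by rewrite -C -E H Gy addrAC subrr add0r.
Qed.

Let S := sharp (g t x) (dt g t x).
Let Gam := Gamma (g t) x.
Let gr := grad (g t) (lam t) x.
Let dgr := dt_grad g lam t x.

Lemma nabla_form_K A B C :
  nabla_form (g t) (fun z => (lam t z)^-1 *: dt g t z) x A B C =
  nabla_K gh lh y Gam A B C.
Proof.
have Hl := is_derive_inv (l0 Oy) (is_derive_smooth_scalar (spacev A) sl Oy).
have Hg := is_derive_smooth (spacev A) (smooth_on_derive oO timev sg) Oy.
have H : 'D_(spacev A) (fun z => (lh z)^-1 *: 'D_timev gh z) y =
    - (lh y ^- 2 * 'D_(spacev A) lh y) *: 'D_timev gh y
    + (lh y)^-1 *: 'D_(spacev A) ('D_timev gh) y.
  exact: (@derive_val _ _ _ _ _ _ _ (is_derive_scalemx Hl Hg)).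
have E : 'D_A (fun z => (lam t z)^-1 *: dt g t z) x =
    'D_(spacev A) (fun z => (lh z)^-1 *: 'D_timev gh z) y.
  apply: (etrans (derive_space (fun s z => (lam s z)^-1 *: dt g s z) t x A)).
  have -> // : spacetime (fun s z => (lam s z)^-1 *: dt g s z) =
      (fun z => (lh z)^-1 *: 'D_timev gh z).
  by apply/funext => z; rewrite /spacetime dtE event_coord.
rewrite /nabla_form E H /nabla_K dtE -/y -lE -/gh -/Gam.
rewrite !bilDm !bilZm.
by abstract_atoms; ring.
Qed.

Lemma hess_lowE A B : hess (g t) (lam t) x A B = hess_low lh y Gam A B.
Proof.
rewrite /hess /hess_low (derive_space lam t x (Gamma (g t) x A B)).
by rewrite (derive_space (fun s z => 'D_B (lam s) z) t x A) spacetime_derive.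
Qed.

Lemma dt2E (V : normedModType R) (F : R -> 'rV[R]_n -> V) :
  dt (dt F) t x = 'D_timev ('D_timev (spacetime F)) y.
Proof. by rewrite dtE spacetime_dt. Qed.

Lemma dt_logE : dt_log lam t x = 'D_timev lh y / lh y.
Proof.
have H : is_derive t 1 (fun s => lam s x) ('D_timev lh y).
  have dl := smooth_on_derivable (v := timev) sl Oy.
  move: dl; rewrite /y event_decomp => dl.
  have := is_derive_line dl; rewrite -event_decomp.
  by congr is_derive; apply/funext => s; rewrite -event_decomp /lh spacetime_event.
have lp' : 0 < lam t x by rewrite -lE; exact: lp.
have H2 := @is_derive1_comp _ (@ln R) (fun s => lam s x) t _ _ (is_derive1_ln lp') H.
rewrite /dt_log /dt derive1E lE mulrC.
exact: (@derive_val _ _ _ _ _ _ _ H2).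
Qed.

Lemma metric_equationP : metric_equation g U u lam t x <->
  forall X Y, metric_residual gh Uh uh lh y Gam S X Y = 0.
Proof.
have E X Y : bil (dt (dt g) t x) X Y -
   (lam t x ^+ 2 / u t x * dnabla_dg g lam t x (U t x) Y X
      + 1 / 2 * bil (dt g t x) X (sharp (g t x) (dt g t x) Y)
      + dt_log lam t x * bil (dt g t x) X Y
      + 2 * lam t x * hess (g t) (lam t) x X Y) =
   metric_residual gh Uh uh lh y Gam S X Y.
  rewrite /metric_residual /dnabla_dg /dnabla !nabla_form_K hess_lowE dt2E dt_logE.
  by rewrite -/S dtE -/y -/gh -lE -uE -UE div1r.
by split=> H X Y; [rewrite -E H subrr|have := H X Y; rewrite -E => /eqP; rewrite subr_eq0 => /eqP].
Qed.


Lemma vector_equationP : vector_equation g U u lam t x <->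
  forall X, vector_residual gh Uh uh lh y Gam gr dgr X = 0.
Proof.
have E X : bil (g t x) (dt (dt U) t x) X -
   (- (lam t x ^+ 2 / (2 * u t x)) * dnabla_dg g lam t x (U t x) X (U t x)
      - bil (dt g t x) (dt U t x) X
      - 1 / 2 * dt_log lam t x * bil (dt g t x) (U t x) X
      - lam t x * hess (g t) (lam t) x (U t x) X
      + u t x * bil (g t x) (dt_grad g lam t x) X
      + u t x / 2 * bil (dt g t x) (grad (g t) (lam t) x) X
      + (2 * dt u t x - 'D_(U t x) (lam t) x) * 'D_X (lam t) x) =
   vector_residual gh Uh uh lh y Gam gr dgr X.
  rewrite /vector_residual /dnabla_dg /dnabla !nabla_form_K hess_lowE dt2E dt_logE.
  rewrite (derive_space lam t x (U t x)) (derive_space lam t x X).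
  by rewrite -/gr -/dgr !dtE -/y -/gh -/Uh -/uh -/lh -lE -uE -UE -gE div1r.
split=> H X; first by rewrite -E (H X) subrr.
by have := H X; rewrite -E => /eqP; rewrite subr_eq0 => /eqP.
Qed.

Lemma scalar_equationP : scalar_equation g U u lam t x <->
  scalar_residual gh Uh uh lh y gr dgr = 0.
Proof.
have E : dt (dt u) t x -
   (bil (g t x) (dt_grad g lam t x) (U t x)
    + 2 * 'D_(dt U t x) (lam t) x
    + 3 / 2 * bil (dt g t x) (grad (g t) (lam t) x) (U t x)
    - u t x * bil (g t x) (grad (g t) (lam t) x) (grad (g t) (lam t) x)) =
   scalar_residual gh Uh uh lh y gr dgr.
  rewrite /scalar_residual dt2E (derive_space lam t x (dt U t x)).
  by rewrite -/gr -/dgr !dtE -/y -/gh -/Uh -/uh -/lh -uE -UE -gE.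
split=> [H|]; first by rewrite -E H subrr.
by rewrite -E => /eqP; rewrite subr_eq0 => /eqP.
Qed.

End residuals.

(** * Transport along the time lines *)

Lemma segment_event (R : realType) (n : nat) (t s : R) (x : 'rV[R]_n) :
  s *: (t *: timev) + event 0 x = event (s * t) x.
Proof. by rewrite timevE !eventZ eventD mulr1 addr0 !scaler0 add0r. Qed.

(* The normal and tangential parts of nabla_{d/dt} V, and those of nabla_X V for
   fixed X, satisfy systems of this same shape. *)
Lemma pair_transport_zero (R : realType) (n : nat) (O : set 'rV[R]_(1 + n))
    (q : 'rV[R]_(1 + n) -> R) (nu : 'rV[R]_n -> 'rV[R]_(1 + n) -> R)
    (gr : 'rV[R]_(1 + n) -> 'rV[R]_n) (S : 'rV[R]_n -> 'rV[R]_(1 + n) -> 'rV[R]_n)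
    (dl : 'rV[R]_n -> 'rV[R]_(1 + n) -> R) t x :
  (forall s, 0 <= s <= 1 -> O (event (s * t) x)) ->
  (forall X y, O y -> nu X y = \sum_j X 0 j * nu (delta_mx 0 j) y) ->
  (forall y, O y -> is_derive y timev q (nu (gr y) y)) ->
  (forall X y, O y -> is_derive y timev (nu X) (2^-1 * nu (S X y) y + dl X y * q y)) ->
  (forall y, O y -> differentiable gr y) ->
  (forall X y, O y -> differentiable (S X) y) ->
  (forall X y, O y -> differentiable (dl X) y) ->
  q (event 0 x) = 0 -> (forall X, nu X (event 0 x) = 0) ->
  q (event t x) = 0 /\ forall X, nu X (event t x) = 0.
Proof.
move=> HO lin dq dnu dgr dS ddl q0 nu0.
(* The unknowns are [q] and the values of [nu] on the coordinate basis; by linearity of [nu] the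
   equations close up on these [1 + n] functions. *)
pose F (k : 'I_1 + 'I_n) y := match k with
  | inl _ => q y | inr j => nu (delta_mx 0 j) y end.
pose a (k l : 'I_1 + 'I_n) y : R := match k, l with
  | inl _, inl _ => 0
  | inl _, inr j => gr y 0 j
  | inr i, inl _ => dl (delta_mx 0 i) y
  | inr i, inr j => 2^-1 * S (delta_mx 0 i) y 0 j end.
have dcoef (G : 'rV[R]_(1 + n) -> 'rV[R]_n) j y : differentiable G y ->
    differentiable (fun z => G z 0 j : R) y.
  move=> dG; apply: (@differentiable_comp _ _ _ _ G (fun M : 'rV[R]_n => M 0 j : R)) => //.
  exact: differentiable_coord.
have xE : t *: timev + event 0 x = event t x.
  by rewrite -[t *: timev]scale1r segment_event mul1r.
have H k : F k (event t x) = 0.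
  rewrite -xE; apply: (@linear_transport_zero _ _ _ O F a).
  - by move=> s s01; rewrite segment_event; exact: HO.
  - move=> [k0|i] y Oy; rewrite big_sumType /= big_ord1 /=.
      by apply: is_derive_eq (dq y Oy) _; rewrite (lin _ _ Oy) mul0r add0r.
    apply: is_derive_eq (dnu _ y Oy) _; rewrite (lin _ _ Oy) addrC mulr_sumr.
    by congr (_ + _); apply: eq_bigr => j _; rewrite mulrA.
  - move=> [k0|i] [k1|j] y Oy /=.
    + exact: differentiable_cst.
    + by apply: dcoef; exact: dgr.
    + exact: ddl.
    + apply: differentiableM; first exact: differentiable_cst.
      by apply: dcoef; exact: dS.
  - by move=> [k0|i] /=; [exact: q0|exact: nu0].
have Oe : O (event t x) by have := HO 1; rewrite mul1r lexx ler01; apply.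
split; first exact: (H (inl ord0)).
move=> X; rewrite (lin X _ Oe); apply: big1 => j _.
by have /= -> := H (inr j); rewrite mulr0.
Qed.

Section defects_linear.
Variables (R : realType) (n : nat).
Variables (g : 'rV[R]_(1 + n) -> 'M[R]_n) (U : 'rV[R]_(1 + n) -> 'rV[R]_n).
Variables (u l : 'rV[R]_(1 + n) -> R).
Variables (y : 'rV[R]_(1 + n)).
Hypotheses (dg : differentiable g y) (dl : differentiable l y).

Lemma spacev_sum (X : 'rV[R]_n) :
  spacev X = \sum_j X 0 j *: spacev (delta_mx 0 j) :> 'rV[R]_(1 + n).
Proof.
rewrite {1}[X]row_sum_delta.
elim/big_ind2 : _ => [|x1 x2 y1 y2 <- <-|i _]; first exact: spacev0.
  by rewrite /spacev add_row_mx addr0.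
by rewrite /spacev scale_row_mx scaler0.
Qed.

Lemma derive_spacev_sum (V : normedModType R) (f : 'rV[R]_(1 + n) -> V) X :
  differentiable f y ->
  'D_(spacev X) f y = \sum_j X 0 j *: 'D_(spacev (delta_mx 0 j)) f y.
Proof.
move=> df; rewrite deriveE // [in LHS]spacev_sum linear_sum.
by apply: eq_bigr => j _; rewrite linearZ deriveE.
Qed.

Lemma bil_suml m (I : finType) (c : I -> R) (h : I -> 'M[R]_m) a b :
  bil (\sum_i c i *: h i) a b = \sum_i c i * bil (h i) a b.
Proof.
elim/big_ind2 : _ => [|x1 x2 y1 y2 <- <-|i _]; first by rewrite bil0m.
  by rewrite bilDm.
by rewrite bilZm.
Qed.

Lemma bil_delta m (h : 'M[R]_m) a b :
  bil h a b = \sum_j b 0 j * bil h a (delta_mx 0 j).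
Proof. by rewrite -bil_sumr -row_sum_delta. Qed.

Local Opaque derive bil.

(** Linearity in the tested vector, which the transport argument needs in order to work in the
    coordinate basis. *)
Lemma defect_tx_sum X : defect_tx g U u l X y =
  \sum_j X 0 j * defect_tx g U u l (delta_mx 0 j) y.
Proof.
rewrite /defect_tx (derive_spacev_sum X dl).
move: (bil_delta ('D_timev g y) (U y) X) (bil_delta (g y) ('D_timev U y) X).
abstract_atoms => -> ->.
rewrite !mulr_sumr -!sumrB; apply: eq_bigr => j _.
by rewrite -[_ *: _]/(_ * _); abstract_atoms; ring.
Qed.

Lemma defect_xx_sum X Y : defect_xx g U u l X Y y =
  \sum_j Y 0 j * defect_xx g U u l X (delta_mx 0 j) y.
Proof.
rewrite /defect_xx /lowered_gamma (derive_spacev_sum Y dg) bil_suml.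
move: (bil_delta (g y) ('D_(spacev X) U y) Y) (bil_delta ('D_(spacev X) g y) (U y) Y)
  (bil_delta ('D_(spacev (U y)) g y) X Y) (bil_delta ('D_timev g y) X Y).
abstract_atoms => -> -> -> ->.
rewrite -big_split -sumrB !mulr_sumr -big_split -sumrB; apply: eq_bigr => j _ /=.
by abstract_atoms; ring.
Qed.

End defects_linear.

(** * The equivalence in a chart *)

Lemma derive_vanishing (R : realType) (V W : normedModType R) (O : set V)
    (f : V -> W) y v : open O -> (forall z, O z -> f z = 0) -> O y ->
  'D_v f y = 0.
Proof.
move=> oO f0 Oy; rewrite -[RHS](derive_cst (0 : W) y v); apply: near_eq_derive.
have : nbhs y O by exact: open_nbhs_nbhs.
by apply: filterS => z /f0.
Qed.

Section local.
Variables (R : realType) (n : nat).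
Variables (g : R -> 'rV[R]_n -> 'M[R]_n) (U : R -> 'rV[R]_n -> 'rV[R]_n).
Variables (u lam : R -> 'rV[R]_n -> R).
Variable O : set 'rV[R]_(1 + n).
Let gh := spacetime g.
Let Uh := spacetime U.
Let uh := spacetime u.
Let lh := spacetime lam.
Hypotheses (oO : open O) (sg : smooth_on O gh) (sU : smooth_on O Uh)
  (su : smooth_on O uh) (sl : smooth_on O lh).
Hypotheses (gT : forall y, O y -> (gh y)^T = gh y)
  (gu : forall y, O y -> gh y \in unitmx)
  (u0 : forall y, O y -> uh y != 0) (lp : forall y, O y -> 0 < lh y).

Let l0 z : O z -> lh z != 0. Proof. by move=> /lp; exact: lt0r_neq0. Qed.

Definition no_defect y : Prop :=
  [/\ defect_tt Uh uh lh y = 0, (forall Y, defect_tx gh Uh uh lh Y y = 0),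
      (forall X, defect_xt gh Uh uh lh X y = 0) &
      (forall X Y, defect_xx gh Uh uh lh X Y y = 0)].

Section at_event.
Variables (t : R) (x : 'rV[R]_n).
Hypothesis Oy : O (event t x).
Let S := sharp (g t x) (dt g t x).
Let Gam := Gamma (g t) x.
Let gr := grad (g t) (lam t) x.
Let dgr := dt_grad g lam t x.

Lemma evolution_tt : 'D_timev (defect_tt Uh uh lh) (event t x) =
  scalar_residual gh Uh uh lh (event t x) gr dgr
  - defect_tx gh Uh uh lh gr (event t x).
Proof.
apply: (derive_time_defect_tt oO sg sU su sl gT Oy).
- exact: (grad_low sl gu Oy).
- exact: (dt_grad_low oO sg sl gu Oy).
Qed.

Lemma evolution_tx X : 'D_timev (defect_tx gh Uh uh lh X) (event t x) =
  2^-1 * defect_tx gh Uh uh lh (S X) (event t x)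
  - defect_tt Uh uh lh (event t x) * 'D_(spacev X) lh (event t x)
  - vector_residual gh Uh uh lh (event t x) Gam gr dgr X
  - 2^-1 * metric_residual gh Uh uh lh (event t x) Gam S (Uh (event t x)) X.
Proof.
apply: (derive_time_defect_tx oO sg sU su sl gT u0 l0 Oy).
- exact: (sharp_low gT gu Oy).
- exact: (grad_low sl gu Oy).
- exact: (dt_grad_low oO sg sl gu Oy).
Qed.

Lemma evolution_xt X : 'D_timev (defect_xt gh Uh uh lh X) (event t x) =
  defect_xx gh Uh uh lh X gr (event t x)
  + 'D_(spacev X) (defect_tt Uh uh lh) (event t x)
  + (2 * lh (event t x))^-1 * defect_tx gh Uh uh lh (S X) (event t x)
  - (2 * lh (event t x))^-1
    * metric_residual gh Uh uh lh (event t x) Gam S X (Uh (event t x)).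
Proof.
apply: (derive_time_defect_xt oO sg sU su sl gT u0 l0 Oy).
- exact: (Gamma_low oO sg gT gu Oy).
- exact: (sharp_low gT gu Oy).
- exact: (grad_low sl gu Oy).
Qed.

Lemma evolution_xx X Y : 'D_timev (defect_xx gh Uh uh lh X Y) (event t x) =
  2^-1 * defect_xx gh Uh uh lh X (S Y) (event t x)
  + 'D_(spacev Y) lh (event t x) * defect_xt gh Uh uh lh X (event t x)
  - 'D_(spacev X) (defect_tx gh Uh uh lh Y) (event t x)
  + defect_tx gh Uh uh lh (Gam X Y) (event t x)
  - (2 * lh (event t x))^-1 * defect_tt Uh uh lh (event t x)
    * bil ('D_timev gh (event t x)) X Y
  - uh (event t x) / (2 * lh (event t x))
    * metric_residual gh Uh uh lh (event t x) Gam S X Y.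
Proof.
apply: (derive_time_defect_xx oO sg sU su sl gT u0 l0 Oy).
- exact: (Gamma_low oO sg gT gu Oy).
- exact: (Gamma_sym oO sg gT gu Oy).
- exact: (sharp_low gT gu Oy).
Qed.

End at_event.

Definition evolves t x : Prop :=
  [/\ metric_equation g U u lam t x, vector_equation g U u lam t x &
      scalar_equation g U u lam t x].

(** The metric equation has to be read off first, from the evolution of [defect_xx], where its
    residual has the nonzero factor [u / (2 lambda)]; the identity for [defect_tx] contains that
    residual besides the one of the vector equation. *)
Lemma no_defect_evolves t x : (forall y, O y -> no_defect y) ->
  O (event t x) -> evolves t x.
Proof.
move=> nd Oy; have [tt0 tx0 xt0 xx0] := nd _ Oy.
have M X Y : metric_residual gh Uh uh lh (event t x) (Gamma (g t) x)
    (sharp (g t x) (dt g t x)) X Y = 0.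
  have := evolution_xx Oy X Y; rewrite tt0 tx0 xt0 xx0.
  rewrite (derive_vanishing timev oO (fun z Oz => let: And4 _ _ _ xx := nd z Oz in xx X Y) Oy).
  rewrite (derive_vanishing (spacev X) oO (fun z Oz => let: And4 _ tx _ _ := nd z Oz in tx Y) Oy).
  rewrite !(mulr0, mul0r, addr0, subr0) sub0r => /esym/eqP.
  rewrite oppr_eq0 !mulf_eq0 invr_eq0 mulf_eq0 (negbTE (u0 Oy)) (negbTE (l0 Oy)).
  by rewrite pnatr_eq0 /= => /eqP.
have V X : vector_residual gh Uh uh lh (event t x) (Gamma (g t) x)
    (grad (g t) (lam t) x) (dt_grad g lam t x) X = 0.
  have := evolution_tx Oy X; rewrite tt0 tx0 M.
  rewrite (derive_vanishing timev oO (fun z Oz => let: And4 _ tx _ _ := nd z Oz in tx X) Oy).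
  by rewrite !(mulr0, mul0r) !subr0 sub0r => /esym/eqP; rewrite oppr_eq0 => /eqP.
have s : scalar_residual gh Uh uh lh (event t x)
    (grad (g t) (lam t) x) (dt_grad g lam t x) = 0.
  have := evolution_tt Oy; rewrite tx0 subr0 => <-.
  apply: (@derive_vanishing _ _ _ O (defect_tt Uh uh lh) _ timev oO _ Oy).
  by move=> z /nd [].
split.
- exact/(metric_equationP U u oO sg sl lp Oy).
- exact/(vector_equationP U u oO sg sl lp Oy).
- exact/scalar_equationP.
Qed.

Hypothesis seg : forall t x s, O (event t x) -> 0 <= s <= 1 -> O (event (s * t) x).
Hypothesis ev : forall t x, O (event t x) -> evolves t x.
Hypothesis init : forall x, O (event 0 x) -> no_defect (event 0 x).

Let Sh (X : 'rV[R]_n) (y : 'rV[R]_(1 + n)) : 'rV[R]_n :=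
  sharp (gh y) ('D_timev gh y) X.
Let gradh := spacetime (fun s => grad (g s) (lam s)).

Let smoothSh X : smooth_on O (Sh X).
Proof.
have s1 := smooth_on_mulmx oO (smooth_on_mulmx oO (smooth_on_invmx oO sg gu)
  (smooth_on_derive oO timev sg)) (smooth_on_cst oO X^T).
apply/(smooth_on_mxP oO) => i j.
apply: (smooth_on_ext oO _ ((smooth_on_mxP oO _).1 s1 j i)) => y _.
by rewrite /Sh /sharp [RHS]mxE.
Qed.

Let ShE X t x : Sh X (event t x) = sharp (g t x) (dt g t x) X.
Proof. by rewrite /Sh dtE /gh spacetime_event. Qed.

Let gradhE t x : gradh (event t x) = grad (g t) (lam t) x.
Proof. exact: (spacetime_event (fun s => grad (g s) (lam s))). Qed.

Let metric0 t x X Y : O (event t x) ->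
  metric_residual gh Uh uh lh (event t x) (Gamma (g t) x)
    (sharp (g t x) (dt g t x)) X Y = 0.
Proof. by move=> Oy; have [/(metric_equationP U u oO sg sl lp Oy) + _ _] := ev Oy; apply. Qed.

Let Oevent (P : 'rV[R]_(1 + n) -> Prop) :
  (forall t x, O (event t x) -> P (event t x)) -> forall y, O y -> P y.
Proof. by move=> HP y; rewrite -(event_coord y); exact: HP. Qed.

(** The evolution of N contains no spatial derivatives of the other defects, so it can be solved
    along each time line separately, and the conclusion then holds on all of [O]. *)
Let time_defects y : O y ->
  defect_tt Uh uh lh y = 0 /\ forall Y, defect_tx gh Uh uh lh Y y = 0.
Proof.
move: y; apply: Oevent => t x Oy.
have Oz s : 0 <= s <= 1 -> O (event (s * t) x) by exact: seg.
have [H1 H2] : - defect_tt Uh uh lh (event t x) = 0 /\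
    forall Y, defect_tx gh Uh uh lh Y (event t x) = 0.
  (* The sign of [defect_tt] is reversed to bring the system into the common form, with
     +[nu (gr y) y] and +[dl X y * q y]. *)
  apply: (@pair_transport_zero _ _ O (fun y => - defect_tt Uh uh lh y)
    (defect_tx gh Uh uh lh) gradh Sh (fun X => 'D_(spacev X) lh)) => //.
  - move=> X y Oy'; apply: defect_tx_sum; exact: smooth_on_diff sl Oy'.
  - apply: Oevent => {Oz}{}t {}x {}Oy.
    have := evolution_tt Oy; have [_ _ /scalar_equationP ->] := ev Oy.
    have [dtt _] := is_derive_defect_tt oO sU su sl timev Oy.
    move=> E; rewrite gradhE; apply: DeriveDef; first exact: derivableN.
    by rewrite deriveN // E sub0r opprK.
  - move=> X; apply: Oevent => {Oz}{}t {}x {}Oy.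
    have := evolution_tx Oy X; rewrite metric0 //.
    have [_ /(vector_equationP U u oO sg sl lp Oy) -> _] := ev Oy.
    have [dtx _] := is_derive_defect_tx oO sg sU su sl X timev Oy.
    move=> E; rewrite ShE; apply: DeriveDef => //.
    by rewrite E mulr0 !subr0 mulrN [X in _ - X = _]mulrC.
  - move=> y; exact: smooth_on_diff (smooth_on_grad oO sg sl gu).
  - move=> X y; exact: smooth_on_diff (smoothSh X).
  - move=> X y; exact: smooth_on_diff (smooth_on_derive_scalar oO _ sl).
  - have := Oz 0; rewrite mul0r lexx ler01 => /(_ isT) /init [-> _ _ _].
    exact: oppr0.
  - by move=> X; have := Oz 0; rewrite mul0r lexx ler01 => /(_ isT) /init [].
by split=> //; apply/eqP; rewrite -oppr_eq0 H1.
Qed.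

(** For fixed [X] the evolution of B_X involves spatial derivatives of the components of N. These
    vanish because N is already known to vanish on a neighbourhood of every event. *)
Lemma evolves_no_defect y : O y -> no_defect y.
Proof.
move: y; apply: Oevent => t x Oy; have [tt0 tx0] := time_defects Oy.
have Oz s : 0 <= s <= 1 -> O (event (s * t) x) by exact: seg.
suff H X : defect_xt gh Uh uh lh X (event t x) = 0 /\
    forall Y, defect_xx gh Uh uh lh X Y (event t x) = 0.
  by split=> // X; have [] := H X.
apply: (@pair_transport_zero _ _ O (defect_xt gh Uh uh lh X)
  (defect_xx gh Uh uh lh X) gradh Sh (fun X => 'D_(spacev X) lh)) => //.
- move=> Y y Oy'; apply: defect_xx_sum; exact: smooth_on_diff sg Oy'.
- apply: Oevent => {Oz tt0 tx0}{}t {}x {}Oy; have [tt0 tx0] := time_defects Oy.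
  have := evolution_xt Oy X; rewrite metric0 // tx0.
  rewrite (derive_vanishing (spacev X) oO (fun z Oz => (time_defects Oz).1) Oy).
  have [dxt _] := is_derive_defect_xt oO sg sU su sl l0 X timev Oy.
  move=> E; rewrite gradhE; apply: DeriveDef => //.
  by rewrite E !mulr0 subr0 !addr0.
- move=> Y; apply: Oevent => {Oz tt0 tx0}{}t {}x {}Oy; have [tt0 tx0] := time_defects Oy.
  have := evolution_xx Oy X Y; rewrite metric0 // tx0 tt0.
  rewrite (derive_vanishing (spacev X) oO (fun z Oz => (time_defects Oz).2 Y) Oy).
  have [dxx _] := is_derive_defect_xx oO sg sU su sl l0 X Y timev Oy.
  move=> E; rewrite ShE; apply: DeriveDef => //.
  by rewrite E !(mulr0, mul0r) !subr0 addr0.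
- move=> y; exact: smooth_on_diff (smooth_on_grad oO sg sl gu).
- move=> Y y; exact: smooth_on_diff (smoothSh Y).
- move=> Y y; exact: smooth_on_diff (smooth_on_derive_scalar oO _ sl).
- by have := Oz 0; rewrite mul0r lexx ler01 => /(_ isT) /init [].
- by move=> Y; have := Oz 0; rewrite mul0r lexx ler01 => /(_ isT) /init [].
Qed.

End local.

(** The slice at t = 0 carries the given metric and vector field only over the image of the chart;
    this set is open, and a covariant derivative depends only on germs. *)
Lemma nabla_near (R : realType) (m : nat) (G G' : 'rV[R]_m -> 'M[R]_m)
    (V V' : 'rV[R]_m -> 'rV[R]_m) x xi :
  (\forall y \near x, G y = G' y) -> (\forall y \near x, V y = V' y) ->
  nabla G V x xi = nabla G' V' x xi.
Proof.
move=> GG VV; have Gx := nbhs_singleton GG; have Vx := nbhs_singleton VV.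
have pE i j k : partial i (fun y => G y j k) x = partial i (fun y => G' y j k) x.
  by apply: near_eq_derive; apply: filterS GG => y ->.
have cE k i j : christoffel G x k i j = christoffel G' x k i j.
  by rewrite /christoffel Gx; under eq_bigr do rewrite !pE.
rewrite /nabla (near_eq_derive _ VV) Vx.
have -> // : Gamma G x xi (V' x) = Gamma G' x xi (V' x).
apply/rowP => k; rewrite !mxE; apply: eq_bigr => i _; apply: eq_bigr => j _.
by rewrite cE.
Qed.

(** * Initial data, and propagation of the null condition *)

Section initial.
Variables (R : realType) (n : nat).
Variables (g : R -> 'rV[R]_n -> 'M[R]_n) (U : R -> 'rV[R]_n -> 'rV[R]_n).
Variables (u lam : R -> 'rV[R]_n -> R).
Variable O : set 'rV[R]_(1 + n).
Let gh := spacetime g.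
Let Uh := spacetime U.
Let uh := spacetime u.
Let lh := spacetime lam.
Hypotheses (oO : open O) (sg : smooth_on O gh) (sU : smooth_on O Uh)
  (su : smooth_on O uh) (sl : smooth_on O lh).
Hypotheses (gT : forall y, O y -> (gh y)^T = gh y)
  (gu : forall y, O y -> gh y \in unitmx)
  (up : forall y, O y -> 0 < uh y) (lp : forall y, O y -> 0 < lh y).

Lemma bil_Vbar y : O y ->
  bil (gbar lam g y) (Vbar lam u U y) (Vbar lam u U y) =
  bil (gh y) (Uh y) (Uh y) - uh y ^+ 2.
Proof.
move=> Oy; rewrite /gbar /Vbar bil_block !mxE eqxx mulr1n bilNl bilNr.
rewrite -!/(spacetime _ y) -/gh -/Uh -/uh -/lh opprK.
by move: (bil _ _ _) (lp Oy) => b /lt0r_neq0 ly; field.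
Qed.

Lemma Vbar_neq0 y : O y -> Vbar lam u U y != 0.
Proof.
move=> Oy; apply/eqP => /(congr1 (fun v => tcoord v)).
have -> : tcoord (0 : 'rV[R]_(1 + n)) = 0 by rewrite /tcoord mxE [LHS]mxE.
rewrite /Vbar tcoord_row mxE eqxx mulr1n => /eqP.
by rewrite mulf_eq0 invr_eq0 (gt_eqF (up Oy)) (gt_eqF (lp Oy)).
Qed.

Local Opaque derive bil.

Lemma defect_xxE t x X Y : O (event t x) ->
  defect_xx gh Uh uh lh X Y (event t x) =
  bil (g t x) (nabla (g t) (U t) x X) Y
  - 2^-1 * (u t x / lam t x * bil (dt g t x) X Y).
Proof.
move=> Oy; rewrite /nabla bilDl /defect_xx.
have := Gamma_low oO sg gT gu Oy X (U t x) Y.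
rewrite /gh /Uh /uh /lh !spacetime_event => ->.
by rewrite (derive_space U t x X) dtE.
Qed.

Variables (A0 : set 'rV[R]_n) (g0 W0 : 'rV[R]_n -> 'M[R]_n)
  (U0 : 'rV[R]_n -> 'rV[R]_n) (u0 : 'rV[R]_n -> R).
Hypotheses (oA0 : open A0) (A0O : forall x, A0 x -> O (event 0 x)).
Hypothesis constraint : forall x, A0 x ->
  [/\ 0 < u0 x, u0 x ^+ 2 = bil (g0 x) (U0 x) (U0 x) &
    forall X, nabla g0 U0 x X + u0 x *: (X *m W0 x) = 0].

Section at_point.
Hypotheses (g0E : forall x, A0 x -> g 0 x = g0 x)
  (U0E : forall x, A0 x -> U 0 x = U0 x).
Variable x : 'rV[R]_n.
Hypothesis Ax : A0 x.
Let Oy := A0O Ax.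

Let near0 (P : 'rV[R]_n -> Prop) : (forall z, A0 z -> P z) -> \forall z \near x, P z.
Proof.
move=> HP; have : nbhs x A0 by exact: open_nbhs_nbhs.
by apply: filterS => z /HP.
Qed.

Lemma nabla_initial X : nabla (g 0) (U 0) x X = - (u0 x *: (X *m W0 x)).
Proof.
have [_ _ /(_ X) /eqP] := constraint Ax; rewrite addr_eq0 => /eqP <-.
by apply: nabla_near; apply: near0.
Qed.

Lemma bil_grad_initial (X : 'rV[R]_n) : bil (g0 x) (grad g0 (lam 0) x) X = 'D_X (lam 0) x.
Proof.
rewrite bil_grad //.
  by apply: differentiable_slice; exact: smooth_on_diff sl Oy.
by have := gu Oy; rewrite /gh spacetime_event g0E.
Qed.

(** Differentiating u^2 = g(U, U) along [X] gives u du(X) = g(nabla_X U, U), and the constraint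
    turns the right-hand side into -u g(W X, U); it remains to divide by [u]. *)
Lemma derive_u_initial (X : 'rV[R]_n) : (forall z, A0 z -> u 0 z = u0 z) ->
  'D_X (u 0) x = - bil (g0 x) (X *m W0 x) (U0 x).
Proof.
move=> u0E.
have dgs : differentiable (g 0) x.
  by apply: differentiable_slice; exact: smooth_on_diff sg Oy.
have dUs : differentiable (U 0) x.
  by apply: differentiable_slice; exact: smooth_on_diff sU Oy.
have dus : differentiable (u 0) x.
  by apply: differentiable_slice; exact: smooth_on_diff su Oy.
have Hg := derivableP (diff_derivable (v := X) dgs).
have HU := derivableP (diff_derivable (v := X) dUs).
have Hu := derivableP (diff_derivable (v := X) dus).
have H1 := @derive_val _ _ _ _ _ _ _ (is_derive_mul Hu Hu).
have H2 := @derive_val _ _ _ _ _ _ _ (is_derive_bil Hg HU HU).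
have E : 'D_X (fun z => u 0 z * u 0 z) x =
    'D_X (fun z => bil (g 0 z) (U 0 z) (U 0 z)) x.
  apply: near_eq_derive; apply: near0 => z Az.
  have [_ + _] := constraint Az.
  by rewrite -expr2 u0E // g0E // U0E.
have gx : (g 0 x)^T = g 0 x by have := gT Oy; rewrite /gh spacetime_event.
have gux : g 0 x \in unitmx by have := gu Oy; rewrite /gh spacetime_event.
have ngT : \forall z \near x, (g 0 z)^T = g 0 z.
  by apply: near0 => z Az; have := gT (A0O Az); rewrite /gh spacetime_event.
have HG := bil_Gamma X (U 0 x) (U 0 x) ngT gux dgs.
have N := congr1 (fun v => bil (g 0 x) v (U 0 x)) (nabla_initial X).
rewrite /nabla bilDl HG bilNl bilZl in N.
have ux : 0 < u 0 x by have := up Oy; rewrite /uh spacetime_event.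
have C := bilC (U 0 x) ('D_X (U 0) x) gx.
have ux0 : 2 * u 0 x != 0 by rewrite mulf_neq0 ?pnatr_eq0 // lt0r_neq0.
have G : bil (g0 x) (X *m W0 x) (U0 x) = bil (g 0 x) (X *m W0 x) (U 0 x).
  by rewrite g0E // U0E.
have us : u0 x = u 0 x by rewrite u0E.
rewrite us in N.
(* The computation over plain reals: [d] is the derivative of [u], [a], [b], [c] are the three terms
   of the product rule for g(U, U), and [z] is the term of Koszul's formula that cancels when the
   last two vectors are equal. *)
have alg (a b c d z p w : R) : d * p + p * d = a + b + c ->
    b + 2^-1 * (a + z - z) = - (p * w) -> c = b -> 2 * p * d = 2 * p * - w.
  move=> H E1 E2; have -> : 2 * p * d = d * p + p * d by ring.
  rewrite H E2; have -> : 2 * p * - w = 2 * - (p * w) by ring.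
  by rewrite -E1; field.
apply: (mulfI ux0); rewrite G.
exact: (alg _ _ _ _ _ _ _ (etrans (esym H1) (etrans E H2)) N C).
Qed.

End at_point.

(** Each defect has its own cause to vanish: the first two by the initial velocities of [u] and [U],
    [defect_xt] by the derivative of u^2 = g(U, U), and [defect_xx] by the constraint and the
    initial velocity of the metric. *)
Lemma initial_no_defect :
  (forall x, A0 x -> initial_conditions g0 W0 U0 u0 g U u lam x) ->
  forall x, A0 x -> no_defect g U u lam (event 0 x).
Proof.
move=> IC x Ax; have Oy := A0O Ax.
have g0E z : A0 z -> g 0 z = g0 z by case/IC => [[]].
have U0E z : A0 z -> U 0 z = U0 z by case/IC.
have u0E z : A0 z -> u 0 z = u0 z by case/IC.
have [[_ dg0] _ dU0 _ du0] := IC x Ax.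
have ly : lam 0 x != 0.
  by have := lp Oy; rewrite /lh spacetime_event => /lt0r_neq0.
have dgx X Y : bil ('D_timev gh (event 0 x)) X Y = - 2 * lam 0 x * bil (g 0 x) (X *m W0 x) Y.
  by have := dg0 X Y; rewrite dtE g0E.
split.
- rewrite /defect_tt /uh -(dtE u) du0 /lh -(derive_space lam).
  by rewrite /Uh spacetime_event U0E // subrr.
- move=> Y; rewrite /defect_tx dgx /Uh -(dtE U) dU0 /lh -(derive_space lam) /uh /gh.
  rewrite !spacetime_event U0E // u0E // g0E // bilDl !bilZl bil_grad_initial //.
  by abstract_atoms; field.
- move=> X; rewrite /defect_xt dgx /uh -(derive_space u) derive_u_initial //.
  rewrite /lh /Uh !spacetime_event U0E // g0E //.
  by abstract_atoms; field.
- move=> X Y; rewrite defect_xxE // nabla_initial // bilNl bilZl.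
  rewrite dg0 u0E // g0E //.
  by abstract_atoms; field.
Qed.

(** The extension prescribes only [g] and [U] at t = 0. The value of [u] follows from the null
    condition and positivity, and the three velocities from [defect_xx] with the constraint, from
    [defect_tx] by nondegeneracy, and from [defect_tt]. *)
Lemma no_defect_initial :
  (forall x, A0 x -> g 0 x = g0 x /\ U 0 x = U0 x) ->
  (forall x, A0 x -> no_defect g U u lam (event 0 x)) ->
  (forall y, O y -> uh y ^+ 2 = bil (gh y) (Uh y) (Uh y)) ->
  forall x, A0 x -> initial_conditions g0 W0 U0 u0 g U u lam x.
Proof.
move=> E0 nd null x Ax; have Oy := A0O Ax.
have g0E z : A0 z -> g 0 z = g0 z by case/E0.
have U0E z : A0 z -> U 0 z = U0 z by case/E0.
have [u0p u02 _] := constraint Ax.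
have ux : u 0 x = u0 x.
  have := null _ Oy; have := up Oy.
  rewrite /uh /gh /Uh !spacetime_event g0E // U0E // -u02 => p /eqP.
  by rewrite eqrXn2 // ?ltW // => /eqP.
have ly : lam 0 x != 0.
  by have := lp Oy; rewrite /lh spacetime_event => /lt0r_neq0.
have [tt tx xt xx] := nd x Ax.
have dg0 X Y : bil (dt g 0 x) X Y = - 2 * lam 0 x * bil (g0 x) (X *m W0 x) Y.
  have alg (b d l v : R) : v != 0 -> l != 0 ->
      - (v * b) - 2^-1 * (v / l * d) = 0 -> d = - 2 * l * b.
    move=> v0 l0 H.
    have -> : d = 2 * l / v * (2^-1 * (v / l * d)) by field; rewrite v0 l0.
    have -> : 2^-1 * (v / l * d) = - (v * b) by lra.
    by field.
  have := xx X Y; rewrite defect_xxE // nabla_initial // bilNl bilZl ux g0E //.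
  by apply: alg => //; exact: lt0r_neq0.
split=> //.
- by split; first exact: g0E.
- exact: U0E.
- have gux : g0 x \in unitmx by have := gu Oy; rewrite /gh spacetime_event g0E.
  apply: (bil_nondegenerate gux) => Y.
  have := tx Y; rewrite /defect_tx /gh -(dtE g) dg0 /Uh -(dtE U) /lh -(derive_space lam).
  rewrite /uh !spacetime_event U0E // g0E // ux bilDl !bilZl bil_grad_initial //.
  by abstract_atoms; lra.
- have := tt; rewrite /defect_tt /uh -(dtE u) /lh -(derive_space lam) /Uh spacetime_event.
  by rewrite U0E // => /eqP; rewrite subr_eq0 => /eqP.
Qed.

(** Where [defect_tt] and [defect_tx] vanish, both u^2 and g(U, U) have time derivative 2 u
    dlambda(U), so their difference is constant along the time lines. *)
Lemma null_propagates :
  (forall t x s, O (event t x) -> 0 <= s <= 1 -> O (event (s * t) x)) ->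
  (forall y, O y -> no_defect g U u lam y) ->
  (forall x, O (event 0 x) -> uh (event 0 x) ^+ 2 =
     bil (gh (event 0 x)) (Uh (event 0 x)) (Uh (event 0 x))) ->
  forall y, O y -> uh y ^+ 2 = bil (gh y) (Uh y) (Uh y).
Proof.
move=> seg nd null0 y; rewrite -(event_coord y); move: (tcoord y) (xcoord y) => t x Oy.
pose F (k : 'I_1) z := uh z * uh z - bil (gh z) (Uh z) (Uh z).
have Oz s : 0 <= s <= 1 -> O (event (s * t) x) by exact: seg.
have xE : t *: timev + event 0 x = event t x.
  by rewrite -[t *: timev]scale1r segment_event mul1r.
suff : F ord0 (event t x) = 0 by rewrite expr2 => /eqP; rewrite subr_eq0 => /eqP.
(* A transport equation with zero coefficient: a function with vanishing time derivative that is
   zero at t = 0. *)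
rewrite -xE; apply: (@linear_transport_zero _ _ _ O F (fun _ _ _ => 0)).
- by move=> s s01; rewrite segment_event; exact: Oz.
- move=> k z Oz'; rewrite big1 => [|l _]; last by rewrite mul0r.
  have Hu := is_derive_smooth_scalar timev su Oz'.
  have Hg := is_derive_smooth timev sg Oz'.
  have HU := is_derive_smooth timev sU Oz'.
  apply: is_derive_eq (is_derive_sub (is_derive_mul Hu Hu) (is_derive_bil Hg HU HU)) _.
  have [+ /(_ (Uh z)) + _ _] := nd z Oz'; rewrite /defect_tt /defect_tx -/uh -/lh -/gh -/Uh.
  move: (bilC (Uh z) ('D_timev Uh z) (gT Oz')).
  abstract_atoms; move: (uh z) => p -> /eqP; rewrite subr_eq0 => /eqP ->.
  by lra.
- by move=> *; exact: differentiable_cst.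
- move=> k; rewrite /F -expr2 null0 ?subrr //.
  by have := Oz 0; rewrite mul0r lexx ler01; apply.
Qed.

End initial.

(** * Passage to the manifold *)

Lemma positive_definite_unit (R : realType) (m : nat) (h : 'M[R]_m) :
  positive_definite h -> h \in unitmx.
Proof.
move=> [hT hp]; rewrite unitmxE unitfE; apply/negP => /det0P [v v0 vh].
by have := hp v v0; rewrite /bil vh mul0mx mxE ltxx.
Qed.

Lemma positive_definite_congr (R : realType) (m : nat) (h Q : 'M[R]_m) :
  Q \in unitmx -> positive_definite h -> positive_definite (Q *m h *m Q^T).
Proof.
move=> Qu [hT hp]; split; first by rewrite !trmx_mul trmxK hT mulmxA.
move=> xi xi0; rewrite /bil.
have -> : xi *m (Q *m h *m Q^T) *m xi^T = (xi *m Q) *m h *m (xi *m Q)^T.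
  by rewrite trmx_mul !mulmxA.
apply: hp; apply: contra_neq xi0 => xQ.
by rewrite -[xi]mulmx1 -(mulmxV Qu) mulmxA xQ mul0mx.
Qed.

(* Gram-Schmidt, by Schur complements. *)
Lemma positive_definite_diagonalize (R : realType) (m : nat) (h : 'M[R]_m) :
  positive_definite h -> exists2 P, P \in unitmx & P *m h *m P^T = 1%:M.
Proof.
elim: m h => [|m IH] h hp.
  by exists 1%:M; [exact: unitmx1|apply/matrixP => -[]].
rewrite -[m.+1]/(1 + m)%N in h hp *.
pose a := ulsubmx h 0 0; pose b := ursubmx h; pose d := drsubmx h.
have hE : h = block_mx a%:M b b^T d.
  have [hT _] := hp; rewrite -[LHS]submxK -mx11_scalar; congr block_mx.
  by rewrite /b -[in RHS]hT trmx_ursub trmxK.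
have a0 : 0 < a.
  have [_ /(_ (row_mx 1%:M 0))] := hp.
  rewrite /bil hE mul_row_block tr_row_mx mul_row_col trmx0 trmx1 !mul0mx !mulmx0.
  rewrite mulmx1 mul1mx !addr0 mxE eqxx mulr1n; apply.
  apply/eqP => /rowP /(_ (lshift m 0)); rewrite row_mxEl !mxE eqxx => /eqP.
  by rewrite oner_eq0.
pose c := a^-1 *: b.
(* One elimination step: subtracting multiples of the first basis vector makes the others orthogonal
   to it, and leaves the Schur complement as the remaining block. *)
pose Q : 'M[R]_(1 + m) := block_mx 1%:M 0 (- c^T) 1%:M.
have Qu : Q \in unitmx by rewrite unitmxE det_lblock !det1 mulr1 unitr1.
have QhQ : Q *m h *m Q^T = block_mx a%:M 0 0 (d - c^T *m b).
  have ac : a *: c = b by rewrite /c scalerA mulfV ?scale1r // gt_eqF.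
  rewrite /Q hE tr_block_mx !mulmx_block !trmx1 !trmx0 !mul1mx !mulmx1 !mul0mx.
  rewrite !mulmx0 !addr0 linearN /= trmxK mulNmx mul_mx_scalar.
  have bT : b^T = a *: c^T by rewrite -[in LHS]ac linearZ.
  rewrite bT addNr mul0mx add0r mulmxN mul_scalar_mx ac addNr mulNmx.
  by congr block_mx; rewrite addrC.
have [sT sp] := positive_definite_congr Qu hp; rewrite QhQ in sT sp.
have [|P Pu PsP] := IH (d - c^T *m b).
  split; first by move: sT; rewrite tr_block_mx => /eq_block_mx [].
  move=> xi xi0; have := sp (row_mx 0 xi).
  rewrite bil_block !mxE mulr0 add0r; apply.
  by apply: contra_neq xi0 => /eqP; rewrite row_mx_eq0 => /andP[_ /eqP].
pose D : 'M[R]_(1 + m) := block_mx (Num.sqrt a)^-1%:M 0 0 P.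
have sa : Num.sqrt a != 0 by rewrite sqrtr_eq0 -ltNge.
exists (D *m Q).
  rewrite unitmx_mul Qu andbT unitmxE det_lblock unitrM.
  by rewrite -[_ && _]/(_ && (P \in unitmx)) Pu andbT det_scalar1 unitfE invr_eq0.
rewrite trmx_mul -!mulmxA (mulmxA h) (mulmxA Q) (mulmxA Q) QhQ /D.
rewrite tr_block_mx !mulmx_block !trmx0 !mulmx0 !mul0mx !addr0 !add0r tr_scalar_mx.
have saE : (Num.sqrt a)^-1 * (a * (Num.sqrt a)^-1) = 1.
  have := sqr_sqrtr (ltW a0); move: (Num.sqrt a) sa => s s0 <-.
  by field.
by rewrite (mulmxA P) PsP -!scalar_mxM saE !mulmx0 -scalar_mx_block.
Qed.

Lemma lorentzian_block (R : realType) (n : nat) (l : R) (h : 'M[R]_n) :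
  l != 0 -> positive_definite h ->
  lorentzian (block_mx (- l ^+ 2)%:M 0 0 h : 'M[R]_(1 + n)).
Proof.
move=> l0 hp; have [hT _] := hp; split.
  by rewrite tr_block_mx !trmx0 tr_scalar_mx hT.
have [P Pu PhP] := positive_definite_diagonalize hp.
exists (block_mx l^-1%:M 0 0 P).
  rewrite unitmxE det_lblock unitrM -[_ && _]/(_ && (P \in unitmx)) Pu andbT.
  by rewrite det_scalar1 unitfE invr_eq0.
rewrite tr_block_mx !mulmx_block !trmx0 !mulmx0 !mul0mx !addr0 !add0r tr_scalar_mx PhP.
have lE : l^-1 * - l ^+ 2 * l^-1 = -1 by field.
by rewrite -!scalar_mxM lE ?mulmx0 ?mul0mx.
Qed.

(** * Product charts and their transition maps *)

Section charts.
Variables (R : realType) (n : nat) (M : manifold R n) (D : set (R * M)).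
Hypothesis openD : open D.

Definition chart_domain (c : chart_index M) : set 'rV[R]_(1 + n) :=
  cfun (spacetime_charts M c) @` (cdom (spacetime_charts M c) `&` D).

Lemma chart_domainP c t x : chart_domain c (event t x) <->
  exists p, [/\ cdom (charts c) p, D (t, p) & cfun (charts c) p = x].
Proof.
split=> [[[s p] [/= cp Dp] E]|[p [cp Dp <-]]]; last by exists (t, p).
have := congr1 (@xcoord R n) E; have := congr1 (@tcoord R n) E.
rewrite -/(event _ _) !xcoord_event !tcoord_event => st xp.
by exists p; rewrite -st.
Qed.

(** The chart inverse is meaningful only on the image of the chart, so a neighbourhood is first
    confined to that image; there membership in [D] is an open condition because [cinv] is
    continuous. *)
Lemma open_chart_domain c : open (chart_domain c).
Proof.
rewrite openE => y Oy; rewrite /interior /=.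
have := Oy; rewrite -{1}(event_coord y) => /chart_domainP [p [cp Dp px]].
have cx : \forall z \near y, (cfun (charts c) @` cdom (charts c)) (xcoord z).
  apply: (continuous_rsubmx (n1 := 1) (n2 := n)).
  by apply: open_nbhs_nbhs; split; [exact: open_cimage|exists p].
have cD : \forall z \near y, D (tcoord z, cinv (charts c) (xcoord z)).
  have [[A B] [/= nA nB] AB] : nbhs (tcoord y, p) D by exact: open_nbhs_nbhs.
  have tA : \forall z \near y, A (tcoord z).
    have : {for y, continuous (fun z : 'rV[R]_(1 + n) => z 0 (lshift n 0) : R)}.
      exact: coord_continuous.
    rewrite (_ : (fun _ => _) = (@tcoord R n)); first by apply.
    by apply/funext => z; rewrite /tcoord mxE.
  have xB : \forall z \near y, B (cinv (charts c) (xcoord z)).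
    have ct : {for y, continuous (cinv (charts c) \o @xcoord R n)}.
      apply: continuous_comp; first exact: continuous_rsubmx.
      by apply: cinv_continuous; exists p.
    by apply: ct; rewrite /= -px cfunK.
  by apply: filterS2 tA xB => z Az Bz; apply: (AB (_, _)).
apply: filterS2 cx cD => z [q cq qz] Dz; rewrite -(event_coord z).
by apply/chart_domainP; exists q; rewrite -qz cfunK // in Dz.
Qed.

End charts.

Section families.
Variables (R : realType) (n : nat) (M : manifold R n) (D : set (R * M)).
Hypothesis openD : open D.

Lemma smooth_metric_family gt c : metric_family D gt ->
  smooth_on (chart_domain D c) (spacetime (gt c)).
Proof.
move=> [[/(_ c) sm _] _]; have oO := open_chart_domain (c := c) openD.
have {}sm := (smooth_on_mxP oO _).1 sm; apply/(smooth_on_mxP oO) => i j.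
apply: (smooth_on_ext oO _ (sm (rshift 1 i) (rshift 1 j))) => y _.
by rewrite block_mxEdr.
Qed.

Lemma smooth_vector_family Ut c : vector_family D Ut ->
  smooth_on (chart_domain D c) (spacetime (Ut c)).
Proof.
move=> [/(_ c) sm _]; have oO := open_chart_domain (c := c) openD.
have {}sm := (smooth_on_mxP oO _).1 sm; apply/(smooth_on_mxP oO) => i j.
apply: (smooth_on_ext oO _ (sm i (rshift 1 j))) => y _.
by rewrite row_mxEr.
Qed.

Lemma smooth_local_rep f c : smooth_function (spacetime_charts M) D f ->
  smooth_on (chart_domain D c) (spacetime (local_rep f c)).
Proof. exact. Qed.

Lemma smooth_function_sub (f : R * M -> R) :
  smooth_function (spacetime_charts M) setT f ->
  smooth_function (spacetime_charts M) D f.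
Proof.
move=> sf c s x [q [cq _] qx]; apply: (sf c s x).
by exists q.
Qed.

Section jacobian.
Variables (c d : chart_index M) (t : R) (p : M).
Hypotheses (cp : cdom (charts c) p) (dp : cdom (charts d) p).
Let x := cfun (charts c) p.
Let phi := cfun (charts d) \o cinv (charts c).
Let J := transition_jacobian (spacetime_charts M) c d (t, p).
Let f (y : 'rV[R]_(1 + n)) : 'rV[R]_(1 + n) := row_mx (tcoord y)%:M (phi (xcoord y)).

Let fE : cfun (spacetime_charts M d) \o cinv (spacetime_charts M c) = f.
Proof. by []. Qed.

Let fl y i : f y i (lshift n 0) = y 0 (lshift n 0).
Proof. by rewrite /f row_mxEl !ord1 /tcoord !mxE eqxx mulr1n. Qed.

Let fr y i k : f y i (rshift 1 k) = phi (xcoord y) 0 k.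
Proof. by rewrite /f row_mxEr ord1. Qed.

Let dphi : differentiable phi x.
Proof. by have := @charts_compatible _ _ M c d [::] x; apply; exists p. Qed.

Let dfr k : differentiable (fun y => phi (xcoord y) 0 k : R) (event t x).
Proof.
apply: (@differentiable_comp _ _ _ _ (@xcoord R n) (fun z => phi z 0 k : R)).
  exact: differentiable_rsubmx.
rewrite xcoord_event.
apply: (@differentiable_comp _ _ _ _ phi (fun z : 'rV[R]_n => z 0 k : R)) => //.
exact: differentiable_coord.
Qed.

Let df : differentiable f (event t x).
Proof.
apply: differentiable_mx => i j; case: (split_ordP j) => k ->.
  rewrite !ord1 (_ : (fun _ => _) = (fun y : 'rV[R]_(1 + n) => y 0 (lshift n 0) : R)).
    exact: differentiable_coord.
  by apply/funext => y; rewrite fl.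
rewrite (_ : (fun _ => _) = (fun y => phi (xcoord y) 0 k)) //.
by apply/funext => y; rewrite fr.
Qed.

Let derive_l v : 'D_v f (event t x) 0 (lshift n 0) = v 0 (lshift n 0).
Proof.
rewrite derive_coef; last exact: diff_derivable.
rewrite (_ : (fun _ => _) = (fun y : 'rV[R]_(1 + n) => y 0 (lshift n 0) : R)).
  exact: (@derive_val _ _ _ _ _ _ _ (is_derive_coef 0 (lshift n 0) (is_derive_id (event t x) v))).
by apply/funext => y; rewrite fl.
Qed.

Let JE v : v *m J = 'D_v f (event t x).
Proof. by rewrite /J /transition_jacobian fE (deriveEjacobian _ df). Qed.

(** Invariance of the covector dt: product charts share the time coordinate, so transition maps
    preserve it. *)
Lemma jacobian_dt : J *m timev^T = timev^T.
Proof.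
have H (v : 'rV[R]_(1 + n)) : (v *m J) *m (timev : 'rV[R]_(1 + n))^T = v *m timev^T.
  have tE (w : 'rV[R]_(1 + n)) : w *m timev^T = (w 0 (lshift n 0))%:M.
    rewrite -[w]hsubmxK /timev tr_row_mx mul_row_col trmx0 mulmx0 addr0 trmx1 mulmx1.
    by rewrite row_mxEl -mx11_scalar.
  by rewrite !tE JE derive_l.
by apply/row_matrixP => i; rewrite !rowE -[RHS]H mulmxA.
Qed.

(** Invariance of the vector d/dt: the spatial part of a transition map does not depend on t. *)
Lemma jacobian_timev : timev *m J = timev.
Proof.
rewrite JE; apply/rowP => j; case: (split_ordP j) => k ->.
  by rewrite !ord1 derive_l.
rewrite derive_coef; last exact: diff_derivable.
rewrite (_ : (fun _ => _) = spacetime (fun (_ : R) z => phi z 0 k)).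
  rewrite -dtE /dt derive1_cst /timev row_mxEr mxE //.
by apply/funext => y; rewrite fr.
Qed.

End jacobian.

End families.

Section spacetime_fields.
Variables (R : realType) (n : nat) (M : manifold R n) (D : set (R * M)).
Variables (lam : R * M -> R).
Hypotheses (openD : open D)
  (hlam : smooth_function (spacetime_charts M) setT lam)
  (hlam_pos : forall q, 0 < lam q).
Variables (gt : chart_index M -> R -> 'rV[R]_n -> 'M[R]_n)
  (Ut : chart_index M -> R -> 'rV[R]_n -> 'rV[R]_n) (ut : R * M -> R).
Hypothesis hfam : smooth_families D gt Ut ut.

Lemma smooth_lapse c :
  smooth_on (chart_domain D c) (spacetime (local_rep lam c)).
Proof. exact: smooth_local_rep (smooth_function_sub hlam). Qed.

Lemma lapse_gt0 c y : 0 < spacetime (local_rep lam c) y.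
Proof. exact: hlam_pos. Qed.

Lemma lapse_neq0 c y : spacetime (local_rep lam c) y != 0.
Proof. exact/lt0r_neq0/lapse_gt0. Qed.

Lemma family_definite c y : chart_domain D c y ->
  positive_definite (spacetime (gt c) y).
Proof.
have [[_ pd] _ _ _] := hfam.
by rewrite -(event_coord y) => /chart_domainP [p [cp Dp <-]]; rewrite spacetime_event; exact: pd.
Qed.

Lemma family_sym c y : chart_domain D c y ->
  (spacetime (gt c) y)^T = spacetime (gt c) y.
Proof. by move=> /family_definite []. Qed.

Lemma family_unit c y : chart_domain D c y -> spacetime (gt c) y \in unitmx.
Proof. by move=> /family_definite; exact: positive_definite_unit. Qed.

Lemma length_gt0 c y : chart_domain D c y -> 0 < spacetime (local_rep ut c) y.
Proof.
have [_ _ _ up] := hfam.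
rewrite -(event_coord y) => /chart_domainP [p [cp Dp px]].
by rewrite spacetime_event /local_rep -px cfunK //; exact: up.
Qed.

Lemma length_neq0 c y : chart_domain D c y -> spacetime (local_rep ut c) y != 0.
Proof. by move=> /length_gt0 /lt0r_neq0. Qed.

(** [timev^T *m timev] is the matrix of dt tensor dt. The transformation law of the Lorentzian
    metric thereby splits into the invariance of dt and the law assumed for the family of slice
    metrics. *)
Lemma block_lapse (a : R) (h : 'M[R]_n) :
  block_mx a%:M 0 0 h = a *: (timev^T *m timev) + block_mx 0 0 0 h :> 'M[R]_(1 + n).
Proof.
rewrite /timev tr_row_mx mul_col_row !trmx0 trmx1 !mul0mx mulmx0 mul1mx.
by rewrite scale_block_mx !scaler0 add_block_mx !addr0 !add0r scale_scalar_mx mulr1.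
Qed.

Lemma lorentzian_metric_gbar : lorentzian_metric (spacetime_charts M) D
  (fun c => gbar (local_rep lam c) (gt c)).
Proof.
have [mf _ _ _] := hfam; split; last first.
  move=> c [t p] Dp cp; rewrite -[cfun _ _]/(event t (cfun (charts c) p)).
  apply: lorentzian_block.
    by rewrite tcoord_event xcoord_event; exact/lt0r_neq0/hlam_pos.
  have [[_ pd] _ _ _] := hfam; rewrite tcoord_event xcoord_event; exact: pd.
split=> [c|c d [t p] Dp cp dp].
  have sg : smooth_on (chart_domain D c) (spacetime (gt c)).
    exact: smooth_metric_family.
  exact: (smooth_on_gbar (open_chart_domain (c := c) openD) sg (smooth_lapse (c := c))).
have [[_ law] _] := mf; have := law c d (t, p) Dp cp dp.
rewrite -![cfun _ _]/(event t (cfun (charts _) p)) /gbar.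
rewrite !tcoord_event !xcoord_event /local_rep !cfunK // => E.
rewrite block_lapse [in RHS]block_lapse E mulmxDr mulmxDl; congr (_ + _).
set J := transition_jacobian _ _ _ _; have jt : J *m timev^T = timev^T by exact: jacobian_dt.
have -> : J *m (- lam (t, p) ^+ 2 *: (timev^T *m timev)) *m J^T =
    - lam (t, p) ^+ 2 *: ((J *m timev^T) *m (J *m timev^T)^T).
  by rewrite -scalemxAr -scalemxAl trmx_mul trmxK !mulmxA.
by rewrite jt trmxK.
Qed.

Lemma vector_field_Vbar : vector_field (spacetime_charts M) D
  (fun c => Vbar (local_rep lam c) (local_rep ut c) (Ut c)).
Proof.
have [_ vf uf _] := hfam; split=> [c|c d [t p] Dp cp dp].
  have sU : smooth_on (chart_domain D c) (spacetime (Ut c)).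
    exact: smooth_vector_family.
  have su : smooth_on (chart_domain D c) (spacetime (local_rep ut c)).
    exact: smooth_local_rep.
  exact: (smooth_on_Vbar (open_chart_domain (c := c) openD) sU su (smooth_lapse (c := c))
    (fun y _ => lapse_neq0 c y)).
have [_ law] := vf; have := law c d (t, p) Dp cp dp.
rewrite -![cfun _ _]/(event t (cfun (charts _) p)) /Vbar.
rewrite !tcoord_event !xcoord_event /local_rep !cfunK // => E.
have VE (a : R) (X : 'rV[R]_n) :
    row_mx a%:M (- X) = a *: timev - row_mx 0 X :> 'rV[R]_(1 + n).
  rewrite /timev scale_row_mx scaler0 scale_scalar_mx mulr1 opp_row_mx oppr0.
  by rewrite add_row_mx addr0 add0r.
by rewrite !VE E mulmxBl -scalemxAl jacobian_timev.
Qed.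

(** The interval hypothesis enters here: both 0 and [t] lie in the slice over [p], and [s * t] lies
    between them, in an order that depends on the sign of [t]. *)
Lemma slice_segment : (forall p, D (0, p)) ->
  (forall p, is_interval [set t | D (t, p)]) ->
  forall c t x (s : R), chart_domain D c (event t x) -> 0 <= s <= 1 ->
  chart_domain D c (event (s * t) x).
Proof.
move=> D0 HI c t x s /chart_domainP [p [cp Dp px]] /andP [s0 s1].
apply/chart_domainP; exists p; split=> //.
have [t0|t0] := leP 0 t.
  by apply: (HI p 0 t (D0 p) Dp); rewrite mulr_ge0 //= ler_piMl.
have t0' := ltW t0; apply: (HI p t 0 Dp (D0 p)).
by rewrite ler_niMl //= mulr_ge0_le0.
Qed.

End spacetime_fields.

Theorem theorem3p1 (R : realType) (n : nat) (M : manifold R n)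
  (g W : chart_index M -> 'rV[R]_n -> 'M[R]_n)
  (U : chart_index M -> 'rV[R]_n -> 'rV[R]_n) (u : M -> R)
  (hdata : constraint_data g W U u)
  (lam : R * M -> R)
  (hlam : smooth_function (spacetime_charts M) setT lam)
  (hlam_pos : forall q, 0 < lam q)
  (D : set (R * M)) (hDopen : open D) (hD0 : forall p, D (0, p))
  (gt : chart_index M -> R -> 'rV[R]_n -> 'M[R]_n)
  (Ut : chart_index M -> R -> 'rV[R]_n -> 'rV[R]_n) (ut : R * M -> R)
  (hfam : smooth_families D gt Ut ut) :
  [/\ parallel_null_extension D lam g U gt Ut ut ->
        evolution_system D lam g W U u gt Ut ut,
      (forall p, is_interval [set t | D (t, p)]) ->
        evolution_system D lam g W U u gt Ut ut ->
        parallel_null_extension D lam g U gt Ut ut &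
      forall c t p, D (t, p) -> cdom (charts c) p ->
        let x := cfun (charts c) p in
        let laml := local_rep lam c in
        let Wt := weingarten laml (gt c) t x in
        forall X Y : 'rV[R]_n,
          bil (dt (gt c) t x) X (sharp (gt c t x) (dt (gt c) t x) Y) =
            4 * laml t x ^+ 2 * bil (gt c t x) (Wt X) (Wt Y) /\
          bil (dt (gt c) t x) X (sharp (gt c t x) (dt (gt c) t x) Y) =
            - 2 * laml t x * bil (dt (gt c) t x) (Wt X) Y].
Proof.
have oO c : open (chart_domain D c) by exact: open_chart_domain.
have [mf vf uf up'] := hfam.
have sg c : smooth_on (chart_domain D c) (spacetime (gt c)) by exact: smooth_metric_family.
have sU c : smooth_on (chart_domain D c) (spacetime (Ut c)) by exact: smooth_vector_family.
have su c : smooth_on (chart_domain D c) (spacetime (local_rep ut c)).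
  exact: smooth_local_rep.
have sl c := smooth_lapse (D := D) hlam (c := c).
have gT c := family_sym hfam (c := c).
have gu c := family_unit hfam (c := c).
have up c := length_gt0 hfam (c := c).
have u0 c := length_neq0 hfam (c := c).
have lp c y : chart_domain D c y -> 0 < spacetime (local_rep lam c) y.
  by move=> _; exact: lapse_gt0.
have l0 c y : chart_domain D c y -> spacetime (local_rep lam c) y != 0.
  by move=> _; exact: lapse_neq0.
(* The part of the chart at t = 0. As [D] contains {0} x M, it is the full image of the chart and
   hence open, so initial identities may be differentiated along the slice. *)
pose A (c : chart_index M) := cfun (charts c) @` cdom (charts c).
have oA c : open (A c) by exact: open_cimage.
have AO c x : A c x -> chart_domain D c (event 0 x).
  by case=> p cp <-; apply/chart_domainP; exists p.
have OA c t x : chart_domain D c (event t x) -> A c x.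
  by move=> /chart_domainP [p [cp _ <-]]; exists p.
have cons c x : A c x -> [/\ 0 < (u \o cinv (charts c)) x,
    (u \o cinv (charts c)) x ^+ 2 = bil (g c x) (U c x) (U c x) &
    forall X, nabla (g c) (U c) x X + (u \o cinv (charts c)) x *: (X *m W c x) = 0].
  case=> p cp <-; have [_ _ _ /(_ c p cp) [_ _ [p0 p2] p3]] := hdata.
  by rewrite /= cfunK.
have Dev c t p : D (t, p) -> cdom (charts c) p ->
    chart_domain D c (event t (cfun (charts c) p)).
  by move=> Dp cp; apply/chart_domainP; exists p.
split.
- move=> [lor Vf null par init].
  have nd c y : chart_domain D c y ->
      no_defect (gt c) (Ut c) (local_rep ut c) (local_rep lam c) y.
    move=> Oy; apply/(parallel_Vbar (oO c) (sg c) (sU c) (su c) (sl c) (gT c) (gu c)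
      (u0 c) (l0 c) Oy) => xi.
    move: Oy; rewrite -(event_coord y) => /chart_domainP [p [cp Dp <-]].
    exact: (par c (tcoord y, p) Dp cp).
  (* The null condition, freed of the lapse: the square of V is g(U, U) - u^2. *)
  have nul c y : chart_domain D c y -> spacetime (local_rep ut c) y ^+ 2 =
      bil (spacetime (gt c) y) (spacetime (Ut c) y) (spacetime (Ut c) y).
    move=> Oy; apply/esym/eqP; rewrite -subr_eq0 -(bil_Vbar _ _ _ (lp c) Oy).
    move: Oy; rewrite -(event_coord y) => /chart_domainP [p [cp Dp <-]].
    by have [-> _] := null c (tcoord y, p) Dp cp.
  split=> [c t p Dp cp|c p cp].
    exact: (no_defect_evolves (oO c) (sg c) (sU c) (su c) (sl c) (gT c) (gu c)
      (u0 c) (lp c) (nd c) (Dev c t p Dp cp)).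
  apply: (no_defect_initial (oO c) (sg c) (sl c) (gT c) (gu c) (up c) (lp c)
    (oA c) (AO c) (cons c) _ _ (nul c)); last by exists p.
    by move=> _ [q cq <-]; exact: init.
  by move=> x /AO; exact: nd.
- move=> HI [evo init].
  have seg := slice_segment hD0 HI.
  have ic c x : A c x -> initial_conditions (g c) (W c) (U c) (u \o cinv (charts c))
      (gt c) (Ut c) (local_rep ut c) (local_rep lam c) x.
    by case=> p cp <-; exact: init.
  have nd0 c x : chart_domain D c (event 0 x) ->
      no_defect (gt c) (Ut c) (local_rep ut c) (local_rep lam c) (event 0 x).
    move=> /OA Ax; exact: (initial_no_defect (oO c) (sg c) (sU c) (su c) (sl c) (gT c)
      (gu c) (up c) (lp c) (oA c) (AO c) (cons c) (ic c) Ax).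
  have ev c t x : chart_domain D c (event t x) ->
      evolves (gt c) (Ut c) (local_rep ut c) (local_rep lam c) t x.
    by move=> /chart_domainP [p [cp Dp <-]]; exact: evo.
  have nd c y (Oy : chart_domain D c y) :=
    evolves_no_defect (oO c) (sg c) (sU c) (su c) (sl c) (gT c) (gu c) (u0 c) (lp c)
      (seg c) (ev c) (nd0 c) Oy.
  have nul c y : chart_domain D c y -> spacetime (local_rep ut c) y ^+ 2 =
      bil (spacetime (gt c) y) (spacetime (Ut c) y) (spacetime (Ut c) y).
    apply: (null_propagates (sg c) (sU c) (su c) (gT c) (seg c) (nd c)).
    move=> x /OA Ax; have [[gE _] UE _ uE _] := ic c x Ax; have [_ E _] := cons c x Ax.
    by rewrite !spacetime_event gE UE uE.
  split.
  + exact: (lorentzian_metric_gbar hDopen hlam hlam_pos hfam).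
  + exact: (vector_field_Vbar hDopen hlam hlam_pos hfam).
  + move=> c [t p] Dp cp x; have Oy := Dev c t p Dp cp; split.
      have := bil_Vbar (gt c) (Ut c) (local_rep ut c) (lp c) Oy.
      by rewrite -(nul c _ Oy) subrr.
    exact: (Vbar_neq0 (Ut c) (up c) (lp c) Oy).
  + move=> c [t p] Dp cp; have Oy := Dev c t p Dp cp.
    exact/(parallel_Vbar (oO c) (sg c) (sU c) (su c) (sl c) (gT c) (gu c)
      (u0 c) (l0 c) Oy)/(nd c _ Oy).
  + by move=> c p cp x; have [[gE _] UE _ _ _] := init c p cp; exact: conj gE UE.
- move=> c t p Dp cp x laml Wt X Y; have Oy := Dev c t p Dp cp.
  have gx : (gt c t x)^T = gt c t x by have := gT c _ Oy; rewrite spacetime_event.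
  have gux : gt c t x \in unitmx by have := gu c _ Oy; rewrite spacetime_event.
  have lx : laml t x != 0 by have := l0 c _ Oy; rewrite spacetime_event.
  have sh Z V : bil (gt c t x) Z (sharp (gt c t x) (dt (gt c) t x) V) =
      bil (dt (gt c) t x) Z V by exact: bil_sharp.
  have dT : (dt (gt c) t x)^T = dt (gt c) t x.
    by rewrite dtE; exact: (derive_sym (oO c) (sg c) (gT c) timev Oy).
  (* Once the Weingarten operator is known as a multiple of the metric dual, both formulas reduce to
     self-adjointness of that dual and arithmetic in the lapse. *)
  have WE Z : Wt Z = - ((2 * laml t x)^-1 *: sharp (gt c t x) (dt (gt c) t x) Z).
    apply: (bil_nondegenerate gux) => V.
    rewrite (bil_weingarten (oO c) (sg c) (sl c) (gT c) (gu c) (l0 c) Z V Oy).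
    by rewrite bilNl bilZl (bilC _ V gx) sh (bilC V Z dT).
  have e1 : bil (gt c t x) (sharp (gt c t x) (dt (gt c) t x) X)
      (sharp (gt c t x) (dt (gt c) t x) Y) =
      bil (dt (gt c) t x) X (sharp (gt c t x) (dt (gt c) t x) Y).
    by rewrite (bilC _ _ gx) sh (bilC _ _ dT).
  have e2 := etrans (esym (sh (sharp (gt c t x) (dt (gt c) t x) X) Y)) e1.
  rewrite !WE !(bilNl, bilNr, bilZl, bilZr) e1 e2.
  by abstract_atoms; split; field.
Qed.
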